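(* Let $q_t$ solve $$\mathrm{d} q_t=\frac1\varepsilon(tq_t-q_t^3+\varepsilon)\,\mathrm{d} t+\frac{\sigma}{\sqrt\varepsilon}\,\mathrm{d} W_t .$$ There exist constants $c_1,\gamma>0$ such that, if $t_1=c_1\sqrt{\varepsilon|\ln\sigma|}$, then: (1) (Fast pulling) for any $\varepsilon=\varepsilon(\sigma)$ with $\sigma^{4/3}|\ln\sigma|^{2/3}\ll\varepsilon(\sigma)\ll1$, $$\lim_{\sigma\downarrow0}\liminf_{s\to-\infty}\mathbb{P}^{s}\Big\{\inf_{t_1\le t}\frac{q_t}{\sqrt t}>\gamma\Big\}=1;$$ (2) (Slow pulling) for any $\varepsilon=\varepsilon(\sigma)$ with $\sigma^2|\ln\sigma|^3\lesssim\varepsilon(\sigma)\ll\sigma^{4/3}|\ln\sigma|^{-13/6}$, $$\lim_{\sigma\downarrow0}\limsup_{s\to-\infty}\Big|\mathbb{P}^{s}\Big\{\inf_{t_1\le t}\frac{q_t}{\sqrt t}>\gamma\Big\}-\frac12\Big|=0 \quad\text{and}\quad \lim_{\sigma\downarrow0}\limsup_{s\to-\infty}\Big|\mathbb{P}^{s}\Big\{\sup_{t_1\le t}\frac{q_t}{\sqrt t}<-\gamma\Big\}-\frac12\Big|=0 .$$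
   Context: $W$ is a standard one-dimensional Brownian motion, $\sigma>0$ is the noise intensity and $\varepsilon=\varepsilon(\sigma)>0$ is a function of $\sigma$. For $s<0$, $\mathbb{P}^s$ denotes the law of the solution started at time $s$ from $q_s=0$. Notation: $x_1\ll x_2$ means $x_1=o(x_2)$ (as $\sigma\downarrow0$); $x_1\lesssim x_2$ means that there is a constant $c>0$ such that $c\,x_1\le x_2$ for $x_1,x_2>0$ sufficiently small (here, for $\sigma$ sufficiently small). *)

(* Defs.v *)
From HB Require Import structures.
From mathcomp Require Export all_boot all_order all_algebra.
From mathcomp Require Export all_classical all_reals all_analysis.
From mathcomp Require Export measurable_realfun.

Set Implicit Arguments.
Unset Strict Implicit.
Unset Printing Implicit Defensive.

Import Order.TTheory GRing.Theory Num.Theory.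
Import numFieldNormedType.Exports.

Local Open Scope classical_set_scope.
Local Open Scope ring_scope.

(* The product rule over the full finite family gives the one over every
   subfamily, since any of the [A i] may be taken to be [setT]. *)
Definition mutually_independent (R : realType) (d : measure_display)
    (T : measurableType d) (P : probability T R) (n : nat)
    (X : 'I_n -> {RV P >-> R}) : Prop :=
  forall A : 'I_n -> set R, (forall i, measurable (A i)) ->
    P [set w | forall i, A i (X i w)] = (\prod_(i < n) P (X i @^-1` A i))%E.
Arguments mutually_independent {R d T} P {n} X.

(* Only the times [r >= 0] matter.  The second argument of [normal_prob] is the
   standard deviation. *)
Record standard_brownian_motion (R : realType) (d : measure_display)
    (T : measurableType d) (P : probability T R)
    (B : R -> {RV P >-> R}) : Prop := {
  bm_start : {ae P, forall w, B 0 w = 0} ;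
  bm_continuous : forall w, {within `[0, +oo[, continuous (fun r : R => B r w)} ;
  bm_gaussian : forall (r1 r2 : R) (A : set R), 0 <= r1 -> r1 < r2 -> measurable A ->
    distribution P (B r2 - B r1) A = normal_prob 0 (Num.sqrt (r2 - r1)) A ;
  bm_independent : forall (n : nat) (r : nat -> R), 0 <= r 0%N ->
    {homo r : i j / (i <= j)%N >-> i <= j} ->
    mutually_independent P (fun i : 'I_n => B (r i.+1) - B (r i)) }.
Arguments standard_brownian_motion {R d T} P B.

(* [q] solves dq_t = (t q_t - q_t^3 + e) / e dt + sigma / sqrt e dW_t on
   [s, +oo) with q_s = 0.  The noise is additive, so the stochastic integral is
   (sigma / sqrt e) (W_t - W_s), and the equation is a pathwise integral
   equation with locally Lipschitz drift: it determines [q] from [W] up to a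
   null event, so adaptedness need not be required separately.  [W] is only
   used through its increments after time [s], which allows both a Brownian
   motion started at time [s] and a two-sided one.  All paths of [q] are
   continuous, which makes the infima and suprema over uncountable sets of times
   random variables. *)
Record solves_sde (R : realType) (d : measure_display) (T : measurableType d)
    (P : probability T R) (sigma e s : R) (W q : R -> {RV P >-> R}) : Prop := {
  sde_noise : standard_brownian_motion P (fun r : R => W (s + r) - W s) ;
  sde_continuous : forall w, {within `[s, +oo[, continuous (fun t : R => q t w)} ;
  sde_start : {ae P, forall w, q s w = 0} ;
  sde_equation : {ae P, forall w, forall t : R, s <= t ->
    q t w = q s w
      + (\int[lebesgue_measure]_(u in `[s, t])
           (e^-1 * (u * q u w - q u w ^+ 3 + e)))%R
      + sigma / Num.sqrt e * (W t w - W s w)} }.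
Arguments solves_sde {R d T} P sigma e s W q.

(* The events {inf_{t >= t1} q_t / sqrt t > g} and
   {sup_{t >= t1} q_t / sqrt t < - g}, with the infimum and the supremum taken
   in the extended reals. *)
Definition follows_upper (R : realType) (T : Type) (q : R -> T -> R)
    (t1 g : R) : set T :=
  [set w | (g%:E <
    ereal_inf [set (q t w / Num.sqrt t)%:E | t in [set t | (t1 <= t)%R]])%E].

Definition follows_lower (R : realType) (T : Type) (q : R -> T -> R)
    (t1 g : R) : set T :=
  [set w | (ereal_sup [set (q t w / Num.sqrt t)%:E | t in [set t | (t1 <= t)%R]]
    < (- g)%:E)%E].

Definition asymp_lesssim (R : realType) (f g : R -> R) : Prop :=
  exists2 c : R, 0 < c & \forall sigma \near 0^'+, c * f sigma <= g sigma.

(* Main.v *)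
(** In the variables v = t / sqrt eps, x = q / sqrt eps, with kap = sqrt eps and
    eta = sigma / eps^(3/4), the equation reads
    dx = (v x - kap x^3 + 1) dv + eta dB.  Multiplying by exp(-v^2/2) removes the
    linear term, so exp(-k^2/2) x_k is int_S^k exp(-v^2/2) (dv + eta dB) up to a cubic
    error which, by an a priori bound on x in terms of the growth of B, is
    O(kap (1 + eta)^3).  In the fast regime eta -> 0 and the drift makes x_k
    positive.  In the slow regime eta -> oo whereas kap eta^2 = sigma^2 / eps -> 0: the
    centred Gaussian term, approximated by Riemann sums, is of order eta and
    dominates, so x_k is of order +eta or -eta with probability about 1/2 each.
    Once x is large it grows by a factor 9/8 on every block
    [sqrt n, sqrt (n+1)], on which B oscillates by at most n^(1/4) by a chaining bound,
    until it reaches a quarter of the stable equilibrium sqrt (v / kap); this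
    happens before v^2 = 100 |ln sigma|, that is before t_1 when c_1 = 10.  The
    reflection x -> -x only changes the sign of the drift constant, and the two
    disjoint events each have probability at least 1/2 - o(1). *)

Require Import Defs.
From mathcomp Require Import ring lra.
Set Implicit Arguments.
Unset Strict Implicit.
Unset Printing Implicit Defensive.
Import Order.TTheory GRing.Theory Num.Theory.
Import numFieldNormedType.Exports.
Local Open Scope classical_set_scope.
Local Open Scope ring_scope.

(** * Linear regime *)

(** Every estimate must be uniform in the start time [S], which tends to minus infinity, so no
    constant may see the length of [[S, k]]. This dictates three choices. The noise is controlled
    only through linear growth, [|B v - B 0| <= L (1 + |v|)], because the probability that this
    fails is summable over unit shifts and hence free of [S]. The Gaussian weight turns polynomial
    errors into multiples of [1 / (1 + v ^ 2)], whose primitive [atan] varies by less than [4] on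
    the whole line. The variance of the Gaussian term is only bounded below, by what [[0, 1]]
    contributes. A second constraint is the order of the choices. The end [k = sqrt n0] of the
    linear stage depends on the tolerated probability [zeta] alone, so [wt k] is a fixed constant;
    only afterwards are [kap], [eta] or [1 / eta], and [kap * eta ^ 2] taken small against it.
    Outside one exceptional event the whole argument is pathwise: differential inequalities replace
    stopping times and the Markov property, and a mesh chosen path by path replaces the stochastic
    integral. *)

Lemma continuous_delta (R : realType) (phi : R -> R) (u e : R) :
  continuous phi -> 0 < e ->
  exists2 d, 0 < d & forall z, `|z - u| < d -> `|phi z - phi u| < e.
Proof.
move=> cphi e0; have /cvgrPdist_lt /(_ e e0) := cphi u.
move=> /nbhs_ballP[d /= d0 dP]; exists d => // z zu.
by rewrite distrC; apply: dP; rewrite /ball /= distrC.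
Qed.

Lemma derive_le0_antimono (R : realType) (phi dphi : R -> R) (a c : R) :
  continuous phi -> (forall v, a < v < c -> is_derive v 1 phi (dphi v)) ->
  (forall v, a < v < c -> dphi v <= 0) -> a <= c -> phi c <= phi a.
Proof.
move=> cphi dphiP dphi0; rewrite le_eqVlt => /predU1P[->//|ac].
have dP v : v \in `]a, c[ -> is_derive v 1 phi (dphi v).
  by rewrite in_itv/=; exact: dphiP.
have [v] := MVT ac dP (continuous_subspaceT cphi).
rewrite in_itv/= => vac E; rewrite -subr_le0 E.
by rewrite mulr_le0_ge0 ?dphi0// subr_ge0 ltW.
Qed.

(** After the last time [u0] with [phi <= 0], continuity keeps [phi] in the strip [0 < phi < r] for
    a while, and there it cannot increase. Restricting the test to a strip matters in
    [block_growth], where closeness to the barrier yields the upper bound on [x] that controls the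
    cubic term. *)
Lemma barrier (R : realType) (phi dphi : R -> R) (a c r : R) :
  0 < r -> continuous phi ->
  (forall v, a < v < c -> is_derive v 1 phi (dphi v)) ->
  phi a <= 0 -> (forall v, a < v < c -> 0 < phi v < r -> dphi v <= 0) ->
  forall v, a <= v <= c -> phi v <= 0.
Proof.
move=> r0 cphi dphiP phia dphi0 v /andP[av vc].
rewrite leNgt; apply/negP => phiv.
pose E := [set u | a <= u <= v /\ phi u <= 0].
have Ea : E a by split; rewrite ?lexx.
have hE : has_sup E.
  by split; [exists a|exists v => u [/andP[_ ->]]].
set u0 := sup E.
have au0 : a <= u0 by apply: ub_le_sup => //; case: hE.
have u0v : u0 <= v by apply: sup_le_ub; [exists a|move=> u [/andP[_ ->]]].
have phiu0 : phi u0 <= 0.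
  rewrite leNgt; apply/negP => p0.
  have [d d0 dP] := continuous_delta u0 cphi p0.
  have [u [/andP[au uv] pu] uu0] := sup_adherent d0 hE.
  rewrite -/u0 in uu0.
  have uu0' : u <= u0 by apply: ub_le_sup; [case: hE|split=> //; rewrite au].
  have := dP u; rewrite !ltr_norml => /(_ _)/andP[|+ _].
    by apply/andP; split; lra.
  by lra.
have u0v' : u0 < v.
  by rewrite lt_neqAle u0v andbT; apply/eqP => e; move: phiv; rewrite -e; lra.
have pos u : u0 < u <= v -> 0 < phi u.
  move=> /andP[u0u uv]; rewrite ltNge; apply/negP => pu.
  have : u <= u0 by apply: ub_le_sup; [case: hE|split=> //; rewrite uv; lra].
  by lra.
have [d d0 dP] := continuous_delta u0 cphi r0.
pose w := Num.min v (u0 + d / 2).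
have wv : w <= v by rewrite /w ge_min lexx.
have wd : w <= u0 + d / 2 by rewrite /w ge_min lexx orbT.
have u0w : u0 < w by rewrite /w lt_min u0v' /=; lra.
have : phi w <= phi u0.
  apply: (@derive_le0_antimono _ _ dphi) => // [z zz|z zz|]; last exact: ltW.
    by apply: dphiP; lra.
  apply: dphi0; first lra.
  have := dP z; rewrite !ltr_norml => /(_ _)/andP[|_ h].
    by apply/andP; split; lra.
  by rewrite pos /=; lra.
by have := pos w; rewrite u0w wv => /(_ isT); lra.
Qed.

Definition wt (R : realType) (v : R) : R := expR (- (v ^+ 2 / 2)).

Lemma wt_gt0 (R : realType) (v : R) : 0 < wt v. Proof. exact: expR_gt0. Qed.

Lemma wt_le1 (R : realType) (v : R) : wt v <= 1.
Proof. by rewrite /wt -[leRHS]expR0 ler_expR oppr_le0 divr_ge0// sqr_ge0. Qed.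

Lemma is_derive_wt (R : realType) (v : R) : is_derive v 1 (@wt R) (- v * wt v).
Proof.
rewrite /wt; have -> : (fun v : R => expR (- (v ^+ 2 / 2))) =
  expR \o (fun v : R => (- 2^-1) *: (v ^+ 2)).
  by apply/funext => z /=; congr expR; rewrite /GRing.scale/=; lra.
apply: is_derive_eq.
rewrite /GRing.scale/= /GRing.scale/=.
rewrite (_ : - 2^-1 * v ^+ 2 = - (v ^+ 2 / 2)); last by lra.
by field.
Qed.

Lemma continuous_wt (R : realType) : continuous (@wt R).
Proof.
move=> v; apply/differentiable_continuous/derivable1_diffP.
by have [] := is_derive_wt v.
Qed.

(** The constant comes from [1 + v ^+ 2 / 8 <= expR (v ^+ 2 / 8)] raised to the fourth power. Three
    of the four powers of [1 + v ^+ 2] serve the cube of a quadratic bound on the path; the fourth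
    leaves a factor [1 / (1 + v ^+ 2)] that is integrable over the line. *)
Definition wbd (R : realType) : R := 8 ^+ 4.

Lemma wbd_ge0 (R : realType) : 0 <= wbd R. Proof. exact: exprn_ge0. Qed.

Lemma wt_poly (R : realType) (v : R) : (1 + v ^+ 2) ^+ 4 * wt v <= wbd R.
Proof.
have v0 := sqr_ge0 v.
have h : (1 + v ^+ 2 / 8) ^+ 4 * wt v <= 1.
  have -> : wt v = (expR (v ^+ 2 / 8) ^+ 4)^-1.
    by rewrite -expRM_natl -expRN; congr expR; field.
  rewrite ler_pdivrMr ?exprn_gt0 ?expR_gt0// mul1r lerXn2r ?nnegrE ?expR_ge0//.
    by lra.
  by rewrite expR_ge1Dx.
rewrite /wbd -[leRHS]mulr1.
apply: (@le_trans _ _ (8 ^+ 4 * ((1 + v ^+ 2 / 8) ^+ 4 * wt v))); last first.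
  by rewrite ler_wpM2l// exprn_ge0.
rewrite mulrA -exprMn.
have -> : 8 * (1 + v ^+ 2 / 8) = 8 + v ^+ 2 by field.
by rewrite ler_pM2r ?wt_gt0// lerXn2r ?nnegrE; lra.
Qed.

(* [dx = (v x - kap x^3 + rho) dv + db] for a merely continuous forcing [b], which
   is why [b] is subtracted before differentiating. *)
Definition langevin (R : realType) (kap rho S : R) (b x : R -> R) : Prop :=
  [/\ continuous b, continuous x & forall v, S < v ->
    is_derive v 1 (fun u => x u - b u) (v * x v - kap * x v ^+ 3 + rho)].

Lemma langevinN (R : realType) (kap rho S : R) (b x : R -> R) :
  langevin kap rho S b x ->
  langevin kap (- rho) S (fun v => - b v) (fun v => - x v).
Proof.
move=> [cb cx dx]; split => [v|v|v Sv]; [by apply: (@cvgN _ R^o); exact: cb|by apply: (@cvgN _ R^o); exact: cx|].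
have hd := dx v Sv.
rewrite (_ : (fun u => _) = (- (fun u => x u - b u))); last first.
  by apply/funext => u; rewrite fctE; lra.
by apply: is_derive_eq; ring.
Qed.

(** * A quadratic bound on the path, uniform in the start time *)

Section apriori.
Variables (R : realType) (kap rho S k beta : R) (b x : R -> R).
Hypotheses (kap0 : 0 <= kap) (rho1 : `|rho| <= 1) (S0 : S <= 0) (k0 : 0 <= k)
  (beta0 : 0 <= beta).
Hypothesis bP : forall v, S <= v <= k -> `|b v| <= beta * (1 + `|v|).

(** A quadratic without real roots: positive on the whole line and eventually above any forcing of
    linear growth. It does not involve [kap], because at the barrier [x >= 0] and the cubic term
    pushes the path down. *)
Let G (v : R) : R := 4 * (1 + beta) * (2 + v + v ^+ 2).

Let is_derive_G (v : R) : is_derive v 1 G (4 * (1 + beta) * (1 + 2 * v)).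
Proof.
rewrite /G; apply: is_derive_eq.
rewrite /GRing.scale/= /GRing.scale/=; ring.
Qed.

Let continuous_G : continuous G.
Proof.
move=> v; apply/differentiable_continuous/derivable1_diffP.
by have [] := is_derive_G v.
Qed.

(** For [v <= 0] the linear drift [v * x v] is confining: along the barrier it outweighs both the
    forcing and the slope of [G], which is negative far to the left. The difference [x - b] is
    compared because it is what is differentiable. *)
Lemma apriori_nonpos : langevin kap rho S b x -> x S = 0 ->
  forall v, S <= v <= 0 -> x v - b v <= 4 * (1 + beta) * (2 + v + v ^+ 2).
Proof.
move=> [cb cx dx] xS v vS0.
suff : x v - b v - G v <= 0 by rewrite /G; lra.
move: v vS0; apply: (@barrier _ (fun v => x v - b v - G v)
   (fun v => v * x v - kap * x v ^+ 3 + rho - 4 * (1 + beta) * (1 + 2 * v)) S 0 1) => //.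
- move=> v; apply: cvgB; last exact: continuous_G.
  by apply: cvgB; [exact: cx|exact: cb].
- move=> v /andP[Sv _]; have hd := dx v Sv; have hG := is_derive_G v.
  by apply: is_derive_eq.
- have /(_ S) := bP; rewrite lexx (le_trans S0 k0) xS => /(_ isT).
  rewrite (ler0_norm S0) ler_norml /G => /andP[b1 _].
  have : 0 <= beta * (7 + 5 * S + 4 * S ^+ 2).
    by rewrite mulr_ge0//; have := sqr_ge0 (S + 5 / 8); lra.
  by have := sqr_ge0 (S + 1 / 2); lra.
move=> v /andP[Sv v0] /andP[p _].
have := bP (v := v); rewrite (ltW Sv) (le_trans (ltW v0) k0) => /(_ isT).
rewrite (ltr0_norm v0) ler_norml => /andP[b1 b2].
move: rho1; rewrite ler_norml => /andP[r1 r2].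
rewrite /G in p.
have xlo : G v - beta * (1 - v) <= x v by rewrite /G; lra.
have x0 : 0 <= x v.
  apply: le_trans xlo; rewrite /G.
  have : 0 <= beta * (7 + 5 * v + 4 * v ^+ 2).
    by rewrite mulr_ge0//; have := sqr_ge0 (v + 5 / 8); lra.
  by have := sqr_ge0 (v + 1 / 2); lra.
have : 0 <= kap * x v ^+ 3 by rewrite mulr_ge0 ?exprn_ge0.
have : v * x v <= v * (G v - beta * (1 - v)) by rewrite ler_nM2l.
(* With [x v] replaced by its lower bound, the coefficient of [beta] in the drift minus the slope of
   [G] is exactly [- ((v + 1) ^+ 2 * (3 - 4 * v) + 1 - v)]. *)
have m2 : 0 <= (v + 1) ^+ 2 * (3 - 4 * v) by rewrite mulr_ge0 ?sqr_ge0//; lra.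
have : 0 <= beta * ((v + 1) ^+ 2 * (3 - 4 * v) + 1 - v) by rewrite mulr_ge0//; lra.
by have := sqr_ge0 v; rewrite /G; lra.
Qed.

(** For [v >= 0] the linear drift is expanding, so the weighted difference is compared. Its
    derivative keeps only [v * b v], the cubic term and [rho], each multiplied by [wt v], and the
    growing slope of [G] dominates them. *)
Lemma apriori_nonneg : langevin kap rho S b x -> x S = 0 ->
  forall v, 0 <= v <= k -> wt v * (x v - b v) <= 4 * (1 + beta) * (2 + v + v ^+ 2).
Proof.
move=> L xS; have [cb cx dx] := L => v vS0.
suff : wt v * (x v - b v) - G v <= 0 by rewrite /G; lra.
move: v vS0; apply: (@barrier _ (fun v => wt v * (x v - b v) - G v)
   (fun v => wt v * (v * b v - kap * x v ^+ 3 + rho) - 4 * (1 + beta) * (1 + 2 * v)) 0 k 1) => //.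
- move=> v; apply: cvgB; last exact: continuous_G.
  apply: cvgM; first exact: continuous_wt.
  by apply: cvgB; [exact: cx|exact: cb].
- move=> v /andP[v0 _]; have hd := dx v (le_lt_trans S0 v0).
  have hG := is_derive_G v; have hw := is_derive_wt v.
  by apply: is_derive_eq; rewrite /GRing.scale/=; ring.
- have /(_ 0) := apriori_nonpos L xS; rewrite S0 lexx => /(_ isT).
  by rewrite /G /wt expr0n mul0r oppr0 expR0; lra.
move=> v /andP[v0 vk] /andP[p _].
have := bP (v := v); rewrite (le_trans S0 (ltW v0)) (ltW vk) => /(_ isT).
rewrite (gtr0_norm v0) ler_norml => /andP[b1 b2].
move: rho1; rewrite ler_norml => /andP[r1 r2].
have w0 := wt_gt0 v; have w1 := wt_le1 v.
have v2 := sqr_ge0 v.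
(* As [wt v <= 1], lying above the barrier after weighting implies lying above it before; this gives
   the sign of [x v]. *)
have ylo : G v <= x v - b v.
  rewrite leNgt; apply/negP => lt.
  have G0 : 0 <= G v by rewrite /G !mulr_ge0// ?addr_ge0// ltW.
  have : wt v * (x v - b v) <= wt v * G v by rewrite ler_pM2l// ltW.
  have : wt v * G v <= 1 * G v by rewrite ler_wpM2r.
  lra.
have x0 : 0 <= x v.
  have : 0 <= beta * (7 + 3 * v + 4 * v ^+ 2) by rewrite mulr_ge0//; lra.
  by move: ylo; rewrite /G; lra.
have : 0 <= kap * x v ^+ 3 by rewrite mulr_ge0 ?exprn_ge0.
have wv2 : wt v * (1 + v ^+ 2 / 2) <= 1.
  by rewrite /wt expRN mulrC ler_pdivrMr ?expR_gt0// mul1r expR_ge1Dx.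
have vb : v * b v <= v * (beta * (1 + v)) by rewrite ler_pM2l.
move=> x30.
have : wt v * (v * b v - kap * x v ^+ 3 + rho) <= wt v * (beta * (v + v ^+ 2) + 1).
  by rewrite ler_pM2l//; lra.
have : wt v * v <= 1 * v by rewrite ler_pM2r.
have : wt v * v ^+ 2 <= 2 by lra.
move=> h1 h2.
have : beta * (wt v * v + wt v * v ^+ 2) <= beta * (v + 2) by rewrite ler_wpM2l//; lra.
have := mulr_ge0 beta0 (ltW v0).
lra.
Qed.

End apriori.

Lemma apriori_upper (R : realType) (kap rho S k beta : R) (b x : R -> R) :
  0 <= kap -> `|rho| <= 1 -> S <= 0 -> 0 <= k -> 0 <= beta ->
  (forall v, S <= v <= k -> `|b v| <= beta * (1 + `|v|)) ->
  langevin kap rho S b x -> x S = 0 ->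
  forall v, S <= v <= k -> wt k * x v <= 12 * (1 + beta) * (1 + v ^+ 2).
Proof.
move=> kap0 rho1 S0 k0 beta0 bP L xS v /[dup] vSk /andP[Sv vk].
have := bP v vSk; rewrite ler_norml => /andP[_ bv].
have w0 := wt_gt0 k; have w1 := wt_le1 k.
have v20 := sqr_ge0 v.
have vv : `|v| <= (1 + v ^+ 2) / 2.
  by have := sqr_ge0 (`|v| - 1); rewrite sqrrB real_normK ?num_real//; lra.
have bv2 : b v <= beta * (3 / 2 + v ^+ 2 / 2).
  by apply: le_trans bv _; rewrite ler_wpM2l//; lra.
have vle : v <= (1 + v ^+ 2) / 2 by apply: le_trans vv; exact: ler_norm.
have Gb : 4 * (1 + beta) * (2 + v + v ^+ 2) <= 4 * (1 + beta) * (5 / 2 + 3 / 2 * v ^+ 2).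
  by rewrite ler_wpM2l//; lra.
have bv20 : 0 <= beta * v ^+ 2 by rewrite mulr_ge0.
have wb : wt k * b v <= beta * (3 / 2 + v ^+ 2 / 2).
  apply: (@le_trans _ _ (wt k * (beta * (3 / 2 + v ^+ 2 / 2)))).
    by rewrite ler_pM2l.
  by rewrite ler_piMl// mulr_ge0//; lra.
suff : wt k * (x v - b v) <= 4 * (1 + beta) * (2 + v + v ^+ 2) by lra.
have Gp : 0 <= 4 * (1 + beta) * (2 + v + v ^+ 2).
  by rewrite !mulr_ge0//; have := sqr_ge0 (v + 1 / 2); lra.
have [y0|/ltW y0] := leP (x v - b v) 0.
  by apply: le_trans Gp; rewrite pmulr_rle0.
have [v0|v0] := leP v 0.
  have := @apriori_nonpos _ kap rho S k beta b x kap0 rho1 S0 k0 beta0 bP L xS v.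
  rewrite Sv v0 => /(_ isT); apply: le_trans.
  by rewrite ler_piMl.
have := @apriori_nonneg _ kap rho S k beta b x kap0 rho1 S0 k0 beta0 bP L xS v.
rewrite (ltW v0) vk => /(_ isT); apply: le_trans.
rewrite ler_wpM2r// ler_expR lerN2 ler_pM2r// lerXn2r ?nnegrE//; exact: ltW.
Qed.

(** The lower side is the upper side for the reflected equation. With the weight frozen at the end
    point [k], the path is at most quadratic on [[S, k]] with a constant that depends neither on [S]
    nor on [kap]. *)
Lemma apriori_norm (R : realType) (kap rho S k beta : R) (b x : R -> R) :
  0 <= kap -> `|rho| <= 1 -> S <= 0 -> 0 <= k -> 0 <= beta ->
  (forall v, S <= v <= k -> `|b v| <= beta * (1 + `|v|)) ->
  langevin kap rho S b x -> x S = 0 ->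
  forall v, S <= v <= k -> wt k * `|x v| <= 12 * (1 + beta) * (1 + v ^+ 2).
Proof.
move=> kap0 rho1 S0 k0 beta0 bP L xS v vSk.
have w0 := wt_gt0 k.
rewrite -[X in X * _]gtr0_norm// -normrM ler_norml (apriori_upper _ _ _ _ _ bP L)// andbT.
have bPN u : S <= u <= k -> `|- b u| <= beta * (1 + `|u|) by rewrite normrN; exact: bP.
rewrite lerNl -mulrN.
have := apriori_upper kap0 _ S0 k0 beta0 bPN (langevinN L); apply => //.
  by rewrite normrN.
by rewrite xS oppr0.
Qed.

(** A defect [K / (1 + v ^+ 2)] in the derivative is the derivative of [K * atan], so for [K >= 0]
    it costs at most [4 * K] over intervals of any length. *)
Lemma atan_increment (R : realType) (h dh : R -> R) (p q c K : R) :
  continuous h -> (forall v, p < v < q -> is_derive v 1 h (dh v)) ->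
  (forall v, p < v < q -> c - K / (1 + v ^+ 2) <= dh v) -> p <= q ->
  c * (q - p) - K * (atan q - atan p) <= h q - h p.
Proof.
move=> ch dhP dhK pq.
have catan : continuous (@atan R) by move=> v; exact: continuous_atan.
suff : c * q - h q - K * atan q <= c * p - h p - K * atan p by lra.
apply: (@derive_le0_antimono _ (fun v => c * v - h v - K * atan v)
  (fun v => c - dh v - K * (1 + v ^+ 2)^-1) p q _ _ _ pq).
- move=> v; apply: cvgB; last by apply: cvgM; [exact: cvg_cst|exact: catan].
  apply: cvgB; last exact: ch.
  by apply: cvgM; [exact: cvg_cst|exact: cvg_id].
- move=> v pvq; have hh := dhP v pvq.
  by apply: is_derive_eq; rewrite /GRing.scale/=; ring.
- by move=> v /dhK; lra.
Qed.

Section linear_regime.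
Variables (R : realType) (kap rho S k beta : R) (b x : R -> R).
Hypotheses (kap0 : 0 <= kap) (rho1 : `|rho| <= 1) (S0 : S <= 0) (k0 : 0 <= k)
  (beta0 : 0 <= beta).
Hypothesis bP : forall v, S <= v <= k -> `|b v| <= beta * (1 + `|v|).
Hypothesis L : langevin kap rho S b x.
Hypothesis xS : x S = 0.

(** The cube of the a priori bound, its polynomial part absorbed by [wbd]. It is cubic in
    [1 + beta]; with [beta] of order [eta], large in the slow regime, [kap * cubic_cst] is then of
    order [kap * eta ^ 3], which is small against [eta] because [kap * eta ^ 2] is small. *)
Definition cubic_cst : R := wbd R * (12 * (1 + beta) / wt k) ^+ 3.

Lemma cubic_cst_ge0 : 0 <= cubic_cst.
Proof.
apply: mulr_ge0; first exact: wbd_ge0.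
apply: exprn_ge0; apply: divr_ge0; last exact/ltW/wt_gt0.
apply: mulr_ge0; first exact: ler0n.
exact: addr_ge0.
Qed.

Lemma weighted_poly (v : R) : wt v * (1 + v ^+ 2) ^+ 3 <= wbd R / (1 + v ^+ 2).
Proof.
have v2 : 0 < 1 + v ^+ 2 by have := sqr_ge0 v; lra.
by rewrite ler_pdivlMr// -mulrA -exprSr mulrC wt_poly.
Qed.

Lemma weighted_cubic v : S <= v <= k ->
  wt v * (kap * `|x v| ^+ 3) <= kap * cubic_cst / (1 + v ^+ 2).
Proof.
move=> vSk; rewrite mulrCA -mulrA ler_wpM2l//.
have v2 : 0 < 1 + v ^+ 2 by have := sqr_ge0 v; lra.
have h := apriori_norm kap0 rho1 S0 k0 beta0 bP L xS vSk.
have w0 := wt_gt0 k.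
have h3 : (wt k * `|x v|) ^+ 3 <= (12 * (1 + beta) * (1 + v ^+ 2)) ^+ 3.
  rewrite lerXn2r ?nnegrE ?mulr_ge0 ?addr_ge0 ?sqr_ge0//; exact: ltW.
have -> : `|x v| ^+ 3 = (wt k * `|x v|) ^+ 3 / wt k ^+ 3.
  by rewrite exprMn mulrAC divff ?mul1r// expf_eq0 gt_eqF.
apply: (@le_trans _ _ (wt v * ((12 * (1 + beta) * (1 + v ^+ 2)) ^+ 3 / wt k ^+ 3))).
  apply: ler_wpM2l; first exact/ltW/wt_gt0.
  apply: ler_wpM2r h3; rewrite invr_ge0; exact/exprn_ge0/ltW.
have -> : wt v * ((12 * (1 + beta) * (1 + v ^+ 2)) ^+ 3 / wt k ^+ 3) =
   (12 * (1 + beta) / wt k) ^+ 3 * (wt v * (1 + v ^+ 2) ^+ 3).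
  by field; rewrite gt_eqF.
have -> : cubic_cst / (1 + v ^+ 2) =
  (12 * (1 + beta) / wt k) ^+ 3 * (wbd R / (1 + v ^+ 2)).
  by rewrite /cubic_cst mulrAC mulrC.
apply: ler_wpM2l; last exact: weighted_poly.
apply: exprn_ge0; apply: divr_ge0; last exact: ltW.
apply: mulr_ge0; first exact: ler0n.
exact: addr_ge0.
Qed.

Lemma weighted_cubic_norm v : S <= v <= k ->
  `|wt v * (kap * x v ^+ 3)| <= kap * cubic_cst / (1 + v ^+ 2).
Proof.
move=> vSk; rewrite normrM [`|kap * _|]normrM normrX (gtr0_norm (wt_gt0 v)) (ger0_norm kap0).
exact: weighted_cubic.
Qed.

Lemma weighted_lin (c v : R) : 0 <= c -> wt v * (c * (1 + v ^+ 2)) <= wbd R * c / (1 + v ^+ 2).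
Proof.
move=> c0; have v2 : 1 <= 1 + v ^+ 2 by have := sqr_ge0 v; lra.
rewrite mulrCA [wbd R * c]mulrC -mulrA; apply: ler_wpM2l => //.
apply: le_trans (weighted_poly v); apply: ler_wpM2l; first exact/ltW/wt_gt0.
by apply: le_trans (ler_weXn2l v2 (isT : 1 <= 3)%N); rewrite expr1.
Qed.

(** The summand [om + 1] collects the oscillation of the forcing on a block and the constant drift
    [rho]. In the slow regime neither tends to zero; they are only small against [eta]. *)
Definition defect_rate (om : R) : R := wbd R * (om + 1) + kap * cubic_cst.

Local Notation K := defect_rate.

(** Freezing the forcing at the right end point gives [h q = wt q * x q] and
    [h p = wt p * (x p + b q - b p)]. The increment of [h] is thus that of [wt * x] less one Riemann
    term weighted at the left end point, while its derivative sees only the difference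
    [b v - b q]. *)
Lemma block_estimate (p q om : R) : S <= p -> p <= q -> q <= k -> 0 <= om ->
  (forall v, p <= v <= q -> `|b v - b q| <= om) ->
  `|wt q * x q - wt p * x p - wt p * (b q - b p)| <= K om * (atan q - atan p).
Proof.
move=> Sp pq qk om0 omP; have [cb cx dx] := L.
pose h v := wt v * (x v - b v + b q).
pose dh v := wt v * (v * (b v - b q)) - wt v * (kap * x v ^+ 3) + wt v * rho.
have ch : continuous h.
  move=> v; apply: cvgM; first exact: continuous_wt.
  apply: cvgD; last exact: cvg_cst.
  by apply: cvgB; [exact: cx|exact: cb].
have dhP v : p < v < q -> is_derive v 1 h (dh v).
  move=> /andP[pv _]; have hd := dx v (le_lt_trans Sp pv).
  have hw := is_derive_wt v; rewrite /h.
  by apply: is_derive_eq; rewrite /dh /GRing.scale/=; ring.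
have dhK v : p < v < q -> `|dh v| <= K om * (1 + v ^+ 2)^-1.
  move=> /andP[pv vq].
  have vSk : S <= v <= k by rewrite (le_trans Sp (ltW pv)) (le_trans (ltW vq) qk).
  have h1 := weighted_cubic_norm vSk.
  have h2 : `|wt v * (v * (b v - b q))| + `|wt v * rho| <= wbd R * (om + 1) / (1 + v ^+ 2).
    rewrite !normrM (gtr0_norm (wt_gt0 v)) -mulrDr.
    apply: le_trans (weighted_lin v _); last by rewrite addr_ge0.
    rewrite ler_wpM2l ?(ltW (wt_gt0 v))//.
    have vv : `|v| <= 1 + v ^+ 2.
      by have := sqr_ge0 (`|v| - 1); rewrite sqrrB real_normK ?num_real//; have := sqr_ge0 v; lra.
    have : `|v| * `|b v - b q| <= (1 + v ^+ 2) * om.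
      by rewrite ler_pM// omP// !ltW.
    by have := sqr_ge0 v; move: rho1; lra.
  rewrite /defect_rate mulrDl /dh; apply: (le_trans (ler_normD _ _)).
  apply: (le_trans (lerD (ler_normB _ _) (lexx _))).
  by rewrite addrAC; apply: lerD.
have up : 0 * (q - p) - K om * (atan q - atan p) <= h q - h p.
  by apply: (atan_increment ch dhP _ pq) => v /dhK; rewrite ler_norml; lra.
have lo : 0 * (q - p) - K om * (atan q - atan p) <= - h q - (- h p).
  apply: (atan_increment (h := fun v => - h v) (dh := fun v => - dh v) _ _ _ pq).
  - by move=> v; apply: (@cvgN _ R^o); exact: ch.
  - move=> v pvq; have hh := dhP v pvq.
    by apply: is_derive_eq; rewrite /GRing.scale/=; ring.
  - by move=> v /dhK; rewrite ler_norml; lra.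
by move: up lo; rewrite /h ler_norml => up lo; apply/andP; split; lra.
Qed.

Lemma atan_diff_le4 (p q : R) : atan q - atan p <= 4.
Proof.
have := atan_gtNpi2 p; have := atan_ltpi2 q; have := @pihalf_lt2 R.
lra.
Qed.

(** The block errors telescope through [atan], so the total depends neither on the number of grid
    points nor on [S]. *)
Lemma riemann_estimate (n : nat) (u : nat -> R) (om : R) : 0 <= om ->
  {homo u : i j / (i <= j)%N >-> i <= j} -> u 0 = S -> u n = k ->
  (forall i, (i < n)%N -> forall v, u i <= v <= u i.+1 ->
     `|b v - b (u i.+1)| <= om) ->
  `|wt k * x k - \sum_(i < n) wt (u i) * (b (u i.+1) - b (u i))| <= 4 * K om.
Proof.
move=> om0 homou u0 un omP.
have K0 : 0 <= K om.
  apply: addr_ge0; apply: mulr_ge0 => //; [exact: wbd_ge0|exact: addr_ge0|].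
  exact: cubic_cst_ge0.
suff /(_ n (leqnn n)) : forall m, (m <= n)%N ->
    `|wt (u m) * x (u m) - \sum_(i < m) wt (u i) * (b (u i.+1) - b (u i))|
    <= K om * (atan (u m) - atan (u 0)).
  by rewrite un => /le_trans; apply; rewrite [4 * _]mulrC ler_wpM2l ?atan_diff_le4.
elim => [_|m IH mn].
  by rewrite big_ord0 u0 xS mulr0 subrr normr0 subrr mulr0.
have := IH (ltnW mn).
have : `|wt (u m.+1) * x (u m.+1) - wt (u m) * x (u m)
   - wt (u m) * (b (u m.+1) - b (u m))| <= K om * (atan (u m.+1) - atan (u m)).
  apply: block_estimate => //; first by rewrite -u0 homou.
  - exact: homou.
  - by rewrite -un homou.
  - exact: omP.
by rewrite big_ord_recr/= !ler_norml; lra.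
Qed.

End linear_regime.

Section fast_regime.
Variables (R : realType) (kap S k beta : R) (b x : R -> R).
Hypotheses (kap0 : 0 <= kap) (S0 : S <= 0) (k1 : 1 <= k) (beta0 : 0 <= beta).
Hypothesis bP : forall v, S <= v <= k -> `|b v| <= beta * (1 + `|v|).
Hypothesis L : langevin kap 1 S b x.
Hypothesis xS : x S = 0.

Definition fast_defect : R := 2 * wbd R * beta + kap * cubic_cst k beta.

Local Notation K := fast_defect.
Let k0 : 0 <= k. Proof. exact: le_trans k1. Qed.
Let rho1 : `|1 : R| <= 1. Proof. by rewrite normr1. Qed.

Let increment (p q c : R) : S <= p -> p <= q -> q <= k ->
  (forall v, p < v < q -> c <= wt v) ->
  c * (q - p) - K * (atan q - atan p) <=
    wt q * (x q - b q) - wt p * (x p - b p).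
Proof.
move=> Sp pq qk cP; have [cb cx dx] := L.
apply: (@atan_increment _ (fun v => wt v * (x v - b v))
  (fun v => wt v * (v * b v - kap * x v ^+ 3 + 1)) p q c K _ _ _ pq).
- move=> v; apply: cvgM; first exact: continuous_wt.
  by apply: cvgB; [exact: cx|exact: cb].
- move=> v /andP[pv vq]; have hd := dx v (le_lt_trans Sp pv).
  have hw := is_derive_wt v.
  by apply: is_derive_eq; rewrite /GRing.scale/=; ring.
move=> v /andP[pv vq].
have vSk : S <= v <= k by rewrite (le_trans Sp (ltW pv)) (le_trans (ltW vq) qk).
have := weighted_cubic_norm kap0 rho1 S0 k0 beta0 bP L xS vSk.
have h2 : `|wt v * (v * b v)| <= wbd R * (2 * beta) / (1 + v ^+ 2).
  rewrite !normrM (gtr0_norm (wt_gt0 v)).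
  apply: le_trans (weighted_lin v _); last by rewrite mulr_ge0.
  rewrite ler_wpM2l ?(ltW (wt_gt0 v))//.
  have v2 := sqr_ge0 v.
  have vv : `|v| + `|v| ^+ 2 <= 2 * (1 + v ^+ 2).
    by have := sqr_ge0 (`|v| - 1); rewrite sqrrB real_normK ?num_real//; lra.
  apply: (@le_trans _ _ (`|v| * (beta * (1 + `|v|)))); first by rewrite ler_wpM2l// bP.
  have : beta * (`|v| + `|v| ^+ 2) <= beta * (2 * (1 + v ^+ 2)) by rewrite ler_wpM2l.
  by lra.
move: h2; have := cP v; rewrite pv vq => /(_ isT).
rewrite /fast_defect !ler_norml; lra.
Qed.

(** [4 * K] pays for the increment of [atan] over [[S, k]], and [4 * wbd R * beta] for the two
    boundary terms [wt * b] at [S] and [k]. *)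
Lemma fast_pulling_estimate : 1 / 2 - 4 * K - 4 * wbd R * beta <= wt k * x k.
Proof.
have K0 : 0 <= K.
  apply: addr_ge0; apply: mulr_ge0 => //; last exact: cubic_cst_ge0.
  by apply: mulr_ge0 => //; exact: wbd_ge0.
(* The drift [1] is kept only on [[0, 1]], where [wt >= 1 / 2]; on the two outer pieces the weight
   is bounded below by [0]. *)
have h1 := @increment S 0 0 (lexx S) S0 k0.
have h2 := @increment 0 1 (1 / 2) S0 ler01 k1.
have h3 := @increment 1 k 0 (le_trans S0 ler01) k1 (lexx k).
have {}h1 := h1 (fun v _ => ltW (wt_gt0 v)).
have {}h3 := h3 (fun v _ => ltW (wt_gt0 v)).
have {}h2 : 1 / 2 * (1 - 0) - K * (atan 1 - atan 0) <=
   wt 1 * (x 1 - b 1) - wt 0 * (x 0 - b 0).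
  apply: h2 => v /andP[v0 v1].
  apply: le_trans (expR_ge1Dx _).
  have : v ^+ 2 <= 1 by rewrite expr_le1 ?ltW.
  by lra.
have wtb v : S <= v <= k -> `|wt v * b v| <= 2 * wbd R * beta.
  move=> /bP h; rewrite normrM (gtr0_norm (wt_gt0 v)).
  have v2 := sqr_ge0 v.
  apply: (@le_trans _ _ (wt v * ((2 * beta) * (1 + v ^+ 2)))).
    rewrite ler_wpM2l ?(ltW (wt_gt0 v))//; apply: le_trans h _.
    rewrite mulrAC [leRHS]mulrC ler_wpM2l//.
    by have := sqr_ge0 (`|v| - 1); rewrite sqrrB real_normK ?num_real//; lra.
  apply: le_trans (weighted_lin v _) _; first by rewrite mulr_ge0.
  rewrite ler_pdivrMr; last by lra.
  have : 0 <= wbd R * (beta * v ^+ 2).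
    by apply: mulr_ge0; [exact: wbd_ge0|exact: mulr_ge0].
  by lra.
have := wtb S; have := wtb k; rewrite !lexx (le_trans S0 k0) => /(_ isT) + /(_ isT).
rewrite !ler_norml.
have : K * (atan k - atan S) <= K * 4 by rewrite ler_wpM2l ?atan_diff_le4.
move: h1 h2 h3; rewrite xS; lra.
Qed.

End fast_regime.

(** * Escape along the curved branch *)

Lemma block_growth (R : realType) (kap rho S : R) (b x : R -> R) (a c m th : R) :
  langevin kap rho S b x -> 0 <= kap -> `|rho| <= 1 -> S <= a -> 1 <= a -> a <= c ->
  c ^+ 2 = a ^+ 2 + 1 -> 20 <= m -> 0 <= th -> 20 * th <= m ->
  16 * kap * m ^+ 2 <= a -> m <= x a ->
  (forall v, a <= v <= c -> `|b v - b a| <= th) ->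
  (forall v, a <= v <= c -> 4 / 5 * m <= x v) /\ 9 / 8 * m <= x c.
Proof.
move=> [cb cx dx] kap0 rho1 Sa a1 ac c2 m20 th0 thm capm ma bP.
have c32 : c <= 3 / 2 * a.
  rewrite -(@ler_pXn2r _ 2) ?nnegrE//; [|lra|lra].
  rewrite c2; have : 1 <= a ^+ 2 by rewrite expr_ge1//; lra.
  lra.
have ca1 : (c - a) * (c + a) = 1 by rewrite -subr_sqr c2; lra.
have aca : a * (c - a) <= 1 / 2.
  have : (c - a) * a <= (c - a) * c by rewrite ler_wpM2l//; lra.
  by lra.
have aca' : 2 / 5 <= a * (c - a).
  have : (c - a) * c <= (c - a) * (3 / 2 * a) by rewrite ler_wpM2l//; lra.
  by lra.
(* Slope of an affine lower barrier: [27 / 40] is the product of [9 / 10], from [x >= 9 / 10 * m],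
   and [3 / 4], from [v - kap * x ^ 2 >= 3 / 4 * a]; the [1] is for [rho]. *)
pose s := 27 / 40 * (a * m) - 1.
have am : m <= a * m by rewrite ler_peMl//; lra.
have s0 : 0 <= s by rewrite /s; lra.
have amca : a * m * (c - a) <= m / 2.
  have -> : a * m * (c - a) = m * (a * (c - a)) by ring.
  by rewrite ler_wpM2l//; lra.
have amca' : 2 / 5 * m <= a * m * (c - a).
  have -> : a * m * (c - a) = m * (a * (c - a)) by ring.
  by rewrite mulrC ler_wpM2l//; lra.
have ca0 : 0 <= c - a by lra.
have sca v : a <= v <= c -> 0 <= s * (v - a) <= 27 / 80 * m.
  move=> /andP[av vc]; rewrite mulr_ge0//=; last by lra.
  apply: (@le_trans _ _ (s * (c - a))); first by rewrite ler_wpM2l//; lra.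
  by rewrite /s; lra.
(* Within the strip of width [m / 20] below the affine barrier, [x] lies between [9 / 10 * m] and
   [2 * m]: the lower bound feeds the linear drift, the upper one limits the cubic term. *)
have key : forall v, a <= v <= c -> m + s * (v - a) - (x v - b v + b a) <= 0.
  apply: (@barrier _ (fun v => m + s * (v - a) - (x v - b v + b a))
    (fun v => s - (v * x v - kap * x v ^+ 3 + rho)) a c (m / 20)).
  - by lra.
  - move=> v; apply: cvgB.
      apply: cvgD; first exact: cvg_cst.
      apply: cvgM; first exact: cvg_cst.
      by apply: cvgB; [exact: cvg_id|exact: cvg_cst].
    apply: cvgD; last exact: cvg_cst.
    by apply: cvgB; [exact: cx|exact: cb].
  - move=> v /andP[av vc]; have hd := dx v (le_lt_trans Sa av).
    by apply: is_derive_eq; rewrite /GRing.scale/=; ring.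
  - by lra.
  move=> v /andP[av vc] /andP[p1 p2].
  have /sca/andP[sv1 sv2] : a <= v <= c by rewrite !ltW.
  have /bP : a <= v <= c by rewrite !ltW.
  rewrite ler_norml => /andP[b1 b2].
  have xlo : 9 / 10 * m <= x v by lra.
  have xhi : x v <= 2 * m by lra.
  have x0 : 0 <= x v by lra.
  have xx : kap * x v ^+ 2 <= a / 4.
    have : kap * x v ^+ 2 <= kap * (2 * m) ^+ 2.
      by rewrite ler_wpM2l// lerXn2r ?nnegrE//; lra.
    by rewrite exprMn; lra.
  have : 9 / 10 * m * (3 / 4 * a) <= x v * (v - kap * x v ^+ 2).
    by clear -xlo xx av m20 a1; apply: ler_pM; lra.
  by move: rho1; rewrite /s exprS ler_norml; lra.
split => [v vac|].
  have := key v vac; have /andP[sv1 _] := sca v vac.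
  by have := bP v vac; rewrite ler_norml; lra.
have cc : a <= c <= c by rewrite ac lexx.
have ca12 : c - a <= 1 / 2.
  by apply: le_trans aca; rewrite ler_peMl.
(* The barrier gains at least [27 / 100 * m - 1 / 2], the noise takes back [m / 20], and
   [1 / 2 <= m / 40]; what remains exceeds [9 / 8 * m]. *)
have := key c cc.
have := bP c cc; rewrite ler_norml /s; lra.
Qed.

Definition rt4 (R : realType) (n : nat) : R := Num.sqrt (Num.sqrt n%:R).

Lemma rt4_ge0 (R : realType) n : 0 <= rt4 R n. Proof. exact: sqrtr_ge0. Qed.

(** From [n = 2] on, [(n + 1) / n <= 3 / 2 < (9 / 8) ^ 4]. The noise allowance and the equilibrium
    both scale like [rt4], and neither may outgrow a path that gains a factor [9 / 8] per block. *)
Lemma rt4S (R : realType) n : (2 <= n)%N -> rt4 R n.+1 <= 9 / 8 * rt4 R n.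
Proof.
move=> n2'; have n2 : 2 <= n%:R :> R by rewrite (ler_nat _ 2).
rewrite -(@ler_pXn2r _ 4) ?nnegrE ?mulr_ge0 ?rt4_ge0//.
have e4 (z : R) : z ^+ 4 = (z ^+ 2) ^+ 2 by rewrite -exprM.
rewrite exprMn !e4 ![rt4 R _ ^+ 2]sqr_sqrtr ?sqrtr_ge0//.
rewrite !sqr_sqrtr ?ler0n// -natr1.
have -> : ((9 / 8 : R) ^+ 2) ^+ 2 = 6561 / 4096 by field.
lra.
Qed.

Lemma rt4_ge1 (R : realType) n : (1 <= n)%N -> 1 <= rt4 R n.
Proof.
move=> n1; have n1' : 1 <= n%:R :> R by rewrite (ler_nat _ 1).
by rewrite -[leLHS]sqrtr1 ler_wsqrtr// -[leLHS]sqrtr1 ler_wsqrtr.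
Qed.

Section climb.
Variables (R : realType) (kap rho S eta m0 : R) (n0 : nat) (b x : R -> R).
Hypotheses (kap0 : 0 < kap) (kap1 : 80 * Num.sqrt kap <= 1) (rho1 : `|rho| <= 1)
  (S0 : S <= 0) (eta0 : 0 <= eta) (etakap : 80 * eta * Num.sqrt kap <= 1)
  (n02 : (2 <= n0)%N) (m020 : 20 <= m0).
Hypothesis L : langevin kap rho S b x.

(** The cap is the height at which the condition [16 * kap * m ^+ 2 <= a] of [block_growth] is an
    equality for [a = Num.sqrt n%:R]. *)
Definition rung (n : nat) : R :=
  Num.min ((9 / 8) ^+ (n - n0) * m0) (rt4 R n / Num.sqrt kap / 4).

Hypothesis eta_m0 : 20 * eta * rt4 R n0 <= m0.
Hypothesis oscP : forall n, (n0 <= n)%N -> forall v,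
  Num.sqrt n%:R <= v <= Num.sqrt n.+1%:R -> `|b v - b (Num.sqrt n%:R)| <= eta * rt4 R n.

Let skap_gt0 : 0 < Num.sqrt kap. Proof. by rewrite sqrtr_gt0. Qed.

Let rung_ge20 n : (n0 <= n)%N -> 20 <= rung n.
Proof.
move=> n0n; rewrite /rung le_min; apply/andP; split.
  by rewrite (le_trans m020)// ler_peMl ?(le_trans _ m020)// exprn_ege1//; lra.
rewrite ler_pdivlMr// ler_pdivlMr//.
apply: le_trans (rt4_ge1 R (leq_trans (ltnW n02) n0n)).
move: kap1; lra.
Qed.

Let rung_eta n : (n0 <= n)%N -> 20 * (eta * rt4 R n) <= rung n.
Proof.
move=> n0n; rewrite /rung le_min; apply/andP; split; last first.
  rewrite ler_pdivlMr// ler_pdivlMr//.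
  have : 80 * eta * Num.sqrt kap * rt4 R n <= 1 * rt4 R n.
    by apply: ler_wpM2r => //; exact: rt4_ge0.
  lra.
rewrite -(subnK n0n); elim: (n - n0)%N => [|i IH].
  by rewrite add0n subnn expr0; move: eta_m0; lra.
rewrite addnK in IH; rewrite addnK addSn.
have := @rt4S R (i + n0) (leq_trans n02 (leq_addl _ _)).
move=> /(ler_wpM2l eta0).
rewrite exprS; lra.
Qed.

Let rungS n : (n0 <= n)%N -> rung n.+1 <= 9 / 8 * rung n.
Proof.
move=> n0n; rewrite /rung minr_pMr; last by lra.
rewrite le_min !ge_min; apply/andP; split; apply/orP; [left|right].
  by rewrite subSn// exprS mulrA.
have := rt4S R (leq_trans n02 n0n).
rewrite -(ler_pM2r (x := (Num.sqrt kap)^-1)) ?invr_gt0//; lra.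
Qed.

Let rung_cap n : (n0 <= n)%N -> 16 * kap * rung n ^+ 2 <= Num.sqrt n%:R.
Proof.
move=> n0n.
have : rung n ^+ 2 <= (rt4 R n / Num.sqrt kap / 4) ^+ 2.
  rewrite lerXn2r ?nnegrE//; last by rewrite /rung ge_min lexx orbT.
    by rewrite (le_trans _ (rung_ge20 n0n)).
  by rewrite !divr_ge0 ?rt4_ge0.
rewrite !exprMn !exprVn !sqr_sqrtr ?sqrtr_ge0// ?(ltW kap0)//.
rewrite -(ler_pM2l (x := 16 * kap)); last by rewrite mulr_gt0.
move/le_trans; apply; rewrite le_eqVlt; apply/orP; left; apply/eqP; field.
by rewrite gt_eqF.
Qed.

(** Consecutive rungs differ by a factor of at most [9 / 8], capped or not, which is what one block
    gains. [block_growth] asks only for [m <= x a], so a path far above its rung needs no separate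
    treatment. *)
Lemma climb_rungs : m0 <= x (Num.sqrt n0%:R) -> forall n, (n0 <= n)%N -> forall v,
  Num.sqrt n%:R <= v <= Num.sqrt n.+1%:R -> 4 / 5 * rung n <= x v.
Proof.
move=> xm0.
have step n : (n0 <= n)%N -> rung n <= x (Num.sqrt n%:R) ->
   (forall v, Num.sqrt n%:R <= v <= Num.sqrt n.+1%:R -> 4 / 5 * rung n <= x v) /\
   9 / 8 * rung n <= x (Num.sqrt n.+1%:R).
  move=> n0n xn; have r20 := rung_ge20 n0n.
  apply: (block_growth (kap := kap) (rho := rho) (S := S) (b := b) (th := eta * rt4 R n)) => //.
  - exact: ltW.
  - by rewrite (le_trans S0) ?sqrtr_ge0.
  - by rewrite -[leLHS]sqrtr1 ler_wsqrtr// (ler_nat _ 1) (leq_trans _ n0n)// (leq_trans _ n02).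
  - by rewrite ler_wsqrtr// ler_nat.
  - by rewrite !sqr_sqrtr ?ler0n// natr1.
  - by rewrite mulr_ge0 ?rt4_ge0.
  - exact: rung_eta.
  - exact: rung_cap.
  - by apply: oscP.
have main n : (n0 <= n)%N -> rung n <= x (Num.sqrt n%:R).
  move=> n0n; rewrite -(subnK n0n); elim: (n - n0)%N => [|i IH].
    rewrite add0n (le_trans _ xm0)// /rung subnn expr0 mul1r ge_min lexx//.
  rewrite addSn; have n0i : (n0 <= i + n0)%N by rewrite leq_addl.
  by apply: le_trans (rungS n0i) _; have [] := step _ n0i IH.
by move=> n n0n; have [] := step n n0n (main n n0n).
Qed.

End climb.

(** * Gaussian laws *)

Section lebesgue_affine.
Context {R : realType}.
Local Notation mu := (@lebesgue_measure R).

Lemma integral_lebesgue_addr (c : R) (f : R -> \bar R) :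
  measurable_fun [set: R] f -> (forall x, 0 <= f x)%E ->
  (\int[mu]_x f (x + c)%R = \int[mu]_x f x)%E.
Proof.
move=> mf f0.
have mc : measurable_fun [set: R] ((fun x : R => x + c) : _ -> measurableTypeR R).
  exact: measurable_funD.
rewrite -(@ge0_integral_pushforward _ _ (measurableTypeR R) (measurableTypeR R) _ _ mc mu setT f)//.
apply: eq_measure_integral => /= A mA _.
apply/esym/lebesgue_measure_unique => //= _ [[a b]] _ <-.
rewrite /pushforward (_ : _ @^-1` _ = `](a - c), (b - c)]%classic); last first.
  by apply/seteqP; split => x /=; rewrite !in_itv/= ltrBlDr lerBrDr.
rewrite !lebesgue_measure_itv/= !lte_fin ltrD2r.
by case: ifP => // _; rewrite -!EFinB; congr EFin; ring.
Qed.

Lemma integral_lebesgue_mulr (c : R) (f : R -> \bar R) : 0 < c ->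
  measurable_fun [set: R] f -> (forall x, 0 <= f x)%E ->
  (\int[mu]_x f x = c%:E * \int[mu]_x f (x * c)%R)%E.
Proof.
move=> c0 mf f0.
have mc : measurable_fun [set: R] ((fun x : R => x * c) : _ -> measurableTypeR R).
  exact: measurable_funM.
rewrite -(@ge0_integral_pushforward _ _ (measurableTypeR R) (measurableTypeR R) _ _ mc mu setT f)//.
rewrite -(ge0_integral_mscale _ _ (NngNum (ltW c0)))//.
apply: eq_measure_integral => /= A mA _.
apply/lebesgue_measure_unique => //= _ [[a b]] _ <-.
rewrite /mscale/= /pushforward (_ : _ @^-1` _ = `](a / c), (b / c)]%classic); last first.
  by apply/seteqP; split => x /=; rewrite !in_itv/= ltr_pdivrMr// ler_pdivlMr.
rewrite !lebesgue_measure_itv/= !lte_fin ltr_pM2r ?invr_gt0//.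
case: ifP => _; last by rewrite mule0.
by rewrite -!EFinB -EFinM; congr EFin; field; rewrite gt_eqF.
Qed.

(** [normal_prob] is given by its density, so its Radon-Nikodym derivative agrees with [normal_pdf]
    almost everywhere and change of variables applies. *)
Lemma integral_normal_prob (m s : R) (f : R -> \bar R) :
  measurable_fun [set: R] f -> (forall x, 0 <= f x)%E ->
  (\int[normal_prob m s]_x f x = \int[mu]_x (f x * (normal_pdf m s x)%:E))%E.
Proof.
move=> mf f0; have dom := normal_prob_dominates m s.
rewrite -(Radon_Nikodym_SigmaFinite.change_of_variables dom f0 measurableT mf).
have mpdf : measurable_fun [set: R] (EFin \o normal_pdf m s).
  by apply/measurable_EFinP; exact: measurable_normal_pdf.
have irn := Radon_Nikodym_SigmaFinite.f_integrable dom.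
have mrn := measurable_int _ irn.
apply: ge0_ae_eq_integral => //.
- exact: emeasurable_funM.
- exact: emeasurable_funM.
- by move=> x _; rewrite mule_ge0//; exact: Radon_Nikodym_SigmaFinite.f_ge0.
- by move=> x _; rewrite mule_ge0// lee_fin normal_pdf_ge0.
have := @integral_ae_eq _ _ _ mu setT measurableT (EFin \o normal_pdf m s) _ irn mpdf.
move=> /(_ _)[|N [mN N0 NP]].
  by move=> E _ mE; rewrite -Radon_Nikodym_SigmaFinite.f_integral.
exists N; split => // x /= h; apply: NP => /= h2; apply: h => _.
by rewrite h2.
Qed.

Lemma normal_pdf_gt0E (m s x : R) : 0 < s ->
  normal_pdf m s x = (s * Num.sqrt (pi *+ 2))^-1 * expR (- (x - m) ^+ 2 / (s ^+ 2 *+ 2)).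
Proof.
move=> s0; rewrite normal_pdfE ?gt_eqF// /normal_peak /normal_fun.
by rewrite -mulrnAr sqrtrM ?sqr_ge0// sqrtr_sqr gtr0_norm.
Qed.

Lemma normal_probE (m s : R) (A : set R) : measurable A ->
  normal_prob m s A = (\int[mu]_x ((\1_A x * normal_pdf m s x)%:E))%E.
Proof.
move=> mA; rewrite /normal_prob integral_mkcond; apply: eq_integral => x _.
rewrite patchE indicE; case: ifP => _; first by rewrite mul1r.
by rewrite mul0r.
Qed.

Lemma measurable_preimageT (f : R -> R) (A : set R) :
  measurable_fun [set: R] f -> measurable A -> measurable (f @^-1` A).
Proof. by move=> mf mA; rewrite -[X in measurable X]setTI; exact: mf. Qed.

Lemma normal_prob_mulr (s c : R) (A : set R) : 0 < s -> 0 < c -> measurable A ->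
  normal_prob 0 s ((fun x => c * x) @^-1` A) = normal_prob 0 (c * s) A.
Proof.
move=> s0 c0 mA.
have mc : measurable_fun [set: R] (fun x : R => c * x) by exact: measurable_funM.
rewrite (normal_probE _ _ (measurable_preimageT mc mA)) (normal_probE _ _ mA).
have mg m t : measurable_fun [set: R] (fun x : R => (\1_A x * normal_pdf m t x)%:E).
  apply/measurable_EFinP; apply: measurable_funM; first exact: measurable_indic.
  exact: measurable_normal_pdf.
have g0 m t x : (0 <= (\1_A x * normal_pdf m t x)%:E)%E.
  by rewrite lee_fin mulr_ge0// normal_pdf_ge0.
rewrite [RHS](@integral_lebesgue_mulr c _ c0 (mg 0 (c * s)) (g0 0 (c * s))).
rewrite -ge0_integralZl//; last 2 first.
- apply/measurable_EFinP; apply: measurable_funM.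
    have mc' : measurable_fun [set: R] (fun x : R => x * c) by exact: measurable_funM.
    exact: (measurable_indic (measurable_preimageT mc' mA)).
  apply: (measurableT_comp (f := normal_pdf 0 (c * s))).
    exact: measurable_normal_pdf.
  exact: measurable_funM.
- by rewrite lee_fin ltW.
apply: eq_integral => x _; rewrite -EFinM; congr EFin.
rewrite /= !normal_pdf_gt0E ?mulr_gt0// !subr0 [c * (_ * _)]mulrCA [x * c]mulrC.
rewrite (_ : \1_((fun x0 => c * x0) @^-1` A) x = \1_A (c * x) :> R)//; congr (_ * _).
rewrite mulrA; congr (_ * expR _).
  have p0 : Num.sqrt (pi *+ 2) != 0 :> R by rewrite gt_eqF// sqrtr_gt0 pmulrn_lgt0// pi_gt0.
  by field; rewrite p0 !gt_eqF.
by field; rewrite !gt_eqF.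
Qed.

Lemma normal_convolution (s r : R) (A : set R) : 0 < s -> 0 < r -> measurable A ->
  (\int[normal_prob 0 s]_x normal_prob 0 r ((fun y => (x + y)%R) @^-1` A) =
   normal_prob 0 (Num.sqrt (s ^+ 2 + r ^+ 2)) A)%E.
Proof.
move=> s0 r0 mA.
have madd x : measurable_fun [set: R] (fun y : R => x + y) by exact: measurable_funD.
have mHx x : measurable_fun [set: R] (fun z => (\1_A z * normal_pdf 0 r (z - x))%:E).
  apply/measurable_EFinP; apply: measurable_funM; first exact: measurable_indic.
  by apply: (measurableT_comp (measurable_normal_pdf 0 r)); exact: measurable_funB.
have inner x : (normal_prob 0 r ((fun y => (x + y)%R) @^-1` A) =
    \int[mu]_z (\1_A z * normal_pdf 0 r (z - x))%:E)%E.
  rewrite normal_probE; last exact: measurable_preimageT.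
  rewrite -(@integral_lebesgue_addr x _ (mHx x)).
    by apply: eq_integral => y _; rewrite addrK [y + x]addrC.
  by move=> z; rewrite lee_fin mulr_ge0// normal_pdf_ge0.
pose H (p : R * R) : \bar R := (\1_A p.2 * normal_pdf 0 r (p.2 - p.1))%:E.
have mA2 : measurable (snd @^-1` A : set (R * R)).
  by rewrite -[X in measurable X]setTI; exact: measurable_snd.
have mH : measurable_fun [set: R * R] H.
  apply/measurable_EFinP; apply: measurable_funM.
    exact: (measurable_indic mA2).
  by apply: (measurableT_comp (measurable_normal_pdf 0 r)); exact: measurable_funB.
have H0 p : (0 <= H p)%E by rewrite lee_fin mulr_ge0// normal_pdf_ge0.
pose K (p : R * R) : \bar R := (H p * (normal_pdf 0 s p.1)%:E)%E.
have mK : measurable_fun [set: R * R] K.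
  apply: emeasurable_funM => //; apply/measurable_EFinP.
  exact: (measurableT_comp (measurable_normal_pdf 0 s)).
have K0 p : (0 <= K p)%E by rewrite mule_ge0// lee_fin normal_pdf_ge0.
pose t := Num.sqrt (s ^+ 2 + r ^+ 2).
have t2 : t ^+ 2 = s ^+ 2 + r ^+ 2 by rewrite sqr_sqrtr// addr_ge0 ?sqr_ge0.
have t0 : 0 < t by rewrite sqrtr_gt0 addr_gt0 ?exprn_gt0.
(* Completing the square: the joint density of the first summand [x] and the sum [z] is the density
   of the sum times the conditional density of [x] given [z], which integrates to one. *)
have square z x : normal_pdf 0 r (z - x) * normal_pdf 0 s x =
    normal_pdf 0 t z * normal_pdf (s ^+ 2 * z / t ^+ 2) (s * r / t) x.
  rewrite !normal_pdf_gt0E ?divr_gt0 ?mulr_gt0//.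
  have p0 : Num.sqrt (pi *+ 2) != 0 :> R by rewrite gt_eqF// sqrtr_gt0 pmulrn_lgt0// pi_gt0.
  rewrite mulrACA -expRD [RHS]mulrACA -expRD; congr (_ * expR _).
    by field; rewrite p0 !gt_eqF.
  rewrite !expr_div_n t2; field.
  by rewrite !gt_eqF// addr_gt0 ?exprn_gt0.
transitivity (\int[mu]_x \int[mu]_z K (x, z))%E.
  rewrite integral_normal_prob; last first.
  - by move=> x; exact: measure_ge0.
  - rewrite (_ : (fun x => _) = fubini_F mu H).
      exact: measurable_fun_fubini_tonelli_F.
    by apply/funext => x; rewrite inner.
  apply: eq_integral => x _; rewrite inner -ge0_integralZr//.
  - exact: mHx.
  - by move=> z _; exact: (H0 (x, z)).
  - by rewrite lee_fin normal_pdf_ge0.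
rewrite (@fubini_tonelli _ _ _ _ _ mu mu K mK K0) (normal_probE _ _ mA).
apply: eq_integral => z _.
transitivity (\int[mu]_x ((\1_A z * normal_pdf 0 t z)%:E *
   (normal_pdf (s ^+ 2 * z / t ^+ 2) (s * r / t) x)%:E))%E.
  by apply: eq_integral => x _; rewrite /K /H /= -!EFinM; congr EFin; rewrite -[LHS]mulrA square mulrA.
rewrite ge0_integralZl//.
- by rewrite integral_normal_pdf mule1.
- by apply/measurable_EFinP; exact: measurable_normal_pdf.
- by move=> x _; rewrite lee_fin normal_pdf_ge0.
- by rewrite lee_fin mulr_ge0// normal_pdf_ge0.
Qed.

End lebesgue_affine.

Section normal_bounds.
Context {R : realType}.
Local Notation mu := (@lebesgue_measure R).

Lemma integral_lebesgue_opp (f : R -> \bar R) :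
  measurable_fun [set: R] f -> (forall x, 0 <= f x)%E ->
  (\int[mu]_x f (- x)%R = \int[mu]_x f x)%E.
Proof.
move=> mf f0.
have mc : measurable_fun [set: R] ((fun x : R => - x) : _ -> measurableTypeR R).
  exact: measurable_funN.
rewrite -(@ge0_integral_pushforward _ _ (measurableTypeR R) (measurableTypeR R) _ _ mc mu setT f)//.
by apply: eq_measure_integral => /= A mA _; exact: lebesgue_measureN.
Qed.

Lemma normal_prob_opp (s : R) (A : set R) : 0 < s -> measurable A ->
  normal_prob 0 s ((fun x => - x) @^-1` A) = normal_prob 0 s A.
Proof.
move=> s0 mA.
have mc : measurable_fun [set: R] (fun x : R => - x) by exact: measurable_funN.
rewrite (normal_probE _ _ (measurable_preimageT mc mA)) (normal_probE _ _ mA).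
rewrite -[RHS]integral_lebesgue_opp.
- by apply: eq_integral => x _; congr EFin; rewrite !normal_pdf_gt0E// !subr0 sqrrN.
- apply/measurable_EFinP; apply: measurable_funM; first exact: measurable_indic.
  exact: measurable_normal_pdf.
- by move=> x; rewrite lee_fin mulr_ge0// normal_pdf_ge0.
Qed.

Lemma normal_prob_lt0 (s : R) : 0 < s ->
  (normal_prob 0 s [set x | x < 0]%R <= (2^-1)%:E)%E.
Proof.
move=> s0.
have mA : measurable [set x : R | x < 0]%R.
  rewrite (_ : [set x | _] = `]-oo, 0[%classic); first exact: measurable_itv.
  by apply/seteqP; split => x /=; rewrite in_itv.
have mB : measurable ((fun x => - x) @^-1` [set x : R | x < 0]%R).
  by apply: measurable_preimageT => //; exact: measurable_funN.
have : (normal_prob 0 s ([set x | x < 0] `|` (fun x => - x) @^-1` [set x : R | x < 0])%R <= 1)%E.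
  by apply: probability_le1; exact: measurableU.
rewrite measureU//; last first.
  by rewrite -subset0 => x [/=]; rewrite oppr_lt0 => /ltW + /lt_geF => ->.
have fA : normal_prob 0 s [set x : R | x < 0]%R \is a fin_num by exact: fin_num_measure.
move=> h; have : (normal_prob 0 s [set x : R | x < 0]%R +
    normal_prob 0 s [set x : R | x < 0]%R <= 1)%E.
  by rewrite -[X in (_ + X)%E](normal_prob_opp s0 mA); exact: h.
by case: (normal_prob 0 s _) fA => //= r _; rewrite -EFinD !lee_fin; lra.
Qed.

Lemma normal_prob_near0 (s d : R) : 0 < s -> 0 <= d ->
  (normal_prob 0 s [set x | `|x| <= d]%R <= (2 * d / s)%:E)%E.
Proof.
move=> s0 d0.
have AE : [set x : R | `|x| <= d]%R = `[(- d), d]%classic.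
  by apply/seteqP; split => x /=; rewrite in_itv/= ler_norml.
rewrite AE /normal_prob.
apply: (@le_trans _ _ (\int[mu]_(x in `[(- d)%R, d]) (s^-1)%:E)%E).
  apply: ge0_le_integral => //.
  - by move=> x _; rewrite lee_fin normal_pdf_ge0.
  - by apply/measurable_EFinP; apply: measurable_funTS; exact: measurable_normal_pdf.
  move=> x _; rewrite lee_fin normal_pdf_gt0E// subr0.
  have p1 : 1 <= Num.sqrt (pi *+ 2) :> R.
    rewrite -[leLHS]sqrtr1 ler_wsqrtr// mulr2n.
    by have := @pihalf_ge1 R; lra.
  rewrite -[leRHS]mulr1; apply: ler_pM; rewrite ?invr_ge0 ?expR_ge0 ?mulr_ge0 ?sqrtr_ge0//.
  - exact: ltW.
  - rewrite lef_pV2 ?posrE ?mulr_gt0//; last by lra.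
    by rewrite ler_peMr// ltW.
  - rewrite -[leRHS]expR0 ler_expR mulNr oppr_le0; apply: divr_ge0; first exact: sqr_ge0.
    by rewrite mulrn_wge0// sqr_ge0.
rewrite integral_cst//= lebesgue_measure_itv/= lte_fin.
case: ifP => _; last by rewrite mule0 lee_fin divr_ge0 ?mulr_ge0// ltW.
by rewrite -EFinB -EFinM lee_fin; lra.
Qed.

Lemma expRN_le (z : R) : 0 < z -> expR (- z) <= 4 / z ^+ 2.
Proof.
move=> z0; rewrite expRN -invf_div lef_pV2 ?posrE ?divr_gt0 ?exprn_gt0 ?expR_gt0//.
have -> : expR z = expR (z / 2) ^+ 2 by rewrite -expRM_natl; congr expR; field.
have -> : z ^+ 2 / 4 = (z / 2) ^+ 2 by field.
rewrite lerXn2r ?nnegrE ?expR_ge0 ?divr_ge0 ?(ltW z0)//.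
by apply: le_trans (expR_ge1Dx _); lra.
Qed.

(** Half of the exponent is kept as the density of deviation [r2 * s]; the other half gives
    [4 / z ^ 2] at [z = y ^ 2 / (4 * s ^ 2)], and the factor [2] in [c] bounds the [r2] of the
    normalisation. Decay of order four is what chaining needs: at scale [2 ^ -m] the factor [s ^ 4]
    is of order [4 ^ -m] and beats the [2 ^ m] increments. *)
Lemma normal_prob_tail (s y : R) : 0 < s -> 0 < y ->
  (normal_prob 0 s [set x | y < `|x|]%R <= (128 * s ^+ 4 / y ^+ 4)%:E)%E.
Proof.
move=> s0 y0.
have mA : measurable [set x : R | y < `|x|]%R.
  rewrite (_ : [set x | _] = ~` `[(- y), y]%classic); first exact: measurableC.
  apply/seteqP; split => x /=; rewrite in_itv/= -ler_norml; first by move=> /lt_geF ->.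
  by move=> /negP; rewrite -ltNge.
pose r2 : R := Num.sqrt 2.
have r20 : 0 < r2 by rewrite sqrtr_gt0.
have r22 : r2 ^+ 2 = 2 by rewrite sqr_sqrtr.
have r2le : r2 <= 2 by rewrite -(@ler_pXn2r _ 2) ?nnegrE ?(ltW r20)// r22; lra.
pose c := 2 * (4 / (y ^+ 2 / (s ^+ 2 * 4)) ^+ 2).
have cE : c = 128 * s ^+ 4 / y ^+ 4 by rewrite /c; field; rewrite !gt_eqF.
have c0 : 0 <= c.
  by rewrite /c; apply: mulr_ge0 => //; apply: divr_ge0 => //; exact: sqr_ge0.
rewrite -cE.
apply: (@le_trans _ _ (\int[mu]_(x in [set x : R | y < `|x|]%R)
   (c%:E * (normal_pdf 0 (r2 * s) x)%:E))%E).
  apply: ge0_le_integral => //.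
  - by move=> x _; rewrite lee_fin normal_pdf_ge0.
  - by apply/measurable_EFinP; apply: measurable_funTS; exact: measurable_normal_pdf.
  - by apply/measurable_EFinP; apply: measurable_funM => //;
      apply: measurable_funTS; exact: measurable_normal_pdf.
  move=> x /= yx; rewrite -EFinM lee_fin !normal_pdf_gt0E ?mulr_gt0// !subr0.
  have p0 : 0 < Num.sqrt (pi *+ 2) :> R by rewrite sqrtr_gt0 pmulrn_lgt0// pi_gt0.
  have -> : - x ^+ 2 / (s ^+ 2 *+ 2) = - (x ^+ 2 / (s ^+ 2 * 4)) + - x ^+ 2 / ((r2 * s) ^+ 2 *+ 2).
    by rewrite exprMn r22; field; rewrite gt_eqF.
  rewrite expRD invfM [in leRHS]invfM [in leRHS]invfM.
  have h : expR (- (x ^+ 2 / (s ^+ 2 * 4))) <= 4 / (y ^+ 2 / (s ^+ 2 * 4)) ^+ 2.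
    apply: le_trans (expRN_le _); last by rewrite divr_gt0 ?mulr_gt0 ?exprn_gt0.
    rewrite ler_expR lerN2 ler_pM2r ?invr_gt0 ?mulr_gt0 ?exprn_gt0//.
    have -> : x ^+ 2 = `|x| ^+ 2 by rewrite real_normK ?num_real.
    by apply: lerXn2r; rewrite ?nnegrE ?normr_ge0 ?(ltW y0) ?(ltW yx).
  set E2 := expR (- x ^+ 2 / _) in h *.
  have hh : expR (- (x ^+ 2 / (s ^+ 2 * 4))) <= c * r2^-1.
    apply: le_trans h _; rewrite /c [leRHS]mulrAC; apply: ler_peMl.
      by apply: divr_ge0 => //; exact: sqr_ge0.
    by rewrite ler_pdivlMr// mul1r.
  have -> : c * (r2^-1 / s / Num.sqrt (pi *+ 2) * E2) =
     (c * r2^-1) * (s^-1 / Num.sqrt (pi *+ 2) * E2) by ring.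
  rewrite mulrCA; apply: ler_wpM2r hh.
  by rewrite !mulr_ge0 ?invr_ge0 ?expR_ge0// ltW.
rewrite ge0_integralZl//; last 2 first.
- by apply/measurable_EFinP; apply: measurable_funTS; exact: measurable_normal_pdf.
- by move=> x _; rewrite lee_fin normal_pdf_ge0.
rewrite -[leRHS]mule1 lee_wpmul2l ?lee_fin//.
by apply: (@probability_le1 _ _ _ (normal_prob 0 (r2 * s))).
Qed.

End normal_bounds.

(** * The law of a sum of independent centred Gaussian variables *)

Section gaussian_sum.
Context {R : realType} {d : measure_display} {T : measurableType d}.
Variables (P : probability T R) (n : nat) (Y : nat -> T -> R) (s : nat -> R).
Hypothesis mY : forall i, measurable_fun [set: T] (Y i).
Hypothesis s0 : forall i, 0 < s i.
Hypothesis indY : forall A : nat -> set R, (forall i, measurable (A i)) ->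
  P [set w | forall i, (i < n)%N -> A i (Y i w)] =
  (\prod_(0 <= i < n) normal_prob 0 (s i) (A i))%E.

Let S k w := \sum_(0 <= i < k) Y i w.

Let mS k : measurable_fun [set: T] (S k).
Proof. exact: measurable_sum. Qed.

Let tail k (A : nat -> set R) : set T :=
  [set w | forall i, (k <= i < n)%N -> A i (Y i w)].

Let mtail k A : (forall i, measurable (A i)) -> measurable (tail k A).
Proof.
move=> mA; rewrite (_ : tail k A = \bigcap_(i in [set i | (k <= i < n)%N]) (Y i @^-1` A i)).
  apply: bigcap_measurableType => i _.
  by rewrite -[X in measurable X]setTI; exact: mY.
by apply/seteqP; split => w h i; exact: h.
Qed.

Let sd k : R := Num.sqrt (\sum_(0 <= i < k) s i ^+ 2).

Let sd_gt0 k : 0 < sd k.+1.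
Proof.
rewrite sqrtr_gt0 big_nat_recr//= ltr_wpDl ?exprn_gt0//.
by apply: sumr_ge0 => i _; exact: sqr_ge0.
Qed.

(** The induction carries the variables not yet summed as the event [tail], so independence never
    has to be restated for partial sums. Under [P] restricted to that event, the partial sum and the
    next variable have a product law, and adding them is a convolution. *)
Lemma gaussian_sum_tail k : (k < n)%N -> forall (B : set R) (A : nat -> set R),
  measurable B -> (forall i, measurable (A i)) ->
  P (S k.+1 @^-1` B `&` tail k.+1 A) =
  (normal_prob 0 (sd k.+1) B * \prod_(k.+1 <= i < n) normal_prob 0 (s i) (A i))%E.
Proof.
elim: k => [n0|k IH kn] B A mB mA.
  pose A' i := if i == 0%N then B else A i.
  have mA' i : measurable (A' i) by rewrite /A'; case: ifP.
  have := indY mA'; rewrite big_ltn//= {2}/A' eqxx.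
  rewrite (_ : sd 1 = s 0); last first.
    by rewrite /sd big_nat1 sqrtr_sqr gtr0_norm.
  rewrite (@eq_big_nat _ _ _ 1 n _ (fun i => normal_prob 0 (s i) (A i))); last first.
    by move=> i /andP[]; rewrite /A'; case: i.
  move=> <-; congr (P _); apply/seteqP; split => w /=.
    move=> []; rewrite /S big_nat1 => h0 h i iN; rewrite /A'.
    by case: eqP => [->//|/eqP i0]; apply: h; rewrite lt0n i0.
  move=> h; split; first by have := h 0%N n0; rewrite /S big_nat1.
  by move=> i /andP[i0 iN]; have := h i iN; rewrite /A'; case: i i0 {iN}.
set c := (\prod_(_ <= _ < _) _)%E.
have c0 : (0 <= c)%E by apply: prode_ge0 => i _; exact: measure_ge0.
have cfin : c \is a fin_num.
  apply: (big_ind (fun x : \bar R => x \is a fin_num)) => [|x y|i _] //.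
    exact: fin_numM.
  by apply: fin_num_measure; exact: mA.
pose D := tail k.+2 A.
have mD : measurable D by exact: mtail.
have fc0 : 0 <= fine c by exact: fine_ge0.
pose V w : measurableTypeR R * measurableTypeR R := (S k.+1 w, Y k.+1 w).
have mV : measurable_fun [set: T] V.
  have m1 : measurable_fun [set: T] (S k.+1 : T -> measurableTypeR R) by exact: mS.
  have m2 : measurable_fun [set: T] (Y k.+1 : T -> measurableTypeR R) by exact: mY.
  exact: (measurable_fun_pair m1 m2).
pose m' := @measure_function_pushforward__canonical__measure_function_Measure
  _ _ _ _ _ (mrestr P mD) V mV.
(* The restricted measure has total mass [c] and not one, whence the scaled first factor. Placing
   [A2] at index [k.+1] turns the induction hypothesis into the formula on rectangles. *)
have mvE : forall A1 A2, measurable A1 -> measurable A2 ->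
   m' (A1 `*` A2) = (mscale (NngNum fc0) (normal_prob 0 (sd k.+1)) A1 * normal_prob 0 (s k.+1) A2)%E.
  move=> A1 A2 mA1 mA2.
  pose A' i := if i == k.+1 then A2 else A i.
  have mA' i : measurable (A' i) by rewrite /A'; case: ifP => _; [exact: mA2|exact: mA].
  have E := IH (ltnW kn) A1 A' mA1 mA'.
  rewrite big_ltn// {2}/A' eqxx in E.
  rewrite (@eq_big_nat _ _ _ k.+2 n _ (fun i => normal_prob 0 (s i) (A i))) in E; last first.
    by move=> i /andP[ki _]; rewrite /A' gtn_eqF.
  rewrite /mscale/= fineK// -/c.
  transitivity (P (S k.+1 @^-1` A1 `&` tail k.+1 A')); last first.
    by rewrite E muleA muleC muleA.
  rewrite /m' /pushforward /mrestr; congr (P _); apply/seteqP; split => w /=.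
    move=> [[h1 h2] h]; split => // i /andP[ki iN]; rewrite /A'.
    case: eqP => [->//|/eqP ik]; apply: h; rewrite iN andbT.
    by rewrite ltn_neqAle eq_sym ik.
  move=> [h1 h]; split; first by split => //; have := h k.+1; rewrite /A' eqxx leqnn kn; apply.
  move=> i /andP[ki iN]; have := h i; rewrite /A' gtn_eqF// iN (ltnW ki); exact.
pose C : set (measurableTypeR R * measurableTypeR R) := (fun p => p.1 + p.2) @^-1` B.
have mC : measurable C.
  rewrite -[X in measurable X]setTI.
  have madd : measurable_fun [set: R * R] (fun p : R * R => p.1 + p.2).
    by apply: measurable_funD.
  exact: madd.
have := @product_measure_unique _ _ _ _ _ (mscale (NngNum fc0) (normal_prob 0 (sd k.+1)))
   (normal_prob 0 (s k.+1)) m' mvE C mC.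
have -> : m' C = P (S k.+2 @^-1` B `&` tail k.+2 A).
  rewrite /m'/= /pushforward /mrestr; congr (P (_ `&` _)).
  have SE w : S k.+2 w = S k.+1 w + Y k.+1 w by rewrite /S big_nat_recr.
  by apply/seteqP; split => w; rewrite /C/= SE.
move=> <-; rewrite /product_measure1 ge0_integral_mscale//; last exact: measurable_fun_xsection.
rewrite /= fineK// muleC; congr (_ * _)%E.
have sdE : sd k.+2 = Num.sqrt (sd k.+1 ^+ 2 + s k.+1 ^+ 2).
  rewrite [in LHS]/sd big_nat_recr//= sqr_sqrtr//.
  by apply: sumr_ge0 => i _; exact: sqr_ge0.
rewrite sdE -normal_convolution//.
apply: eq_integral => x _; congr (normal_prob _ _ _).
by apply/seteqP; split => y; rewrite /xsection/= inE.
Qed.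

Lemma gaussian_sum_law (B : set R) : (0 < n)%N -> measurable B ->
  P (S n @^-1` B) = normal_prob 0 (sd n) B.
Proof.
move=> n0 mB; have := @gaussian_sum_tail n.-1.
rewrite prednK// => /(_ (leqnn _) B (fun=> setT) mB (fun=> measurableT)).
rewrite big_geq ?mule1// => <-; congr (P _).
by apply/seteqP; split => w //= [].
Qed.

End gaussian_sum.

(** * Oscillation of the noise *)

Section chaining.
Variables (R : realType) (g : R -> R) (a l mu : R).
Hypotheses (cg : continuous g) (l0 : 0 < l).

Let pt (m i : nat) : R := a + l * (i%:R / 2 ^+ m).

Hypothesis step : forall m i, (i < 2 ^ m)%N ->
  `|g (pt m i.+1) - g (pt m i)| <= mu * (9 / 10) ^+ m.

Let two0 m : 2 ^+ m != 0 :> R. Proof. by rewrite expf_neq0. Qed.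

Let ptS m j : pt m.+1 j.*2 = pt m j.
Proof.
rewrite /pt -mul2n natrM exprS; congr (_ + _ * _); field.
exact: two0.
Qed.

(** A point of level [m.+1] is a point of level [m] or one step to the right of one. The bound is
    the partial geometric sum [mu * (1 + ... + (9 / 10) ^ m)]. *)
Let dyadic m i : (i <= 2 ^ m)%N ->
  `|g (pt m i) - g a| <= 10 * mu * (1 - (9 / 10) ^+ m.+1).
Proof.
have pt0 m' : pt m' 0 = a by rewrite /pt mul0r mulr0 addr0.
have mu0 : 0 <= mu.
  by have := @step 0 0 isT; rewrite expr0 mulr1; apply: le_trans.
elim: m i => [|m IH] i.
  case: i => [_|[_|//]]; first by rewrite pt0 subrr normr0 expr1; lra.
  by have := @step 0 0 isT; rewrite pt0 expr0 expr1; lra.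
rewrite expnS mul2n => im.
have h0 : (i./2 <= 2 ^ m)%N by rewrite -leq_double (leq_trans _ im)// -{2}(odd_double_half i) leq_addl.
have := IH _ h0; rewrite -(ptS m i./2).
have q0 : 0 <= (9 / 10 : R) ^+ m by rewrite exprn_ge0.
case/boolP : (odd i) => oi; last first.
  rewrite -[in X in _ -> X](odd_double_half i) (negbTE oi) add0n => /le_trans; apply.
  have := mulr_ge0 mu0 q0; rewrite !exprS; lra.
have iE : i = (i./2).*2.+1 by rewrite -[LHS]odd_double_half oi.
have := @step m.+1 (i./2).*2; rewrite -iE expnS mul2n => /(_ im).
move=> h1 h2; apply: le_trans (_ : `|g (pt m.+1 i) - g (pt m.+1 (i./2).*2)| +
   `|g (pt m.+1 (i./2).*2) - g a| <= _).
  by rewrite -[X in `|X|](subrKA (g (pt m.+1 (i./2).*2))) ler_normD.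
have := mulr_ge0 mu0 q0; move: h1 h2; rewrite !exprS; lra.
Qed.

Lemma chaining_bound v : a <= v <= a + l -> `|g v - g a| <= 10 * mu.
Proof.
move=> /andP[av val].
have mu0 : 0 <= mu.
  by have := @step 0 0 isT; rewrite expr0 mulr1; apply: le_trans.
apply/ler_addgt0Pr => e e0.
have [dl dl0 dlP] := continuous_delta v cg e0.
(* A level whose spacing is below the continuity radius at [v]; the dyadic point just left of [v]
   then stands in for [v]. *)
pose m := (Num.truncn (l / dl)).+1.
have lm : l / 2 ^+ m < dl.
  rewrite ltr_pdivrMr ?exprn_gt0// mulrC -ltr_pdivrMr//.
  have /andP[_ h] := truncn_itv (ltW (divr_gt0 l0 dl0)).
  apply: lt_trans h _; rewrite -natrX ltr_nat; exact: ltn_expl.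
pose x := (v - a) / l * 2 ^+ m.
have x0 : 0 <= x by rewrite mulr_ge0 ?exprn_ge0// divr_ge0 ?subr_ge0// ltW.
have /andP[ix xi] := truncn_itv x0.
set i := Num.truncn x in ix xi.
have im : (i <= 2 ^ m)%N.
  rewrite -(ler_nat R) natrX; apply: le_trans ix _.
  by rewrite /x ler_piMl ?exprn_ge0// ler_pdivrMr// mul1r; lra.
have ve : v = a + l * (x / 2 ^+ m).
  by rewrite /x mulfK// mulrCA divff ?gt_eqF//; lra.
have near : `|pt m i - v| < dl.
  apply: le_lt_trans lm; rewrite {1}ve /pt opprD addrACA subrr add0r -mulrBr.
  rewrite -mulrBl normrM gtr0_norm// ler_pM2l//.
  rewrite normrM [X in _ * X]gtr0_norm ?invr_gt0 ?exprn_gt0//.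
  rewrite -[leRHS]mul1r ler_pM2r ?invr_gt0 ?exprn_gt0//.
  by rewrite distrC ger0_norm ?subr_ge0// -natr1 in xi *; lra.
have := dlP _ near; have := dyadic im.
have : 0 <= mu * (9 / 10) ^+ m.+1 by rewrite mulr_ge0// exprn_ge0.
move=> h1 h2 h3.
have -> : g v - g a = (g (pt m i) - g a) - (g (pt m i) - g v) by ring.
apply: le_trans (ler_normB _ _) _; lra.
Qed.

End chaining.

Section union_bound.
Context {R : realType} {d : measure_display} {T : measurableType d}.
Variable P : probability T R.

Lemma union_bound (F : nat -> set T) (u : nat -> R) (M : R) :
  (forall n, measurable (F n)) -> (forall n, (P (F n) <= (u n)%:E)%E) ->
  (forall n, \sum_(0 <= i < n) u i <= M) ->
  (P (\bigcup_n F n) <= M%:E)%E.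
Proof.
move=> mF Fu uM.
have mU : measurable (\bigcup_n F n) by exact: bigcup_measurable.
apply: (le_trans (generalized_Boole_inequality P mF mU)).
apply: lime_le; first by apply: is_cvg_nneseries => n _ _; exact: measure_ge0.
apply: nearW => n; apply: (@le_trans _ _ (\sum_(0 <= i < n) u i)%:E); last first.
  by rewrite lee_fin.
by rewrite -sumEFin; apply: lee_sum => i _; exact: Fu.
Qed.

Lemma union_bound_fin (F : nat -> set T) (u : R) (n : nat) :
  (forall i, measurable (F i)) -> (forall i, (i < n)%N -> (P (F i) <= u%:E)%E) ->
  (P (\bigcup_(i in [set i | (i < n)%N]) F i) <= (n%:R * u)%:E)%E.
Proof.
move=> mF Fu; rewrite bigcup_mkord.
apply: (le_trans (Boole_inequality P (fun i _ => mF i))).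
apply: (@le_trans _ _ (\sum_(i < n) u%:E)%E); first by apply: lee_sum => i _; exact: Fu.
by rewrite sumEFin sumr_const card_ord mulr_natl.
Qed.

Lemma geometric_sum_le (c q : R) n : 0 <= c -> 0 <= q < 1 ->
  \sum_(0 <= i < n) c * q ^+ i <= c / (1 - q).
Proof.
move=> c0 /andP[q0 q1]; have q10 : 0 < 1 - q by lra.
rewrite ler_pdivlMr// -mulr_sumr -mulrA ler_piMr//.
elim: n => [|n]; first by rewrite big_geq// mul0r.
have -> : \sum_(0 <= i < n.+1) q ^+ i = 1 + q * \sum_(0 <= i < n) q ^+ i.
  rewrite big_nat_recl//= expr0 mulr_sumr; congr (_ + _).
  by apply: eq_bigr => i _; rewrite exprS.
set z := \sum_(_ <= _ < _) _ => h.
have : q * (z * (1 - q)) <= q * 1 by rewrite ler_wpM2l.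
lra.
Qed.

Lemma inverse_square_sum_le (n0 n : nat) : (0 < n0)%N ->
  \sum_(0 <= i < n) (i + n0.+1)%:R ^- 2 <= n0%:R^-1 :> R.
Proof.
move=> n00; suff : \sum_(0 <= i < n) (i + n0.+1)%:R ^- 2 <= n0%:R^-1 - (n + n0)%:R^-1 :> R.
  by move/le_trans; apply; rewrite lerBlDr lerDl invr_ge0.
elim: n => [|n IH]; first by rewrite big_geq// add0n subrr.
rewrite big_nat_recr//=.
suff : (n + n0.+1)%:R ^- 2 <= (n + n0)%:R^-1 - (n.+1 + n0)%:R^-1 :> R by move: IH; lra.
rewrite addnS -addSn.
set x : R := (n + n0)%:R.
have x0 : 0 < x by rewrite ltr0n addn_gt0 n00 orbT.
have -> : (n.+1 + n0)%:R = x + 1 by rewrite addSn -natr1.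
have -> : x^-1 - (x + 1)^-1 = (x * (x + 1))^-1.
  by field; rewrite !gt_eqF//; lra.
rewrite lef_pV2 ?posrE ?exprn_gt0 ?mulr_gt0//; lra.
Qed.

End union_bound.

(** Brownian increments are demanded from [S] on, but continuity and measurability at all times: the
    rescaled noise is frozen before [S], so paths can be handled as functions on the whole line. *)
Record scaled_noise (R : realType) (d : measure_display) (T : measurableType d)
    (P : probability T R) (S : R) (B : R -> T -> R) : Prop := {
  noise_measurable : forall v, measurable_fun [set: T] (B v) ;
  noise_continuous : forall w, continuous (fun v => B v w) ;
  noise_law : forall u v (A : set R), S <= u -> u < v -> measurable A ->
    P [set w | A (B v w - B u w)] = normal_prob 0 (Num.sqrt (v - u)) A ;
  noise_independent : forall (n : nat) (r : nat -> R), S <= r 0%N ->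
    {homo r : i j / (i <= j)%N >-> i <= j} ->
    forall A : nat -> set R, (forall i, measurable (A i)) ->
    P [set w | forall i, (i < n)%N -> A i (B (r i.+1) w - B (r i) w)] =
    (\prod_(0 <= i < n) P [set w | A i (B (r i.+1) w - B (r i) w)%R])%E }.

(** [128] is the constant of the Gaussian tail, [10 ^+ 4] the fourth power of the chaining factor,
    and [5] bounds the sum of a geometric series of ratio at most [4 / 5]. Locking keeps it opaque
    to the arithmetic tactics. *)
Definition osc_cst (R : realType) : R := locked (5 * (128 * 10 ^+ 4)).

Lemma osc_cst_ge0 (R : realType) : 0 <= osc_cst R.
Proof.
by rewrite /osc_cst -lock; apply: mulr_ge0 => //; apply: mulr_ge0 => //; exact: exprn_ge0.
Qed.

Section noise.
Context {R : realType} {d : measure_display} {T : measurableType d}.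
Variables (P : probability T R) (S : R) (B : R -> T -> R).
Hypothesis BP : scaled_noise P S B.

Lemma measurable_norm_gt (y : R) : measurable [set x : R | y < `|x|].
Proof.
have -> : [set x : R | y < `|x|] = ~` `[(- y), y]%classic.
  apply/seteqP; split => x /=; rewrite in_itv/= -ler_norml; first by move=> /lt_geF ->.
  by move=> /negP; rewrite -ltNge.
exact: measurableC.
Qed.

Lemma noise_increment_measurable u v (A : set R) : measurable A ->
  measurable [set w | A (B v w - B u w)].
Proof.
move=> mA; rewrite -[X in measurable X]setTI.
have : measurable_fun [set: T] (fun w => B v w - B u w).
  by apply: measurable_funB; exact: (noise_measurable BP).
exact.
Qed.

Lemma noise_increment_tail u v y : S <= u -> u < v -> 0 < y ->
  (P [set w | y < `|B v w - B u w|]%R <= (128 * (v - u) ^+ 2 / y ^+ 4)%:E)%E.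
Proof.
move=> Su uv y0.
rewrite (noise_law BP Su uv (measurable_norm_gt y)).
have vu : 0 < v - u by rewrite subr_gt0.
have s0 : 0 < Num.sqrt (v - u) by rewrite sqrtr_gt0.
apply: le_trans (normal_prob_tail s0 y0) _; rewrite lee_fin.
have e4 (z : R) : z ^+ 4 = (z ^+ 2) ^+ 2 by rewrite -exprM.
by rewrite (e4 (Num.sqrt _)) sqr_sqrtr// ltW.
Qed.

Lemma block_event a l lam : S <= a -> 0 < l -> 0 < lam ->
  exists E : set T, [/\ measurable E, (P E <= (osc_cst R * l ^+ 2 / lam ^+ 4)%:E)%E &
    forall w, ~ E w -> forall v, a <= v <= a + l -> `|B v w - B a w| <= lam].
Proof.
move=> Sa l0 lam0.
pose pt (m i : nat) : R := a + l * (i%:R / 2 ^+ m).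
pose F m i := [set w | lam / 10 * (9 / 10) ^+ m < `|B (pt m i.+1) w - B (pt m i) w|].
have mF m i : measurable (F m i).
  exact: (noise_increment_measurable _ _ (measurable_norm_gt _)).
pose G m := \bigcup_(i in [set i | (i < 2 ^ m)%N]) F m i.
have mG m : measurable (G m) by apply: bigcup_measurable => i _; exact: mF.
pose c := 128 * l ^+ 2 / (lam / 10) ^+ 4.
(* Level [m] has [2 ^ m] increments, each failing with probability at most
   [c * (1 / 4) ^ m * (10 / 9) ^ (4 * m)]. The threshold ratio [9 / 10] is admissible because its
   fourth power exceeds [1 / 2]. *)
pose q : R := 1 / 2 * (10 / 9) ^+ 4.
have PG m : (P (G m) <= (c * q ^+ m)%:E)%E.
  pose u := 128 * (l / 2 ^+ m) ^+ 2 / (lam / 10 * (9 / 10) ^+ m) ^+ 4.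
  have -> : c * q ^+ m = (2 ^ m)%:R * u.
    have -> : q ^+ m = (2 ^+ m * ((9 / 10) ^+ m) ^+ 4)^-1.
      have -> : q = (2 * (9 / 10) ^+ 4)^-1 by rewrite /q; field.
      by rewrite exprVn exprMn -!exprM (mulnC 4).
    have p2 : 2 ^+ m != 0 :> R by rewrite expf_neq0.
    have t9 : (9 / 10) ^+ m != 0 :> R by rewrite expf_neq0// gt_eqF// divr_gt0.
    rewrite natrX /u /c; move: (2 ^+ m) ((9 / 10) ^+ m) p2 t9 => p t p2 t9.
    by field; rewrite p2 t9 gt_eqF.
  apply: union_bound_fin => // i im.
  have p2 : 0 < 2 ^+ m :> R by rewrite exprn_gt0.
  have ptE : pt m i.+1 - pt m i = l / 2 ^+ m.
    by rewrite /pt -natr1; field; rewrite gt_eqF.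
  rewrite /u -ptE; apply: noise_increment_tail.
  - by rewrite /pt (le_trans Sa)// lerDl mulr_ge0 ?(ltW l0)// divr_ge0// ltW.
  - by rewrite -subr_gt0 ptE divr_gt0.
  - by rewrite mulr_gt0 ?exprn_gt0// divr_gt0.
have q45 : q <= 4 / 5.
  have e4 (z : R) : z ^+ 4 = (z ^+ 2) ^+ 2 by rewrite -exprM.
  have h1 : (10 / 9 : R) ^+ 2 <= 31 / 25 by lra.
  have : ((10 / 9 : R) ^+ 2) ^+ 2 <= (31 / 25) ^+ 2.
    by rewrite lerXn2r ?nnegrE ?exprn_ge0//; lra.
  by rewrite /q e4; lra.
have q0 : 0 <= q by rewrite /q mulr_ge0// exprn_ge0.
have c0 : 0 <= c.
  rewrite /c; apply: divr_ge0; last by apply: exprn_ge0; apply: divr_ge0 => //; exact: ltW.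
  by apply: mulr_ge0 => //; exact: sqr_ge0.
exists (\bigcup_m G m); split; first exact: bigcup_measurable.
  apply: union_bound mG PG _ => n.
  apply: (@le_trans _ _ (c / (1 - q))).
    by apply: geometric_sum_le => //; rewrite q0 /=; lra.
  apply: (@le_trans _ _ (5 * c)).
    rewrite ler_pdivrMr; last by lra.
    have : c * q <= c * (4 / 5) by rewrite ler_wpM2l.
    by lra.
  rewrite le_eqVlt; apply/orP; left; apply/eqP; rewrite /c /osc_cst -lock.
  by field; rewrite gt_eqF.
move=> w Ew v vP.
have -> : lam = 10 * (lam / 10) by field.
apply: (@chaining_bound _ (fun v => B v w) a l) vP => //.
  exact: (noise_continuous BP).
move=> m i im; rewrite leNgt; apply/negP => h; apply: Ew.
by exists m => //; exists i.
Qed.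

End noise.

Lemma uniform_delta (R : realType) (g : R -> R) (a c e : R) :
  continuous g -> 0 < e ->
  exists2 dl, 0 < dl & forall x, a <= x <= c -> forall z, `|z - x| < dl ->
    `|g z - g x| < e.
Proof.
move=> cg e0.
have e20 : 0 < e / 2 by rewrite divr_gt0.
have := @segment_compact R a c; rewrite compact_near_coveringP => /(_ R 0^'+).
move=> /(_ (fun dl x => forall z, `|z - x| < dl -> `|g z - g x| < e) _) [|].
  move=> x _.
  have [d d0 dP] := continuous_delta x cg e20.
  have d20 : 0 < d / 2 by rewrite divr_gt0.
  exists (ball x (d / 2), [set dl | 0 < dl < d / 2]) => /=.
    split; first exact: nbhsx_ballx.
    by near=> dl => /=; apply/andP; split; near: dl; [exact: nbhs_right_gt|exact: nbhs_right_lt].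
  move=> [y dl] /= [+ /andP[_ dld]] z; rewrite /ball/= => xy zy.
  have h1 : `|g y - g x| < e / 2 by apply: dP; rewrite distrC; lra.
  have h2 : `|g z - g x| < e / 2.
    apply: dP; have -> : z - x = (z - y) - (x - y) by ring.
    by apply: (le_lt_trans (ler_normB _ _)); lra.
  have -> : g z - g y = (g z - g x) - (g y - g x) by ring.
  by apply: (le_lt_trans (ler_normB _ _)); lra.
move=> dl /= dl0 H.
exists (dl / 2); first by rewrite divr_gt0.
move=> x xac; apply: (H (dl / 2)).
- by rewrite /= sub0r normrN gtr0_norm ?divr_gt0//; lra.
- by rewrite divr_gt0.
- by rewrite /= in_itv.
Unshelve. all: by end_near.
Qed.

Lemma scaled_noiseN (R : realType) (d : measure_display) (T : measurableType d)
    (P : probability T R) (S : R) (B : R -> T -> R) :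
  scaled_noise P S B -> scaled_noise P S (fun v w => - B v w).
Proof.
move=> BP.
have mopp (A : set R) : measurable A -> measurable ((fun x : R => - x) @^-1` A).
  by move=> mA; apply: measurable_preimageT => //; exact: measurable_funN.
have E (u v : R) (A : set R) : [set w | A (- B v w - - B u w)] =
    [set w | ((fun x => - x) @^-1` A) (B v w - B u w)].
  by apply/seteqP; split => w /=; rewrite opprB opprK addrC.
split.
- by move=> v; apply: measurable_funN; exact: (noise_measurable BP).
- by move=> w v; apply: (@cvgN _ R^o); exact: (noise_continuous BP).
- move=> u v A Su uv mA; rewrite E (noise_law BP Su uv (mopp _ mA)) normal_prob_opp//.
  by rewrite sqrtr_gt0 subr_gt0.
- move=> n r Sr homor A mA.
  have := noise_independent BP n Sr homor (fun i => mopp _ (mA i)).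
  under [in X in _ -> _ = X]eq_bigr do rewrite E.
  move=> <-; congr (P _); apply/seteqP; split => w h i iN.
    by have := h i iN; rewrite /= opprB opprK addrC.
  by have := h i iN; rewrite /= opprB opprK addrC.
Qed.

Section noise_events.
Context {R : realType} {d : measure_display} {T : measurableType d}.
Variables (P : probability T R) (S : R) (B : R -> T -> R).
Hypothesis BP : scaled_noise P S B.

Let osc0 : 0 <= osc_cst R.
Proof. exact: osc_cst_ge0. Qed.

(** The threshold grows in proportion to the distance of the block's left end from [0], so the
    failure probabilities decay like inverse squares and their sum does not depend on [S]. *)
Lemma growth_event k L : S < 0 -> 0 < k -> 0 < L ->
  exists E : set T, [/\ measurable E,
    (P E <= (osc_cst R * (1024 + k ^+ 2) / L ^+ 4)%:E)%E &
    forall w, ~ E w -> forall v, S <= v <= k -> `|B v w - B 0 w| <= L * (1 + `|v|)].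
Proof.
move=> S0 k0 L0.
have L40 : 0 < L ^+ 4 by rewrite exprn_gt0.
(* All these blocks end at [0] and differ in their left end, clipped at [S]. Both [B v] and [B 0]
   are compared with [B (a j)], so the threshold [L * j.+1%:R / 4] is spent twice. *)
pose a (j : nat) : R := Num.max S (- j.+1%:R).
have aS j : S <= a j by rewrite /a le_max lexx.
have a0 j : a j < 0 by rewrite /a gt_max S0 oppr_lt0 ltr0n.
have na0 j : 0 < - a j by rewrite oppr_gt0.
have lam0 j : 0 < L * j.+1%:R / 4 by rewrite divr_gt0 ?mulr_gt0 ?ltr0n.
have /choice[E EP] := fun j => block_event BP (aS j) (na0 j) (lam0 j).
have [E' [mE' PE' E'P]] := block_event BP (ltW S0) k0 L0.
have mE j : measurable (E j) by have [] := EP j.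
exists ((\bigcup_j E j) `|` E'); split.
- by apply: measurableU => //; exact: bigcup_measurable.
- apply: (le_trans (measureU2 _ _ _)) => //; first exact: bigcup_measurable.
  have -> : osc_cst R * (1024 + k ^+ 2) / L ^+ 4 =
     osc_cst R * 1024 / L ^+ 4 + osc_cst R * k ^+ 2 / L ^+ 4.
    by rewrite mulrDr mulrDl.
  rewrite EFinD; apply: leeD => //.
  (* [1024] is [256], the fourth power of the [4] in the threshold, times the [4] that allows [j.+1]
     to be replaced by [j + 2], whose inverse squares sum to at most [1]. *)
  apply: (@union_bound _ _ _ _ _ (fun j => osc_cst R * 1024 / L ^+ 4 * (j + 2)%:R ^- 2)) => //.
    move=> j; have [_ h _] := EP j; apply: le_trans h _; rewrite lee_fin.
    have aj : (- a j) ^+ 2 <= j.+1%:R ^+ 2.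
      rewrite lerXn2r ?nnegrE ?ler0n ?(ltW (na0 j))//.
      by rewrite lerNl /a le_max lexx orbT.
    apply: (@le_trans _ _ (osc_cst R * j.+1%:R ^+ 2 / (L * j.+1%:R / 4) ^+ 4)).
      apply: ler_wpM2r; first by rewrite invr_ge0 exprn_ge0// ltW.
      exact: ler_wpM2l.
    have -> : (j + 2)%:R = j.+1%:R + 1 :> R by rewrite addn2 -[in LHS]natr1.
    set z : R := j.+1%:R.
    have z1 : 1 <= z by rewrite /z ler1n.
    clearbody z; have z0 : 0 < z by lra.
    have z10 : 0 < z + 1 by lra.
    have -> : osc_cst R * z ^+ 2 / (L * z / 4) ^+ 4 =
       osc_cst R / L ^+ 4 * (256 / z ^+ 2).
      by field; rewrite !gt_eqF//; lra.
    have -> : osc_cst R * 1024 / L ^+ 4 * (z + 1) ^- 2 =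
       osc_cst R / L ^+ 4 * (1024 / (z + 1) ^+ 2).
      by field; rewrite !gt_eqF//; lra.
    apply: ler_wpM2l; first by rewrite divr_ge0// ltW.
    rewrite ler_pdivrMr ?exprn_gt0//.
    rewrite mulrAC ler_pdivlMr ?exprn_gt0//.
    have : 0 <= (z - 1) * (3 * z + 1) by rewrite mulr_ge0//; lra.
    by lra.
  move=> n; rewrite -mulr_sumr -[leRHS]mulr1; apply: ler_wpM2l.
    apply: divr_ge0; last exact: ltW.
    by apply: mulr_ge0; [exact: osc0|exact: ler0n].
  by have := @inverse_square_sum_le R 1 n isT; rewrite invr1.
move=> w /not_orP[Ew E'w] v /andP[Sv vk].
have [v0|v0] := leP 0 v.
  have := E'P w E'w v; rewrite add0r v0 vk => /(_ isT) /le_trans; apply.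
  by rewrite ler_peMr ?(ltW L0)// lerDl.
have vN : 0 <= - v by rewrite oppr_ge0 ltW.
have /andP[j1 j2] := truncn_itv vN.
move: (Num.truncn _) j1 j2 => j j1 j2.
have Ejw : ~ E j w by move=> h; apply: Ew; exists j.
have [_ _ h] := EP j.
have av : a j <= v by rewrite /a ge_max Sv /= lerNl ltW.
have hv := h w Ejw v; rewrite av /= subrr (ltW v0) in hv.
have h0 := h w Ejw 0; rewrite (ltW (a0 j)) /= subrr lexx in h0.
have -> : B v w - B 0 w = (B v w - B (a j) w) - (B 0 w - B (a j) w) by ring.
apply: (le_trans (ler_normB _ _)).
rewrite (ltr0_norm v0).
have : L * j.+1%:R <= L * (1 - v) by rewrite ler_pM2l// -natr1; lra.
have := hv isT; have := h0 isT.
have : 0 <= L * (1 - v) by rewrite mulr_ge0//; lra.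
lra.
Qed.

(** The block from [sqrt n] to [sqrt (n + 1)] has length at most [1 / sqrt n]; with threshold
    [n ^ (1 / 4)] the ratio [l ^ 2 / lam ^ 4] is at most [n ^ -2], which is summable. *)
Lemma osc_event (n1 : nat) : (0 < n1)%N -> S <= 0 ->
  exists E : set T, [/\ measurable E, (P E <= (osc_cst R / n1%:R)%:E)%E &
    forall w, ~ E w -> forall n, (n1 < n)%N ->
    forall v, Num.sqrt n%:R <= v <= Num.sqrt n.+1%:R ->
    `|B v w - B (Num.sqrt n%:R) w| <= Num.sqrt (Num.sqrt n%:R)].
Proof.
move=> n10 S0.
pose a (j : nat) : R := Num.sqrt (j + n1.+1)%:R.
pose l (j : nat) : R := Num.sqrt (j + n1.+1).+1%:R - a j.
have nS0 j : 0 < (j + n1.+1)%:R :> R by rewrite ltr0n addnS.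
have a0 j : 0 < a j by rewrite sqrtr_gt0.
have aS j : S <= a j by rewrite (le_trans S0)// ltW.
have l0 j : 0 < l j by rewrite subr_gt0 ltr_sqrt ?ltr_nat// ltr0n.
have lam0 j : 0 < Num.sqrt (a j) by rewrite sqrtr_gt0.
have /choice[E EP] := fun j => block_event BP (aS j) (l0 j) (lam0 j).
have mE j : measurable (E j) by have [] := EP j.
exists (\bigcup_j E j); split; first exact: bigcup_measurable.
  apply: (@union_bound _ _ _ _ _ (fun j => osc_cst R * (j + n1.+1)%:R ^- 2)) => //.
    move=> j; have [_ h _] := EP j; apply: le_trans h _; rewrite lee_fin -mulrA.
    apply: ler_wpM2l => //.
    have -> : Num.sqrt (a j) ^+ 4 = (j + n1.+1)%:R.
      by rewrite (exprM _ 2 2) sqr_sqrtr ?(ltW (a0 j))// sqr_sqrtr// ltW.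
    have la : l j * a j <= 1.
      have : l j * (l j + 2 * a j) = 1.
        rewrite /l; have -> : forall p q : R, (p - q) * (p - q + 2 * q) = p ^+ 2 - q ^+ 2.
          by move=> p q; ring.
        by rewrite !sqr_sqrtr ?ler0n// -natr1; lra.
      have := mulr_gt0 (l0 j) (a0 j); have := sqr_ge0 (l j); lra.
    have : (l j * a j) ^+ 2 <= 1 by rewrite expr_le1// mulr_ge0// ltW.
    rewrite exprMn [a j ^+ 2]sqr_sqrtr ?(ltW (nS0 j))// => h2.
    by rewrite expr2 invfM ler_pM2r ?invr_gt0// -[leRHS]mul1r ler_pdivlMr.
  move=> n; rewrite -mulr_sumr; apply: ler_wpM2l => //.
  exact: inverse_square_sum_le.
move=> w Ew n n1n v vP.
have nE : (n - n1.+1 + n1.+1 = n)%N by rewrite subnK.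
have [_ _ h] := EP (n - n1.+1)%N.
have := h w _ v; rewrite /l /a nE addrC subrK; apply => //.
by move=> h2; apply: Ew; exists (n - n1.+1)%N.
Qed.

End noise_events.

(* The Riemann sums approximate the stochastic integral of [wt] without our
   having to construct it; only their exact Gaussian law is used. *)
Section riemann_event.
Context {R : realType} {d : measure_display} {T : measurableType d}.
Variables (P : probability T R) (S k : R) (B : R -> T -> R).
Hypotheses (S0 : S < 0) (k1 : 1 <= k).
Hypothesis BP : scaled_noise P S B.

Definition grid (N i : nat) : R := S + (k - S) * (i%:R / N.+1%:R).

Definition riemann_sum (N : nat) (w : T) : R :=
  \sum_(0 <= i < N.+1) wt (grid N i) * (B (grid N i.+1) w - B (grid N i) w).

Let Sk : 0 < k - S. Proof. by rewrite subr_gt0 (lt_le_trans S0)// (le_trans ler01). Qed.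

Lemma grid0 N : grid N 0 = S. Proof. by rewrite /grid mul0r mulr0 addr0. Qed.

Lemma gridN N : grid N N.+1 = k.
Proof. by rewrite /grid divff ?pnatr_eq0// mulr1 addrC subrK. Qed.

Lemma gridS N i : grid N i.+1 - grid N i = (k - S) / N.+1%:R.
Proof.
have : N.+1%:R != 0 :> R by rewrite pnatr_eq0.
by rewrite /grid -(natr1 i); move: (N.+1%:R) => n n0; field.
Qed.

Lemma grid_lt N i : grid N i < grid N i.+1.
Proof. by rewrite -subr_gt0 gridS divr_gt0. Qed.

Lemma grid_homo N : {homo grid N : i j / (i <= j)%N >-> i <= j}.
Proof.
move=> i j ij; rewrite /grid lerD2l ler_pM2l// ler_pM2r ?invr_gt0//.
by rewrite ler_nat.
Qed.

Lemma measurable_riemann_sum N : measurable_fun [set: T] (riemann_sum N).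
Proof.
apply: measurable_sum => i; apply: measurable_funM; first exact: measurable_cst.
by apply: measurable_funB; exact: (noise_measurable BP).
Qed.

Lemma wt_ge12 (v : R) : `|v| <= 1 -> 1 / 2 <= wt v.
Proof.
move=> v1; apply: le_trans (expR_ge1Dx _).
have : `|v| ^+ 2 <= 1 by rewrite expr_le1.
rewrite real_normK ?num_real//; lra.
Qed.

Lemma riemann_variance N : k - S <= N.+1%:R ->
  1 / 4 <= \sum_(0 <= i < N.+1) (wt (grid N i) * Num.sqrt (grid N i.+1 - grid N i)) ^+ 2.
Proof.
move=> hN.
(* [psi] clamps to [[0, 1]]: its increments telescope to [1], never exceed the steps, and, the mesh
   being at most [1], vanish unless the left end point lies in [[-1, 1]], where
   [wt ^+ 2 >= 1 / 4]. *)
pose psi (v : R) : R := Num.min (Num.max v 0) 1.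
have -> : 1 / 4 = \sum_(0 <= i < N.+1) 1 / 4 * (psi (grid N i.+1) - psi (grid N i)) :> R.
  rewrite -mulr_sumr telescope_sumr// gridN grid0 /psi.
  have -> : Num.max k 0 = k by apply: max_idPl; exact: le_trans k1.
  have -> : Num.max S 0 = 0 by apply: max_idPr; exact: ltW.
  by rewrite (min_idPr k1) (min_idPl ler01); lra.
apply: ler_sum => i _.
have lt := grid_lt N i.
rewrite exprMn sqr_sqrtr; last by rewrite subr_ge0 ltW.
have h1 : grid N i.+1 - grid N i <= 1 by rewrite gridS ler_pdivrMr ?mul1r.
move: lt h1; set p := grid N i; set q := grid N i.+1 => pq pq1.
have psipq : psi q - psi p <= q - p.
  rewrite /psi !maxEle !minEle; do !case: ifPn; rewrite -?ltNge; lra.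
have w20 : 0 <= wt p ^+ 2 by exact: sqr_ge0.
have [p1|p1] := leP `|p| 1.
  have w12 := wt_ge12 p1.
  have : (1 / 2) ^+ 2 <= wt p ^+ 2 by rewrite lerXn2r ?nnegrE//; lra.
  move=> h; have : 1 / 4 * (q - p) <= wt p ^+ 2 * (q - p).
    by apply: ler_wpM2r; lra.
  lra.
have -> : psi q - psi p = 0.
  have [p0|p0] := leP 0 p.
    rewrite ger0_norm// in p1.
    rewrite /psi !(max_idPl _) ?(min_idPr _) ?subrr//; lra.
  rewrite ltr0_norm// in p1.
  by rewrite /psi !(max_idPr _) ?subrr//; lra.
by rewrite mulr0 mulr_ge0//; lra.
Qed.

Lemma riemann_sum_law N : k - S <= N.+1%:R -> exists2 s, 1 / 2 <= s &
  forall A, measurable A -> P (riemann_sum N @^-1` A) = normal_prob 0 s A.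
Proof.
move=> hN.
pose s i := wt (grid N i) * Num.sqrt (grid N i.+1 - grid N i).
pose Y i w := wt (grid N i) * (B (grid N i.+1) w - B (grid N i) w).
have s0 i : 0 < s i by rewrite mulr_gt0 ?wt_gt0// sqrtr_gt0 subr_gt0 grid_lt.
have mY i : measurable_fun [set: T] (Y i).
  apply: measurable_funM; first exact: measurable_cst.
  by apply: measurable_funB; exact: (noise_measurable BP).
have indY (A : nat -> set R) : (forall i, measurable (A i)) ->
    P [set w | forall i, (i < N.+1)%N -> A i (Y i w)] =
    (\prod_(0 <= i < N.+1) normal_prob 0 (s i) (A i))%E.
  move=> mA.
  pose A' i := (fun x => wt (grid N i) * x) @^-1` A i.
  have mA' i : measurable (A' i).
    by apply: measurable_preimageT => //; exact: measurable_funM.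
  have Sg : S <= grid N 0 by rewrite grid0.
  rewrite (noise_independent BP N.+1 Sg (@grid_homo N) mA').
  apply: eq_bigr => i _; rewrite (noise_law BP _ (grid_lt N i) (mA' i)).
    by apply: normal_prob_mulr (wt_gt0 _) (mA i); rewrite sqrtr_gt0 subr_gt0 grid_lt.
  by rewrite -(grid0 N); exact: grid_homo.
exists (Num.sqrt (\sum_(0 <= i < N.+1) s i ^+ 2)).
  have <- : Num.sqrt ((1 / 2) ^+ 2) = 1 / 2 :> R by rewrite sqrtr_sqr ger0_norm.
  rewrite ler_wsqrtr//; apply: le_trans (riemann_variance hN); lra.
by move=> A mA; exact: (@gaussian_sum_law _ _ _ P N.+1 Y s mY s0 indY A isT mA).
Qed.

Lemma riemann_sum_lt N dl : k - S <= N.+1%:R -> 0 <= dl ->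
  (P [set w | riemann_sum N w < dl]%R <= (1 / 2 + 4 * dl)%:E)%E.
Proof.
move=> hN dl0; have [s s12 sP] := riemann_sum_law hN.
have s0 : 0 < s by lra.
have mlt (c : R) : measurable [set x : R | x < c].
  rewrite (_ : [set x | _] = `]-oo, c[%classic); first exact: measurable_itv.
  by apply/seteqP; split => x /=; rewrite in_itv.
have mle : measurable [set x : R | `|x| <= dl].
  rewrite (_ : [set x : R | `|x| <= dl]%R = `[(- dl), dl]%classic); first exact: measurable_itv.
  by apply/seteqP; split => x /=; rewrite in_itv/= ler_norml.
rewrite (sP _ (mlt dl)).
apply: (@le_trans _ _ (normal_prob 0 s ([set x | x < 0]%R `|` [set x | `|x| <= dl]%R))).
  apply: le_measure; first by apply: mem_set; exact: mlt.
    by apply: mem_set; apply: measurableU; [exact: mlt|exact: mle].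
  move=> x /= xd; have [x0|x0] := ltP x 0; [by left|right].
  by rewrite ger0_norm// ltW.
apply: (le_trans (measureU2 (normal_prob 0 s) (mlt 0) mle)).
rewrite EFinD; apply: leeD; first by have := normal_prob_lt0 s0; rewrite div1r.
apply: (le_trans (normal_prob_near0 s0 dl0)); rewrite lee_fin.
rewrite ler_pdivrMr//.
have : 4 * dl * (1 / 2) <= 4 * dl * s by apply: ler_wpM2l => //; lra.
lra.
Qed.

(** How fine a grid is needed depends on the path, so no single grid can be fixed in advance. The
    exceptional event is that all sufficiently fine sums lie below [dl]: an increasing union of
    events, each contained in one event [riemann_sum n w < dl], hence no likelier than the common
    bound for those. *)
Lemma riemann_event dl : 0 <= dl ->
  exists E : set T, [/\ measurable E, (P E <= (1 / 2 + 4 * dl)%:E)%E &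
    forall w, ~ E w -> forall N0, exists2 N, (N0 <= N)%N & dl <= riemann_sum N w].
Proof.
move=> dl0.
pose N1 := Num.truncn (k - S).
have N1P n : (N1 <= n)%N -> k - S <= n.+1%:R.
  move=> N1n; have /andP[_ h] := truncn_itv (ltW Sk).
  by apply: (le_trans (ltW h)); rewrite ler_nat ltnS.
pose G n := [set w | riemann_sum n w < dl].
have mG n : measurable (G n).
  rewrite (_ : G n = riemann_sum n @^-1` `]-oo, dl[%classic).
    by rewrite -[X in measurable X]setTI; exact: measurable_riemann_sum.
  by apply/seteqP; split => w /=; rewrite in_itv.
pose F m := \bigcap_(n in [set n | (m + N1 <= n)%N]) G n.
have mF m : measurable (F m) by apply: bigcap_measurableType => n _; exact: mG.
exists (\bigcup_m F m); split; first exact: bigcup_measurable.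
  have mU : measurable (\bigcup_m F m) by exact: bigcup_measurable.
  have homoF : {homo F : n m / (n <= m)%N >-> (n <= m)%O}.
    move=> n m nm; apply/subsetPset => w h i mi; apply: h.
    by rewrite /= in mi *; apply: leq_trans mi; rewrite leq_add2r.
  have cvgF := nondecreasing_cvg_mu (mu := P) mF mU homoF.
  rewrite -(cvg_lim _ cvgF)//; apply: lime_le; first by apply/cvg_ex; eexists; exact: cvgF.
  apply: nearW => m.
  apply: (@le_trans _ _ (P (G (m + N1)%N))).
    by apply: le_measure; rewrite ?inE// => w; apply; exact: leqnn.
  by apply: riemann_sum_lt => //; apply: N1P; rewrite leq_addl.
move=> w Ew N0; apply: contrapT => h; apply: Ew; exists N0 => // n /= hn.
rewrite /G/= ltNge; apply/negP => hd; apply: h; exists n => //.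
by apply: leq_trans hn; rewrite leq_addr.
Qed.

End riemann_event.

Lemma wt_sqrt_le (R : realType) (n : nat) : (0 < n)%N ->
  wt (Num.sqrt n%:R : R) <= 16 / n%:R ^+ 2.
Proof.
move=> n0; have n0' : 0 < n%:R :> R by rewrite ltr0n.
rewrite /wt sqr_sqrtr ?ler0n//.
apply: (le_trans (expRN_le _)); first by rewrite divr_gt0.
by rewrite le_eqVlt; apply/orP; left; apply/eqP; field; rewrite gt_eqF.
Qed.

Lemma rt4_le (R : realType) (n : nat) : (0 < n)%N -> rt4 R n <= n%:R.
Proof.
move=> n0; have n1 : 1 <= n%:R :> R by rewrite ler1n.
have h (x : R) : 1 <= x -> Num.sqrt x <= x.
  move=> x1; have x0 : 0 <= x by lra.
  rewrite -[leRHS]ger0_norm// -sqrtr_sqr; apply: ler_wsqrtr.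
  by rewrite expr2 ler_peMl.
apply: le_trans (h _ n1); apply: h.
by rewrite -[leLHS]sqrtr1 ler_wsqrtr.
Qed.

(** The conclusion restarts the rungs from height [1]. This is weaker, as [m0 >= 20], but it no
    longer depends on the height of the launch. *)
Lemma climb_from (R : realType) (kap rho S eta m0 : R) (n0 : nat) (B x : R -> R) :
  0 < kap -> 80 * Num.sqrt kap <= 1 -> `|rho| <= 1 -> S <= 0 -> 0 < eta ->
  80 * eta * Num.sqrt kap <= 1 -> (2 <= n0)%N -> 20 <= m0 ->
  20 * eta * rt4 R n0 <= m0 ->
  langevin kap rho S (fun v => eta * (B v - B 0)) x ->
  (forall n, (n0 <= n)%N -> forall v, Num.sqrt n%:R <= v <= Num.sqrt n.+1%:R ->
     `|B v - B (Num.sqrt n%:R)| <= rt4 R n) ->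
  m0 <= x (Num.sqrt n0%:R) ->
  forall n, (n0 <= n)%N -> forall v, Num.sqrt n%:R <= v <= Num.sqrt n.+1%:R ->
  4 / 5 * rung kap 1 n0 n <= x v.
Proof.
move=> kap0 kap1 rho1 S0 eta0 etakap n02 m020 etam0 L osc xm0 n n0n v vP.
apply: le_trans (_ : 4 / 5 * rung kap m0 n0 n <= _).
  rewrite ler_pM2l// /rung le_min !ge_min lexx orbT andbT; apply/orP; left.
  by rewrite ler_wpM2l// ?exprn_ge0//; lra.
apply: (climb_rungs kap0 kap1 rho1 S0 (ltW eta0) etakap n02 m020 L etam0) => // i n0i u uP.
rewrite -mulrBr normrM (gtr0_norm eta0) ler_pM2l// opprB addrA subrK.
exact: osc.
Qed.

(** * Scaled solutions *)

Section launch.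
Variable R : realType.

(** A measurable null set replaces the almost-everywhere quantifier, ready to be joined to the other
    exceptional events. *)
Definition scaled_solution (d : measure_display) (T : measurableType d)
    (P : probability T R) (kap rho eta S : R)
    (B x : R -> T -> R) : Prop :=
  scaled_noise P S B /\
  exists N : set T, [/\ measurable N, P N = 0%E & forall w, ~ N w ->
    langevin kap rho S (fun v => eta * (B v w - B 0 w)) (x ^~ w) /\ x S w = 0].

Lemma scaled_solutionN (d : measure_display) (T : measurableType d)
    (P : probability T R) kap rho eta S B x :
  scaled_solution P kap rho eta S B x ->
  scaled_solution P kap (- rho) eta S (fun v w => - B v w) (fun v w => - x v w).
Proof.
move=> [BP [N [mN N0 NP]]]; split; first exact: scaled_noiseN.
exists N; split => // w Nw; have [L xS] := NP w Nw.
split; last by rewrite xS oppr0.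
have := langevinN L.
rewrite (_ : (fun v => - (eta * (B v w - B 0 w))) = (fun v => eta * (- B v w - - B 0 w)))//.
by apply/funext => v; ring.
Qed.

(** [n0], [dl] and [L] are chosen from [zeta] alone, before the probability space, [kap], [eta] and
    [S]; the later limits rest on this uniformity. *)
Lemma slow_launch (zeta : R) : 0 < zeta ->
  exists n0 dl L, [/\ (2 <= n0)%N, 0 < dl, 0 < L &
  forall (d : measure_display) (T : measurableType d) (P : probability T R) (kap rho eta S : R) (B x : R -> T -> R),
    S < 0 -> 0 < kap -> `|rho| <= 1 -> 0 < eta ->
    80 * Num.sqrt kap <= 1 -> 80 * eta * Num.sqrt kap <= 1 -> 20 <= dl * eta ->
    4 * defect_rate kap (Num.sqrt n0%:R) (L * eta) 1 <= dl * eta ->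
    scaled_solution P kap rho eta S B x ->
    exists E, [/\ measurable E, (P E <= (1 / 2 + zeta)%:E)%E &
      forall w, ~ E w -> forall n, (n0 <= n)%N -> forall v,
      Num.sqrt n%:R <= v <= Num.sqrt n.+1%:R ->
      4 / 5 * rung kap 1 n0 n <= x v w]].
Proof.
(* The Riemann sum is tested at level [2 * dl], which costs [8 * dl = zeta / 4]; the growth and
   oscillation events take [zeta / 4] each. *)
move=> z0; pose dl := zeta / 32.
have dl0 : 0 < dl by rewrite divr_gt0.
have osc0 := osc_cst_ge0 R.
(* With [n0 >= 320 / dl] the amplification [1 / wt k] lifts [dl * eta] to at least
   [20 * eta * rt4 R n0]. The second entry makes the oscillation event cost at most [zeta / 4]. *)
pose M := Num.max (320 / dl) (4 * osc_cst R / zeta).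
pose n1 := (Num.truncn M).+1.
have n1M : M <= n1%:R.
  have M0 : 0 <= M by rewrite le_max divr_ge0 ?ler0n ?(ltW dl0).
  by have /andP[_ /ltW] := truncn_itv M0.
pose n0 := n1.+1; pose k : R := Num.sqrt n0%:R.
have k1 : 1 <= k by rewrite -[leLHS]sqrtr1 ler_wsqrtr// ler1n.
pose L := Num.max 1 (4 * (osc_cst R * (1024 + k ^+ 2)) / zeta).
have L1 : 1 <= L by rewrite le_max lexx.
have L0 : 0 < L by lra.
exists n0, dl, L; split => // d T P kap rho eta S B x S0 kap0 rho1 eta0 kap1 etakap eta20 def [BP [N [mN PN NP]]].
have [E1 [mE1 PE1 E1P]] := growth_event BP S0 (lt_le_trans ltr01 k1) L0.
have [E2 [mE2 PE2 E2P]] := osc_event BP (isT : (0 < n1)%N) (ltW S0).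
have [E3 [mE3 PE3 E3P]] := riemann_event S0 k1 BP (mulr_ge0 (ler0n R 2) (ltW dl0)).
exists (N `|` (E1 `|` (E2 `|` E3))); split.
- by do !apply: measurableU.
- have PE1' : (P E1 <= (zeta / 4)%:E)%E.
    apply: (le_trans PE1); rewrite lee_fin ler_pdivrMr ?exprn_gt0//.
    apply: (@le_trans _ _ (zeta / 4 * L)); last first.
      by rewrite ler_pM2l ?divr_gt0// -[leLHS]expr1 ler_weXn2l.
    have : 4 * (osc_cst R * (1024 + k ^+ 2)) / zeta <= L by rewrite le_max lexx orbT.
    by rewrite ler_pdivrMr//; lra.
  have PE2' : (P E2 <= (zeta / 4)%:E)%E.
    apply: (le_trans PE2); rewrite lee_fin ler_pdivrMr ?ltr0n//.
    have : 4 * osc_cst R / zeta <= n1%:R.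
      by apply: le_trans n1M; rewrite le_max lexx orbT.
    by rewrite ler_pdivrMr//; lra.
  have mE23 : measurable (E2 `|` E3) by exact: measurableU.
  have mE123 : measurable (E1 `|` (E2 `|` E3)) by exact: measurableU.
  apply: (le_trans (measureU2 P mN mE123)); rewrite [X in (X + _ <= _)%E]PN add0e.
  apply: (le_trans (measureU2 P mE1 mE23)).
  apply: (@le_trans _ _ ((zeta / 4)%:E + ((zeta / 4)%:E + (1 / 2 + 4 * (2 * dl))%:E))%E).
    apply: leeD => //; apply: (le_trans (measureU2 P mE2 mE3)); exact: leeD.
  by rewrite -!EFinD lee_fin /dl; lra.
move=> w /not_orP[Nw /not_orP[E1w /not_orP[E2w E3w]]].
have [Lw xS] := NP w Nw.
set b := (fun v => eta * (B v w - B 0 w)) in Lw.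
have bP v : S <= v <= k -> `|b v| <= L * eta * (1 + `|v|).
  move=> /(E1P w E1w); rewrite /b normrM (gtr0_norm eta0) => h.
  by rewrite [L * eta]mulrC -mulrA ler_pM2l.
have k0 : 0 <= k by lra.
have Le0 : 0 <= L * eta by rewrite mulr_ge0// ltW.
have [cb cx dx] := Lw.
(* The path is fixed from here on: its modulus of continuity says how fine the grid must be for
   oscillations of at most [1], and [E3P] supplies a grid at least that fine with a large sum. *)
have [dd dd0 ddP] := uniform_delta S k cb (ltr01 : 0 < 1 :> R).
have [N1 N1P] : exists N1 : nat, forall n, (N1 <= n)%N -> (k - S) / n.+1%:R < dd.
  exists (Num.truncn ((k - S) / dd)) => n hn.
  have kS0 : 0 <= (k - S) / dd by rewrite divr_ge0 ?(ltW dd0)// subr_ge0; lra.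
  have /andP[_ h] := truncn_itv kS0.
  rewrite ltr_pdivrMr ?ltr0n// mulrC -ltr_pdivrMr//.
  by apply: (lt_le_trans h); rewrite ler_nat ltnS.
have [m N1m Xm] := E3P w E3w N1.
have wk0 := wt_gt0 k.
have est : `|wt k * x k w - eta * riemann_sum S k B m w| <= 4 * defect_rate kap k (L * eta) 1.
  have := @riemann_estimate _ kap rho S k (L * eta) b (x ^~ w) (ltW kap0) rho1 (ltW S0)
    k0 Le0 bP Lw xS m.+1 (grid S k m) 1 ler01 (grid_homo S0 k1 m) (grid0 S k m) (gridN S k m).
  rewrite (_ : \sum_(i < m.+1) _ = eta * riemann_sum S k B m w); last first.
    rewrite /riemann_sum big_mkord mulr_sumr; apply: eq_bigr => i _.
    by rewrite /b; ring.
  apply => i im v /andP[v1 v2].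
  apply/ltW/ddP.
    rewrite -{1}(grid0 S k m) (grid_homo S0 k1 m)//= -[leRHS](gridN S k m).
    exact: grid_homo.
  rewrite distrC ger0_norm ?subr_ge0//.
  apply: le_lt_trans (N1P m N1m); rewrite -(gridS S k m i); lra.
(* Of the [2 * dl * eta] in the Riemann sum, at most one half is lost to the approximation error. *)
have xk : dl * eta <= wt k * x k w.
  move: est def; rewrite ler_norml => /andP[h _].
  have : eta * (2 * dl) <= eta * riemann_sum S k B m w by rewrite ler_pM2l.
  by rewrite -/k; lra.
have xk' : dl * eta / wt k <= x k w by rewrite ler_pdivrMr// [x k w * _]mulrC.
have de0 : 0 < dl * eta by rewrite mulr_gt0.
have de_le : dl * eta <= dl * eta / wt k.
  by rewrite ler_pdivlMr// ler_piMr ?wt_le1// ltW.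
apply: (climb_from kap0 kap1 rho1 (ltW S0) eta0 etakap _ _ _ Lw _ xk') => //.
- exact: le_trans de_le.
- rewrite ler_pdivlMr//.
  have n00 : 0 < n0%:R :> R by rewrite ltr0n.
  have h1 : rt4 R n0 * wt k <= n0%:R * (16 / n0%:R ^+ 2).
    by apply: ler_pM; rewrite ?rt4_ge0 ?(ltW wk0) ?rt4_le ?wt_sqrt_le.
  have h2 : 320 / dl <= n0%:R.
    apply: (@le_trans _ _ n1%:R); last by rewrite ler_nat.
    by apply: le_trans n1M; rewrite le_max lexx.
  have h3 : 20 * (n0%:R * (16 / n0%:R ^+ 2)) <= dl.
    have -> : 20 * (n0%:R * (16 / n0%:R ^+ 2)) = 320 / n0%:R :> R by field; rewrite gt_eqF.
    by rewrite ler_pdivrMr// mulrC -ler_pdivrMr.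
  have : eta * (20 * (rt4 R n0 * wt k)) <= eta * dl by rewrite ler_pM2l//; lra.
  lra.
- by move=> n n0n v vP; exact: E2P.
Qed.

(** Here the entire noise is an error term, bounded by its linear growth; the drift [rho = 1] alone
    brings [wt k * x k] to [1 / 4]. *)
Lemma fast_launch (zeta : R) : 0 < zeta ->
  exists n0 L, [/\ (2 <= n0)%N, 0 < L &
  forall (d : measure_display) (T : measurableType d) (P : probability T R) (kap eta S : R) (B x : R -> T -> R),
    S < 0 -> 0 < kap -> 0 < eta -> eta <= 1 ->
    80 * Num.sqrt kap <= 1 -> 80 * eta * Num.sqrt kap <= 1 ->
    4 * fast_defect kap (Num.sqrt n0%:R) (L * eta) + 4 * wbd R * (L * eta) <= 1 / 4 ->
    scaled_solution P kap 1 eta S B x ->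
    exists E, [/\ measurable E, (P E <= zeta%:E)%E &
      forall w, ~ E w -> forall n, (n0 <= n)%N -> forall v,
      Num.sqrt n%:R <= v <= Num.sqrt n.+1%:R ->
      4 / 5 * rung kap 1 n0 n <= x v w]].
Proof.
move=> z0; have osc0 := osc_cst_ge0 R.
(* From [n0 >= 1280] follows [n0 * wt k <= 16 / n0 <= 1 / 80], so the launch height [1 / 4 / wt k]
   is at least [20] and at least [20 * rt4 R n0]. The second entry bounds the cost of the
   oscillation event. *)
pose M := Num.max (40 * 32) (2 * osc_cst R / zeta).
pose n1 := (Num.truncn M).+1.
have n1M : M <= n1%:R.
  have M0 : 0 <= M by rewrite le_max mulr_ge0 ?ler0n.
  by have /andP[_ /ltW] := truncn_itv M0.
pose n0 := n1.+1; pose k : R := Num.sqrt n0%:R.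
have k1 : 1 <= k by rewrite -[leLHS]sqrtr1 ler_wsqrtr// ler1n.
pose L := Num.max 1 (2 * (osc_cst R * (1024 + k ^+ 2)) / zeta).
have L1 : 1 <= L by rewrite le_max lexx.
have L0 : 0 < L by lra.
exists n0, L; split => // d T P kap eta S B x S0 kap0 eta0 eta1 kap1 etakap def [BP [N [mN PN NP]]].
have [E1 [mE1 PE1 E1P]] := growth_event BP S0 (lt_le_trans ltr01 k1) L0.
have [E2 [mE2 PE2 E2P]] := osc_event BP (isT : (0 < n1)%N) (ltW S0).
exists (N `|` (E1 `|` E2)); split.
- by do !apply: measurableU.
- have PE1' : (P E1 <= (zeta / 2)%:E)%E.
    apply: (le_trans PE1); rewrite lee_fin ler_pdivrMr ?exprn_gt0//.
    apply: (@le_trans _ _ (zeta / 2 * L)); last first.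
      by rewrite ler_pM2l ?divr_gt0// -[leLHS]expr1 ler_weXn2l.
    have : 2 * (osc_cst R * (1024 + k ^+ 2)) / zeta <= L by rewrite le_max lexx orbT.
    by rewrite ler_pdivrMr//; lra.
  have PE2' : (P E2 <= (zeta / 2)%:E)%E.
    apply: (le_trans PE2); rewrite lee_fin ler_pdivrMr ?ltr0n//.
    have : 2 * osc_cst R / zeta <= n1%:R.
      by apply: le_trans n1M; rewrite le_max lexx orbT.
    by rewrite ler_pdivrMr//; lra.
  have mE12 : measurable (E1 `|` E2) by exact: measurableU.
  apply: (le_trans (measureU2 P mN mE12)); rewrite [X in (X + _ <= _)%E]PN add0e.
  apply: (le_trans (measureU2 P mE1 mE2)).
  apply: (@le_trans _ _ ((zeta / 2)%:E + (zeta / 2)%:E)%E); first exact: leeD.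
  by rewrite -!EFinD lee_fin; lra.
move=> w /not_orP[Nw /not_orP[E1w E2w]].
have [Lw xS] := NP w Nw.
set b := (fun v => eta * (B v w - B 0 w)) in Lw.
have bP v : S <= v <= k -> `|b v| <= L * eta * (1 + `|v|).
  move=> /(E1P w E1w); rewrite /b normrM (gtr0_norm eta0) => h.
  by rewrite [L * eta]mulrC -mulrA ler_pM2l.
have Le0 : 0 <= L * eta by rewrite mulr_ge0// ltW.
have wk0 := wt_gt0 k.
have xk : 1 / 4 <= wt k * x k w.
  have := fast_pulling_estimate (ltW kap0) (ltW S0) k1 Le0 bP Lw xS.
  by move: def; rewrite -/k /fast_defect; lra.
have xk' : 1 / 4 / wt k <= x k w by rewrite ler_pdivrMr// [x k w * _]mulrC.
have n01280 : 40 * 32 <= n0%:R :> R.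
  apply: (@le_trans _ _ n1%:R); last by rewrite ler_nat.
  by apply: le_trans n1M; rewrite le_max lexx.
have n00 : 0 < n0%:R :> R by rewrite ltr0n.
have wk : n0%:R * wt k <= 1 / 80.
  have h : n0%:R * wt k <= n0%:R * (16 / n0%:R ^+ 2).
    by apply: ler_wpM2l; [exact: ltW|exact: wt_sqrt_le].
  apply: le_trans h _.
  have -> : n0%:R * (16 / n0%:R ^+ 2) = 16 / n0%:R :> R by field; rewrite gt_eqF.
  by rewrite ler_pdivrMr//; lra.
apply: (climb_from kap0 kap1 _ (ltW S0) eta0 etakap _ _ _ Lw _ xk') => //.
- by rewrite normr1.
- rewrite ler_pdivlMr//; have : 1 * wt k <= n0%:R * wt k by rewrite ler_pM2r// ler1n.
  by move: wk; clear; lra.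
- rewrite ler_pdivlMr//.
  have h1 : eta * rt4 R n0 * wt k <= 1 * n0%:R * wt k.
    rewrite ler_pM2r//; apply: ler_pM; rewrite ?rt4_ge0 ?rt4_le//; exact: ltW.
  by move: wk h1; clear; lra.
- by move=> n n0n v vP; exact: E2P.
Qed.

End launch.

Lemma within_continuous_comp (R : realType) (f g : R -> R) (a : R) :
  {within `[a, +oo[, continuous f} -> continuous g -> (forall v, a <= g v) ->
  continuous (fun v => f (g v)).
Proof.
move=> /subspace_continuousP cf cg ag v.
have agv : `[a, +oo[%classic (g v) by rewrite /= in_itv/= ag.
apply: cvg_trans (cf _ agv) => /= X hX; rewrite nbhs_simpl/= in hX *.
have := cg v _ hX; rewrite /= nbhs_simpl/=; apply: filterS => z /=; apply.
by rewrite in_itv/= ag.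
Qed.

(** * Change of variables from the original equation to the scaled one *)

Section scaling.
Context {R : realType} {d : measure_display} {T : measurableType d}.
Variables (P : probability T R) (sigma e s : R) (W q : R -> {RV P >-> R}).
Hypotheses (sigma0 : 0 < sigma) (e0 : 0 < e) (s0 : s < 0).
Hypothesis H : solves_sde P sigma e s W q.

Let kap : R := Num.sqrt e.
Let tau : R := Num.sqrt kap.

Let kap0 : 0 < kap. Proof. by rewrite sqrtr_gt0. Qed.
Let tau0 : 0 < tau. Proof. by rewrite sqrtr_gt0. Qed.
Let kap2 : kap ^+ 2 = e. Proof. by rewrite sqr_sqrtr// ltW. Qed.
Let tau2 : tau ^+ 2 = kap. Proof. by rewrite sqr_sqrtr// ltW. Qed.

(** Clipping at [s] freezes path and noise before the start, which makes both continuous on the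
    whole line although [q] is only known to be so on [[s, +oo[]. *)
Definition rescaled_time (v : R) : R := Num.max (kap * v) s.

(** Time is stretched by [kap], so dividing by [tau = Num.sqrt kap] restores the Brownian
    normalisation. *)
Definition rescaled_noise (v : R) (w : T) : R :=
  (W (rescaled_time v) w - W s w) / tau.

Definition rescaled_path (v : R) (w : T) : R := q (rescaled_time v) w / kap.

Let rt_ge v : s <= rescaled_time v. Proof. by rewrite le_max lexx orbT. Qed.

Let rtE v : s / kap <= v -> rescaled_time v = kap * v.
Proof. by rewrite ler_pdivrMr// mulrC => h; apply: max_idPl. Qed.

Let continuous_rt : continuous rescaled_time.
Proof.
move=> v; apply: continuous_max; last exact: cvg_cst.
by apply: cvgM; [exact: cvg_cst|exact: cvg_id].
Qed.

Let Z (r : R) : {RV P >-> R} := W (s + r) - W s.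

Let noiseE v w : rescaled_noise v w = Z (rescaled_time v - s) w / tau.
Proof. by rewrite /rescaled_noise /Z/= [s + _]addrC subrK. Qed.

Lemma rescaled_noiseP : scaled_noise P (s / kap) rescaled_noise.
Proof.
have [bm0 bmc bmg bmi] := sde_noise H.
have mA (A : set R) : measurable A -> measurable ((fun x => tau^-1 * x) @^-1` A).
  by move=> mA; apply: measurable_preimageT => //; exact: measurable_funM.
have incr (u v : R) (A : set R) w : A (rescaled_noise v w - rescaled_noise u w) =
   ((Z (rescaled_time v - s) - Z (rescaled_time u - s)) @^-1` ((fun x => tau^-1 * x) @^-1` A)) w.
  by rewrite !noiseE /= -mulrBl mulrC.
split.
- move=> v; apply: measurable_funM; last exact: measurable_cst.
  by apply: measurable_funB.
- move=> w v; under eq_fun do rewrite noiseE.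
  apply: cvgM; last exact: cvg_cst.
  apply: (within_continuous_comp (bmc w) (g := fun v => rescaled_time v - s)).
    move=> v'; apply: cvgB; [exact: continuous_rt|exact: cvg_cst].
  by move=> v'; rewrite subr_ge0.
- move=> u v A Su uv mA'; have Sv := le_trans Su (ltW uv).
  have r0 : 0 <= rescaled_time u - s by rewrite subr_ge0.
  have rr : rescaled_time u - s < rescaled_time v - s.
    by rewrite ltrD2r !rtE// ltr_pM2l.
  have := bmg _ _ _ r0 rr (mA _ mA').
  rewrite /distribution /pushforward => E.
  transitivity (P ((Z (rescaled_time v - s) - Z (rescaled_time u - s)) @^-1` ((fun x => tau^-1 * x) @^-1` A))).
    by congr (P _); apply/funext => w; exact: incr.
  rewrite E; have -> : rescaled_time v - s - (rescaled_time u - s) = kap * (v - u).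
    by rewrite !rtE//; ring.
  have ht : 0 < tau * Num.sqrt (v - u) by rewrite mulr_gt0// sqrtr_gt0 subr_gt0.
  have tau'0 : 0 < tau^-1 by rewrite invr_gt0.
  rewrite (sqrtrM _ (ltW kap0)) (normal_prob_mulr ht tau'0 mA').
  have -> : tau^-1 * (tau * Num.sqrt (v - u)) = Num.sqrt (v - u).
    by rewrite mulKf// gt_eqF.
  reflexivity.
- move=> n r Sr homor A mA'.
  pose r' j := rescaled_time (r j) - s.
  have r'0 : 0 <= r' 0%N by rewrite subr_ge0.
  have homor' : {homo r' : i j / (i <= j)%N >-> i <= j}.
    move=> i j ij; rewrite /r' lerD2r !rtE ?ler_pM2l ?homor//.
      by apply: le_trans Sr _; exact: homor.
    by apply: le_trans Sr _; exact: homor.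
  have := bmi n r' r'0 homor' (fun i => (fun x => tau^-1 * x) @^-1` A i) (fun i => mA _ (mA' i)).
  rewrite big_mkord => E.
  transitivity (P [set w | forall i : 'I_n,
      ((fun x => tau^-1 * x) @^-1` A i) ((Z (r' i.+1) - Z (r' i)) w)]).
    congr (P _); apply/seteqP; split => w h.
      by move=> i; have := h i (ltn_ord i); rewrite incr.
    by move=> i iN; have := h (Ordinal iN); rewrite incr.
  rewrite E; apply: eq_bigr => i _; congr (P _).
  by apply/funext => w; rewrite -incr.
Qed.


Let eta : R := sigma / tau ^+ 3.

(** Once the additive noise is subtracted, the integral equation exhibits the path as a constant
    plus a primitive of a continuous function, to which the fundamental theorem of calculus
    applies. *)
Lemma rescaled_langevin w :
  (forall t : R, s <= t -> q t w = q s w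
      + (\int[lebesgue_measure]_(u in `[s, t])
           (e^-1 * (u * q u w - q u w ^+ 3 + e)))%R
      + sigma / Num.sqrt e * (W t w - W s w)) ->
  langevin kap 1 (s / kap) (fun v => eta * (rescaled_noise v w - rescaled_noise 0 w))
    (rescaled_path ^~ w).
Proof.
move=> eq.
have cq : {within `[s, +oo[, continuous (fun t : R => q t w)} by exact: (sde_continuous H).
pose qc u := q (Num.max u s) w.
have cqc : continuous qc.
  apply: (within_continuous_comp cq (g := fun u => Num.max u s)).
    by move=> v; apply: continuous_max; [exact: cvg_id|exact: cvg_cst].
  by move=> v; rewrite le_max lexx orbT.
pose gc u := e^-1 * (u * qc u - qc u ^+ 3 + e).
have cgc : continuous gc.
  move=> u; apply: cvgM; first exact: cvg_cst.
  apply: cvgD; last exact: cvg_cst.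
  apply: cvgB; first by apply: cvgM; [exact: cvg_id|exact: cqc].
  by apply: (cvg_comp qc (fun x => x ^+ 3)); [exact: cqc|exact: exprn_continuous].
pose F t := (\int[lebesgue_measure]_(u in `[s, t]) gc u)%R.
have dF t : s < t -> is_derive t 1 F (gc t).
  move=> st; have t1 : t < t + 1 by rewrite ltrDl.
  have ig : lebesgue_measure.-integrable `[s, t + 1] (EFin \o gc).
    apply: continuous_compact_integrable; first exact: segment_compact.
    exact: continuous_subspaceT.
  have [dF1 dF2] := continuous_FTC1_closed t1 ig st (cgc t).
  by split; [exact: dF1|rewrite -derive1E; exact: dF2].
have qE t : s <= t -> q t w = q s w + F t + sigma / kap * (W t w - W s w).
  move=> st; rewrite (eq t st); congr (_ + _ + _).
  apply: eq_Rintegral => u; rewrite inE/= in_itv/= => /andP[su _].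
  by rewrite /gc /qc (max_idPl su).
have cnoise : continuous (fun v => rescaled_noise v w).
  exact: (noise_continuous rescaled_noiseP).
split.
- move=> v; apply: cvgM; first exact: cvg_cst.
  by apply: cvgB; [exact: cnoise|exact: cvg_cst].
- move=> v; apply: cvgM; last exact: cvg_cst.
  apply: (within_continuous_comp cq (g := rescaled_time)); [exact: continuous_rt|exact: rt_ge].
move=> v Sv.
(* The constant combines the initial value with the recentring of the noise from time [s] to time
   [0]. *)
pose c := (q s w) / kap - sigma / e * (W s w - W 0 w).
have sv : s < kap * v by move: Sv; rewrite ltr_pdivrMr// mulrC.
have near : \near v, c + kap^-1 * F (kap * v) =
   rescaled_path v w - eta * (rescaled_noise v w - rescaled_noise 0 w).
  near=> u.
  have Su : s / kap < u by near: u; exact: lt_nbhsr.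
  have su : s <= kap * u by move: Su; rewrite ltr_pdivrMr// mulrC => /ltW.
  rewrite /rescaled_path /rescaled_noise (rtE (ltW Su)) (qE _ su).
  have -> : rescaled_time 0 = 0 by rewrite /rescaled_time mulr0; apply: max_idPl; exact: ltW.
  rewrite /c /eta -!kap2 -!tau2.
  move: (F _) (W _ w) => FF WW.
  by field; rewrite gt_eqF.
apply: (near_eq_is_derive near).
have dFv := dF _ sv.
have dcomp : is_derive v 1 (F \o (fun v => kap * v)) (gc (kap * v) * kap).
  apply: is_derive1_comp.
  by apply: is_derive_eq; rewrite /GRing.scale/= ; ring.
have -> : (fun v => c + kap^-1 * F (kap * v)) = (fun v => c + kap^-1 * (F \o (fun v => kap * v)) v) by [].
apply: is_derive_eq; rewrite /GRing.scale/=.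
rewrite /gc /qc /rescaled_path (rtE (ltW Sv)) (max_idPl (ltW sv)) -!kap2.
by field; rewrite gt_eqF.
Unshelve. all: by end_near.
Qed.

Lemma rescaled_solution : scaled_solution P kap 1 eta (s / kap) rescaled_noise rescaled_path.
Proof.
split; first exact: rescaled_noiseP.
have [N1 [mN1 PN1 N1P]] := sde_start H.
have [N2 [mN2 PN2 N2P]] := sde_equation H.
exists (N1 `|` N2); split; first exact: measurableU.
  apply/eqP; rewrite eq_le measure_ge0 andbT.
  apply: (le_trans (measureU2 P mN1 mN2)).
  by rewrite [X in (X + _ <= _)%E]PN1 [X in (_ + X <= _)%E]PN2 adde0.
move=> w /not_orP[N1w N2w]; split.
  apply: rescaled_langevin; apply: contrapT => h; apply: N2w; exact: N2P.
rewrite /rescaled_path rtE// mulrCA mulfV ?gt_eqF// mulr1.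
have -> : q s w = 0 by apply: contrapT => h; apply: N1w; exact: N1P.
by rewrite mul0r.
Qed.

End scaling.

(** * Events and asymptotic regimes *)

Section follows.
Context {R : realType}.

Lemma follows_lowerE (T : Type) (q : R -> T -> R) (t1 g : R) :
  follows_lower q t1 g = follows_upper (fun t w => - q t w) t1 g.
Proof.
have E w : [set (- x)%E | x in [set (- q t w / Num.sqrt t)%:E | t in [set t | t1 <= t]]] =
    [set (q t w / Num.sqrt t)%:E | t in [set t | t1 <= t]].
  rewrite image_comp; congr (_ @` _); apply/funext => t /=.
  by rewrite mulNr opprK.
apply/funext => w; rewrite /follows_lower /follows_upper /ereal_inf /= E.
by rewrite EFinN lteNr.
Qed.

Lemma follows_upper_intro (T : Type) (q : R -> T -> R) (t1 g c : R) w :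
  g < c -> (forall t, t1 <= t -> c <= q t w / Num.sqrt t) ->
  follows_upper q t1 g w.
Proof.
move=> gc h; rewrite /follows_upper/=; apply: (@lt_le_trans _ _ c%:E).
  by rewrite lte_fin.
by apply: le_ereal_inf_tmp => _ [t /= t1t <-]; rewrite lee_fin h.
Qed.

(** A strict bound on an infimum is a uniform gap. Gaps of the form [n.+1%:R^-1] make the event a
    countable union, and also give disjointness of the two branches. *)
Lemma follows_upperP (T : Type) (q : R -> T -> R) (t1 g : R) w :
  follows_upper q t1 g w <->
  exists n : nat, forall t, t1 <= t -> g + n.+1%:R^-1 <= q t w / Num.sqrt t.
Proof.
split; last first.
  move=> [n h]; apply: follows_upper_intro h.
  by rewrite ltrDl invr_gt0.
rewrite /follows_upper/= => h.
have [c gc hc] : exists2 c : R, g < c & forall t, t1 <= t -> c <= q t w / Num.sqrt t.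
  have lb t : t1 <= t -> (ereal_inf [set (q t w / Num.sqrt t)%:E | t in [set t | (t1 <= t)%R]]
      <= (q t w / Num.sqrt t)%:E)%E.
    by move=> t1t; apply: ereal_inf_lbound; exists t.
  move: h lb; case: (ereal_inf _) => [c||] h lb.
  - by exists c => // t /lb.
  (* The infimum is not [+oo], because [t1] itself is an admissible time. *)
  - by have := lb t1 (lexx _).
  - by [].
have cg0 : 0 <= (c - g)^-1 by rewrite invr_ge0 subr_ge0 ltW.
exists (Num.truncn (c - g)^-1) => t /hc; apply: le_trans.
rewrite -lerBrDl -[leRHS]invrK lef_pV2 ?posrE ?ltr0n ?invr_gt0 ?subr_gt0//.
by have /andP[_ /ltW] := truncn_itv cg0.
Qed.

Lemma measurable_follows_upper (d : measure_display) (T : measurableType d)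
    (q : R -> T -> R) (s t1 g : R) :
  s <= t1 -> 0 < t1 -> (forall t, measurable_fun [set: T] (q t)) ->
  (forall w, {within `[s, +oo[, continuous (fun t => q t w)}) ->
  measurable (follows_upper q t1 g).
Proof.
move=> st1 t10 mq cq.
(* Times at rational distance from [t1] are dense in [[t1, +oo[], so continuity reduces the event to
   countably many conditions. *)
pose pt (i j : nat) : R := t1 + i%:R / j.+1%:R.
have -> : follows_upper q t1 g = \bigcup_n \bigcap_i \bigcap_j
    [set w | g + n.+1%:R^-1 <= q (pt i j) w / Num.sqrt (pt i j)].
  apply/seteqP; split => w; rewrite follows_upperP.
    move=> [n h]; exists n => // i _ j _ /=; apply: h.
    by rewrite /pt lerDl divr_ge0.
  move=> [n _ h]; exists n => t t1t.
  pose f t := q (Num.max t t1) w / Num.sqrt (Num.max t t1).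
  have cmax : continuous (fun t : R => Num.max t t1).
    by move=> v; apply: continuous_max; [exact: cvg_id|exact: cvg_cst].
  have cf : continuous f.
    move=> v; apply: cvgM.
      apply: (@within_continuous_comp _ (fun t => q t w) (fun t => Num.max t t1) s) => //.
      by move=> z; rewrite le_max st1 orbT.
    apply: cvgV; first by rewrite gt_eqF// sqrtr_gt0 lt_max t10 orbT.
    apply: continuous_comp; [exact: cmax|exact: sqrt_continuous].
  have fE u : t1 <= u -> f u = q u w / Num.sqrt u by move=> /max_idPl; rewrite /f => ->.
  rewrite -fE//; apply/ler_addgt0Pr => e e0.
  have [dl dl0 dlP] := continuous_delta t cf e0.
  pose j := Num.truncn dl^-1; pose x := (t - t1) * j.+1%:R.
  have x0 : 0 <= x by rewrite mulr_ge0// subr_ge0.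
  have /andP[i1 i2] := truncn_itv x0.
  set i := Num.truncn x in i1 i2.
  have j0 : 0 < j.+1%:R :> R by rewrite ltr0n.
  have jd : j.+1%:R^-1 < dl.
    have dl'0 : 0 <= dl^-1 by rewrite invr_ge0 ltW.
    have /andP[_ h2] := truncn_itv dl'0.
    by rewrite -[ltRHS]invrK ltf_pV2 ?posrE ?invr_gt0.
  have t1p : t1 <= pt i j by rewrite /pt lerDl divr_ge0.
  have h1 := h i I j I; rewrite /= -fE// in h1.
  have ptt : `|pt i j - t| < dl.
    apply: le_lt_trans jd.
    have -> : pt i j - t = (i%:R - x) / j.+1%:R by rewrite /pt /x; field; rewrite gt_eqF.
    rewrite normrM [X in _ * X]gtr0_norm ?invr_gt0//.
    rewrite -[leRHS]mul1r ler_pM2r ?invr_gt0// ler_norml.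
    by move: i1 i2; rewrite -natr1 => i1 i2; apply/andP; split; lra.
  have := dlP _ ptt; rewrite ltr_norml => /andP[_ h2].
apply: (le_trans h1); rewrite addrC -lerBlDr; exact: ltW.
apply: bigcup_measurable => n _; apply: bigcap_measurableType => i _.
apply: bigcap_measurableType => j _.
have mf : measurable_fun [set: T] (fun w => q (pt i j) w / Num.sqrt (pt i j)).
  by apply: measurable_funM => //; exact: measurable_cst.
rewrite (_ : [set w | _] = (fun w => q (pt i j) w / Num.sqrt (pt i j)) @^-1`
   `[(g + n.+1%:R^-1), +oo[%classic); last first.
  by apply/seteqP; split => w /=; rewrite in_itv/= andbT.
by rewrite -[X in measurable X]setTI; exact: mf.
Qed.

Lemma follows_disjoint (T : Type) (q : R -> T -> R) (t1 g : R) : 0 < g ->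
  follows_upper q t1 g `&` follows_upper (fun t w => - q t w) t1 g = set0.
Proof.
move=> g0; rewrite -subset0 => w [/follows_upperP[n h] /follows_upperP[m h']].
have hn : 0 < n.+1%:R^-1 :> R by rewrite invr_gt0.
have hm : 0 < m.+1%:R^-1 :> R by rewrite invr_gt0.
have := h' t1 (lexx _); have := h t1 (lexx _); rewrite mulNr.
move: (_ / Num.sqrt t1) (n.+1%:R^-1) (m.+1%:R^-1) hn hm => z x y hn hm; lra.
Qed.

End follows.

Lemma expR_le_nine_eighths (R : realType) (n : nat) : expR (n%:R / 10) <= (9 / 8 : R) ^+ n.
Proof.
have -> : n%:R / 10 = n%:R * (1 / 10) :> R by rewrite div1r.
rewrite expRM_natl lerXn2r ?nnegrE ?expR_ge0//.
rewrite -[X in expR X]opprK expRN -[leRHS]invrK lef_pV2 ?posrE ?expR_gt0 ?invr_gt0//.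
by apply: le_trans (expR_ge1Dx _); lra.
Qed.

(** [(9 / 8) ^ n] exceeds [exp (n / 10)]. One half of this exponent yields [n / 20], the other, by
    [n + 1 >= 100 * |ln sg|], yields [sg ^ -2]. One factor [1 / sg] covers the cap, as
    [sg <= Num.sqrt kap]; the other covers the late start at [n0]. *)
Lemma rung_saturated (R : realType) (kap sg : R) (n0 n : nat) :
  0 < kap -> 0 < sg -> 1 <= - ln sg -> sg <= Num.sqrt kap ->
  5 * sg * (9 / 8) ^+ n0 <= 1 -> (0 < n0 <= n)%N -> 100 * - ln sg <= n.+1%:R ->
  rung kap 1 n0 n = rt4 R n / Num.sqrt kap / 4.
Proof.
move=> kap0 sg0 ln1 sgk sgn0 /andP[n00 n0n] lnn.
rewrite /rung mulr1; apply: min_idPr.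
have n1 : 0 < n%:R :> R by rewrite ltr0n (leq_trans n00).
have sk0 : 0 < Num.sqrt kap by rewrite sqrtr_gt0.
have N0 : 0 < (9 / 8 : R) ^+ n0 by rewrite exprn_gt0// divr_gt0.
have hn : n%:R / 20 / sg ^+ 2 <= (9 / 8) ^+ n.
  apply: le_trans (expR_le_nine_eighths R n).
  have -> : n%:R / 10 = n%:R / 20 + n%:R / 20 :> R by field.
  rewrite expRD; apply: ler_pM.
  - by rewrite divr_ge0// ltW.
  - by rewrite invr_ge0 exprn_ge0// ltW.
  - by apply: le_trans (expR_ge1Dx _); rewrite lerDr.
  have -> : sg ^- 2 = expR (2 * - ln sg).
    by rewrite (expRM_natl 2) expRN lnK ?posrE// exprVn.
  by rewrite ler_expR; move: lnn; rewrite -natr1; lra.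
have -> : (9 / 8 : R) ^+ (n - n0) = (9 / 8) ^+ n / (9 / 8) ^+ n0.
  by rewrite -[in RHS](subnK n0n) exprD mulfK// gt_eqF.
rewrite ler_pdivlMr//; apply: le_trans hn.
have h1 : rt4 R n / Num.sqrt kap / 4 <= n%:R / sg / 4.
  rewrite ler_pM2r//; apply: ler_pM; rewrite ?rt4_ge0 ?invr_ge0 ?(ltW sk0) ?rt4_le ?(leq_trans n00)//.
  by rewrite lef_pV2 ?posrE.
apply: (@le_trans _ _ (n%:R / sg / 4 * (9 / 8) ^+ n0)); first by rewrite ler_pM2r.
have -> : n%:R / 20 / sg ^+ 2 = n%:R / sg / 4 * (1 / (5 * sg)) by field; rewrite gt_eqF.
rewrite ler_pM2l ?divr_gt0// ler_pdivlMr ?mulr_gt0//; lra.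
Qed.

Lemma follows_from_rungs (R : realType) (T : Type) (q : R -> T -> R) (e sg : R)
    (n0 : nat) (w : T) :
  0 < e -> 0 < sg -> 1 <= - ln sg -> n0.+1%:R <= 100 * - ln sg ->
  sg <= Num.sqrt (Num.sqrt e) -> 5 * sg * (9 / 8) ^+ n0 <= 1 -> (2 <= n0)%N ->
  (forall n, (n0 <= n)%N -> forall v, Num.sqrt n%:R <= v <= Num.sqrt n.+1%:R ->
     4 / 5 * rung (Num.sqrt e) 1 n0 n <= q (Num.sqrt e * v) w / Num.sqrt e) ->
  follows_upper q (10 * Num.sqrt (e * `|ln sg|)) (1 / 10) w.
Proof.
move=> e0 sg0 ln1 n0ln sge sgn0 n02 h.
set kap := Num.sqrt e in sge h *.
have kap0 : 0 < kap by rewrite sqrtr_gt0.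
have sk0 : 0 < Num.sqrt kap by rewrite sqrtr_gt0.
rewrite ler0_norm; last by lra.
(* A saturated rung gives [1 / 5] of [rt4 R n], and passing to [Num.sqrt v <= 9 / 8 * rt4 R n]
   leaves [8 / 45], above [1 / 8]. The gap between [1 / 8] and [1 / 10] makes the bound on the
   infimum strict. *)
apply: (@follows_upper_intro _ _ _ _ _ (1 / 8)); first by lra.
move=> t tt1.
have L0 : 0 < - ln sg by lra.
have t10 : 0 < 10 * Num.sqrt (e * - ln sg) by rewrite mulr_gt0// sqrtr_gt0 mulr_gt0.
have t0 : 0 < t by apply: lt_le_trans tt1.
pose v := t / kap.
have v0 : 0 < v by rewrite divr_gt0.
have tE : t = kap * v by rewrite /v mulrC divfK// gt_eqF.
have vL : 100 * - ln sg <= v ^+ 2.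
  have -> : 100 * - ln sg = (10 * Num.sqrt (e * - ln sg) / kap) ^+ 2.
    rewrite expr_div_n exprMn !sqr_sqrtr; [|exact: ltW|by rewrite mulr_ge0// ltW].
    by field; rewrite gt_eqF.
  rewrite lerXn2r ?nnegrE ?(ltW v0)//; first by rewrite divr_ge0 ?ltW.
  by rewrite ler_pM2r ?invr_gt0.
have /andP[nv vn] := truncn_itv (sqr_ge0 v).
move: (Num.truncn _) nv vn => n nv vn.
have n0n : (n0 <= n)%N.
  by rewrite -ltnS -(ltr_nat R); apply: le_lt_trans vn; apply: le_trans vL; apply: le_trans n0ln; rewrite ler_nat.
have vb : Num.sqrt n%:R <= v <= Num.sqrt n.+1%:R.
  have -> : v = Num.sqrt (v ^+ 2) by rewrite sqrtr_sqr gtr0_norm.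
  by rewrite !ler_wsqrtr// ltW.
have := h n n0n v vb.
rewrite (@rung_saturated _ kap sg)//; last 2 first.
- by rewrite n0n (leq_trans _ n02).
- by apply: le_trans vL _; exact: ltW.
rewrite -tE => hq.
have n2 := leq_trans n02 n0n.
have r0 : 0 < rt4 R n by apply: lt_le_trans (rt4_ge1 R (ltnW n2)).
have sv : Num.sqrt v <= 9 / 8 * rt4 R n.
  by apply: le_trans (rt4S R n2); apply: ler_wsqrtr; case/andP: vb.
have sv0 : 0 < Num.sqrt v by rewrite sqrtr_gt0.
have -> : Num.sqrt t = Num.sqrt kap * Num.sqrt v by rewrite tE sqrtrM ?(ltW kap0).
rewrite ler_pdivlMr ?mulr_gt0//.
have hk : kap = Num.sqrt kap ^+ 2 by rewrite sqr_sqrtr// ltW.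
have : 4 / 5 * (rt4 R n / Num.sqrt kap / 4) * kap <= q t w.
  by move: hq; rewrite ler_pdivlMr.
apply: le_trans.
have -> : 4 / 5 * (rt4 R n / Num.sqrt kap / 4) * kap = 1 / 5 * rt4 R n * Num.sqrt kap.
  by rewrite {2}hk; field; rewrite gt_eqF.
have -> : 1 / 8 * (Num.sqrt kap * Num.sqrt v) = 1 / 8 * Num.sqrt v * Num.sqrt kap by ring.
by rewrite ler_pM2r//; lra.
Qed.

(** * Limits along filters, and the two regimes in terms of the scaled parameters *)

Section limits.
Context {R : realType}.

Lemma limf_einf_ge (F : set_system R) (f : R -> \bar R) (V : set R) (c : \bar R) :
  F V -> (forall x, V x -> c <= f x)%E -> (c <= limf_einf f F)%E.
Proof.
move=> FV cf; rewrite limf_einfE.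
apply: (@le_trans _ _ (ereal_inf (f @` V))); last by apply: ereal_sup_ubound; exists V.
by apply: le_ereal_inf_tmp => _ [x Vx <-]; exact: cf.
Qed.

Lemma limf_einf_le (F : set_system R) (FF : ProperFilter F) (f : R -> \bar R) (V : set R) (c : \bar R) :
  F V -> (forall x, V x -> f x <= c)%E -> (limf_einf f F <= c)%E.
Proof.
move=> FV fc; rewrite limf_einfE; apply: ge_ereal_sup => _ [U FU <-].
have [x [Ux Vx]] := filter_ex (filterI FU FV).
by apply: (@le_trans _ _ (f x)); [apply: ereal_inf_lbound; exists x|exact: fc].
Qed.

Lemma limf_esup_le (F : set_system R) (f : R -> \bar R) (V : set R) (c : \bar R) :
  F V -> (forall x, V x -> f x <= c)%E -> (limf_esup f F <= c)%E.
Proof.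
move=> FV cf; rewrite limf_esupE.
apply: (@le_trans _ _ (ereal_sup (f @` V))); first by apply: ereal_inf_lbound; exists V.
by apply: ge_ereal_sup => _ [x Vx <-]; exact: cf.
Qed.

Lemma ecvg_squeeze (F : set_system R) (FF : ProperFilter F) (f : R -> \bar R) (a : R) :
  (forall z : R, 0 < z -> \forall x \near F, ((a - z)%:E <= f x <= (a + z)%:E)%E) ->
  f x @[x --> F] --> a%:E.
Proof.
move=> h; apply/fine_cvgP; split.
  near=> x; have : ((a - 1)%:E <= f x <= (a + 1)%:E)%E by near: x; exact: h.
  by case: (f x) => [r||] // /andP[].
apply/cvgrPdist_le => z z0; near=> x; rewrite /=.
have : ((a - z)%:E <= f x <= (a + z)%:E)%E by near: x; exact: h.
case: (f x) => [r||] /andP[] //.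
rewrite !lee_fin => h1 h2 /=.
by rewrite ler_norml; apply/andP; split; lra.
Unshelve. all: by end_near.
Qed.

Lemma near0_ln_ge (A : R) : \forall x \near (0 : R)^'+, A <= - ln x.
Proof.
near=> x.
have x0 : 0 < x by [].
have xA : x < expR (- A) by near: x; apply: nbhs_right_lt; exact: expR_gt0.
rewrite lerNr -[leRHS]expRK ler_ln ?posrE ?expR_gt0//; exact: ltW.
Unshelve. all: by end_near.
Qed.

Lemma powR_third (x : R) : 0 <= x -> (x `^ (1 / 3)) ^+ 3 = x.
Proof.
move=> x0; rewrite -powR_mulrn ?powR_ge0// -powRrM.
have -> : 1 / 3 * 3%:R = 1 :> R by field.
exact: powRr1.
Qed.

Lemma powR_four_thirds (x : R) : x `^ (4 / 3) = (x `^ (1 / 3)) ^+ 4.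
Proof.
rewrite -powR_mulrn ?powR_ge0// -powRrM; congr (_ `^ _).
by rewrite div1r mulrC.
Qed.

Lemma powR_ge1 (x p : R) : 1 <= x -> 0 <= p -> 1 <= x `^ p.
Proof.
move=> x1 p0; have <- : 1 `^ p = 1 :> R by rewrite powR1.
by apply: ge0_ler_powR => //; rewrite nnegrE; lra.
Qed.

Variable eps : R -> R.
Hypothesis eps0 : forall x, 0 < x -> 0 < eps x.

Let kap x := Num.sqrt (eps x).
Let tau x := Num.sqrt (kap x).

Let kap0 x : 0 < x -> 0 < kap x. Proof. by move=> x0; rewrite sqrtr_gt0 eps0. Qed.
Let tau0 x : 0 < x -> 0 < tau x. Proof. by move=> x0; rewrite sqrtr_gt0 kap0. Qed.
Let tau2 x : 0 < x -> tau x ^+ 2 = kap x.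
Proof. by move=> x0; rewrite sqr_sqrtr// ltW// kap0. Qed.
Let tau4 x : 0 < x -> tau x ^+ 4 = eps x.
Proof.
move=> x0; rewrite (exprM _ 2 2) tau2// sqr_sqrtr//; exact/ltW/eps0.
Qed.

Let third_le1 (x : R) : 0 < x -> x <= 1 -> x `^ (1 / 3) <= 1.
Proof.
move=> x0 x1; rewrite -(@expr_le1 _ 3) ?powR_ge0// powR_third//; exact: ltW.
Qed.

(** In terms of [y = x ^ (1 / 3)] the lower bound on [eps] becomes [y <= a * tau x] after a fourth
    root; its cube bounds the noise ratio by [a ^ 3]. *)
Lemma fast_regime_near (a : R) : 0 < a -> a <= 1 ->
  (fun sigma : R => sigma `^ (4 / 3) * `|ln sigma| `^ (2 / 3)) =o_ (0^'+) eps ->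
  eps =o_ (0^'+) (fun _ : R => 1 : R) ->
  \forall x \near (0 : R)^'+, [/\ kap x <= a, x / tau x ^+ 3 <= a & x <= tau x].
Proof.
move=> a0 a1 /eqoP h1 /eqoP h2.
near=> x.
have x0 : 0 < x by [].
have x1 : x <= 1 by near: x; exact: nbhs_right_le.
have ln1 : 1 <= - ln x by near: x; exact: near0_ln_ge.
have : `|x `^ (4 / 3) * `|ln x| `^ (2 / 3)| <= a ^+ 4 * `|eps x|.
  by near: x; apply: h1; exact: exprn_gt0.
have : `|eps x| <= a ^+ 2 * `|1 : R| by near: x; apply: h2; exact: exprn_gt0.
rewrite !(gtr0_norm (eps0 x0)) normr1 mulr1 => ea.
rewrite ger0_norm ?mulr_ge0 ?powR_ge0// => hx.
set y := x `^ (1 / 3).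
have y0 : 0 <= y by exact: powR_ge0.
have y1 : y <= 1 by exact: third_le1.
have y3 : y ^+ 3 = x by rewrite powR_third// ltW.
have ya : y <= a * tau x.
  rewrite -(@ler_pXn2r _ 4) ?nnegrE ?mulr_ge0 ?(ltW a0) ?sqrtr_ge0//.
  rewrite exprMn tau4// -powR_four_thirds; apply: le_trans hx.
  rewrite ler_peMr ?powR_ge0//; apply: powR_ge1; last by lra.
  by rewrite ltr0_norm//; lra.
have t0 := tau0 x0.
split.
- by rewrite -[leRHS]gtr0_norm// -sqrtr_sqr ler_wsqrtr.
- rewrite ler_pdivrMr ?exprn_gt0//.
  apply: (@le_trans _ _ ((a * tau x) ^+ 3)).
    by rewrite -[leLHS]y3 lerXn2r ?nnegrE// (le_trans y0).
  rewrite exprMn ler_pM2r ?exprn_gt0// -[leRHS]expr1.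
  by apply: ler_wiXn2l => //; exact: ltW.
- apply: (@le_trans _ _ y).
    by rewrite -[leLHS]y3 -[leRHS]expr1; apply: ler_wiXn2l.
  by apply: (le_trans ya); rewrite ler_piMl// ltW.
Unshelve. all: by end_near.
Qed.

(** The comparison is reversed to [tau x <= a * y], whose cube makes the noise ratio large; the
    lower bound on [eps] enters through the identity [kap * eta ^ 2 = x ^ 2 / eps x]. *)
Lemma slow_regime_near (a : R) : 0 < a -> a <= 1 ->
  asymp_lesssim (fun sigma : R => sigma ^+ 2 * `|ln sigma| ^+ 3) eps ->
  eps =o_ (0^'+) (fun sigma : R => sigma `^ (4 / 3) * `|ln sigma| `^ (- (13 / 6))) ->
  \forall x \near (0 : R)^'+, [/\ kap x <= a, 1 <= a * (x / tau x ^+ 3),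
    kap x * (x / tau x ^+ 3) ^+ 2 <= a & x <= tau x].
Proof.
move=> a0 a1 [c c0 h1] /eqoP h2.
near=> x.
have x0 : 0 < x by [].
have x1 : x <= 1 by near: x; exact: nbhs_right_le.
have ln1 : 1 <= - ln x by near: x; exact: near0_ln_ge.
have lnc : (c * a)^-1 <= - ln x by near: x; exact: near0_ln_ge.
have : c * (x ^+ 2 * `|ln x| ^+ 3) <= eps x by near: x; exact: h1.
have : `|eps x| <= a ^+ 4 * `|x `^ (4 / 3) * `|ln x| `^ (- (13 / 6))|.
  by near: x; apply: h2; exact: exprn_gt0.
have -> : `|ln x| = - ln x by rewrite ltr0_norm//; lra.
rewrite (gtr0_norm (eps0 x0)) ger0_norm ?mulr_ge0 ?powR_ge0// => hx1 hx2.
set y := x `^ (1 / 3).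
have y0 : 0 <= y by exact: powR_ge0.
have y1 : y <= 1 by exact: third_le1.
have y3 : y ^+ 3 = x by rewrite powR_third// ltW.
have t0 := tau0 x0.
have ya : tau x <= a * y.
  rewrite -(@ler_pXn2r _ 4) ?nnegrE ?mulr_ge0 ?(ltW a0) ?sqrtr_ge0//.
  rewrite exprMn tau4// -powR_four_thirds; apply: (le_trans hx1).
  rewrite ler_pM2l ?exprn_gt0// ler_piMr ?powR_ge0// powRN invf_le1 ?powR_gt0//; last by lra.
  by apply: powR_ge1 => //; lra.
have ln3 : - ln x <= (- ln x) ^+ 3 by rewrite -[leLHS]expr1; apply: ler_weXn2l.
(* The unknown constant [c] is beaten by the diverging logarithm, which turns a bound up to
   constants into an arbitrarily small ratio. *)
have xe : x ^+ 2 <= a * eps x.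
  have : (c * a)^-1 <= (- ln x) ^+ 3 by apply: le_trans ln3.
  rewrite -div1r ler_pdivrMr ?mulr_gt0// => h3.
  have : x ^+ 2 * 1 <= x ^+ 2 * ((- ln x) ^+ 3 * (c * a)) by rewrite ler_wpM2l ?sqr_ge0.
  have : a * (c * (x ^+ 2 * (- ln x) ^+ 3)) <= a * eps x by rewrite ler_pM2l.
  lra.
split.
- rewrite -tau2//; apply: (@le_trans _ _ ((a * y) ^+ 2)).
    by rewrite lerXn2r ?nnegrE ?(ltW t0)// mulr_ge0// ltW.
  rewrite exprMn; apply: (@le_trans _ _ (a ^+ 2 * 1)).
    by rewrite ler_pM2l ?exprn_gt0// expr_le1.
  by rewrite mulr1 -[leRHS]expr1; apply: ler_wiXn2l => //; exact: ltW.
- rewrite mulrA ler_pdivlMr ?exprn_gt0// mul1r.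
  apply: (@le_trans _ _ ((a * y) ^+ 3)).
    by rewrite lerXn2r ?nnegrE ?(ltW t0)// mulr_ge0// ltW.
  rewrite exprMn y3 ler_pM2r// -[leRHS]expr1.
  by apply: ler_wiXn2l => //; exact: ltW.
- have -> : kap x * (x / tau x ^+ 3) ^+ 2 = x ^+ 2 / eps x.
    by rewrite -tau4// -tau2//; field; rewrite gt_eqF.
  by rewrite ler_pdivrMr ?eps0.
- rewrite -(@ler_pXn2r _ 4) ?nnegrE ?(ltW x0) ?(ltW t0)// tau4//.
  apply: (@le_trans _ _ (x ^+ 2)).
    by apply: ler_wiXn2l => //; exact: ltW.
  by apply: (le_trans xe); rewrite ler_piMl// ltW// eps0.
Unshelve. all: by end_near.
Qed.

End limits.

(** * Probabilities of the two branches for fixed small parameters *)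

Section probabilities.
Variable R : realType.

Definition noise_ratio (sigma e : R) : R := sigma / Num.sqrt (Num.sqrt e) ^+ 3.

Definition pull_time (sigma e : R) : R := 10 * Num.sqrt (e * `|ln sigma|).

Lemma scaled_le1 (D X z : R) : 0 < D -> 0 <= z -> z <= D^-1 -> X <= D -> X * z <= 1.
Proof.
move=> D0 z0 zD XD; apply: (@le_trans _ _ (D * z)); first by rewrite ler_wpM2r.
by rewrite mulrC -ler_pdivlMr// div1r.
Qed.

Lemma sqrt_le_inv80 (z : R) : 0 <= z -> 80 ^+ 2 * z <= 1 -> 80 * Num.sqrt z <= 1.
Proof.
move=> z0 h; have h0 : 0 <= 80 * Num.sqrt z by rewrite mulr_ge0.
by rewrite -(@expr_le1 _ 2) ?h0// exprMn sqr_sqrtr.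
Qed.

Lemma cubic_cst_le (k b1 b2 : R) : 0 <= b1 -> b1 <= b2 -> cubic_cst k b1 <= cubic_cst k b2.
Proof.
move=> b10 b12; have w0 := wt_gt0 k.
apply: ler_wpM2l; first exact: wbd_ge0.
apply: lerXn2r; rewrite ?nnegrE.
- by apply: divr_ge0; [apply: mulr_ge0 => //; lra|exact: ltW].
- by apply: divr_ge0; [apply: mulr_ge0 => //; lra|exact: ltW].
- by rewrite ler_pM2r ?invr_gt0// ler_pM2l//; lra.
Qed.

(** For [z >= 1], [1 + L * z <= (1 + L) * z]; then cube. *)
Lemma cubic_cst_scale (k L z : R) : 0 <= L -> 1 <= z ->
  cubic_cst k (L * z) <= cubic_cst k L * z ^+ 3.
Proof.
move=> L0 z1; have w0 := wt_gt0 k; have Lz : 0 <= L * z by rewrite mulr_ge0//; lra.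
rewrite /cubic_cst -[leRHS]mulrA -exprMn.
apply: ler_wpM2l; first exact: wbd_ge0.
apply: lerXn2r; rewrite ?nnegrE.
- by apply: divr_ge0; [apply: mulr_ge0 => //; lra|exact: ltW].
- apply: mulr_ge0; last by lra.
  by apply: divr_ge0; [apply: mulr_ge0 => //; lra|exact: ltW].
- by rewrite [leRHS]mulrAC ler_pM2r ?invr_gt0// -mulrA ler_pM2l//; lra.
Qed.

Lemma probability_compl_ge (d : measure_display) (T : measurableType d)
    (P : probability T R) (E F : set T) (c : R) :
  measurable E -> measurable F -> (P E <= c%:E)%E -> (forall w, ~ E w -> F w) ->
  ((1 - c)%:E <= P F)%E.
Proof.
move=> mE mF PE EF.
apply: (@le_trans _ _ (P (~` E))); last first.
  by apply: le_measure; rewrite ?inE//; exact: measurableC.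
rewrite probability_setC// EFinB; exact: leeB.
Qed.

Section solution.
Variables (d : measure_display) (T : measurableType d) (P : probability T R)
  (sigma e s : R) (W q : R -> {RV P >-> R}).
Hypotheses (sigma0 : 0 < sigma) (e0 : 0 < e) (s0 : s < 0).
Hypothesis H : solves_sde P sigma e s W q.

Let pt0 : sigma < 1 -> 0 < pull_time sigma e.
Proof.
move=> s1; rewrite mulr_gt0// sqrtr_gt0 mulr_gt0// normr_gt0.
by rewrite lt_eqF// ln_lt0// sigma0.
Qed.

Lemma measurable_up (g : R) : sigma < 1 ->
  measurable (follows_upper (fun t w => q t w) (pull_time sigma e) g).
Proof.
move=> s1; have p0 := pt0 s1.
apply: (@measurable_follows_upper _ _ _ _ s) => //.
- by rewrite (le_trans (ltW s0)) ?ltW.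
- by move=> w; exact: (sde_continuous H).
Qed.

Lemma measurable_down (g : R) : sigma < 1 ->
  measurable (follows_upper (fun t w => - q t w) (pull_time sigma e) g).
Proof.
move=> s1; have p0 := pt0 s1.
apply: (@measurable_follows_upper _ _ _ _ s) => //.
- by rewrite (le_trans (ltW s0)) ?ltW.
- by move=> t; apply: measurable_funN.
- move=> w v; apply: (@cvgN _ R^o).
  have h : {within `[s, +oo[, continuous (fun t : R => q t w)} by exact: (sde_continuous H).
  exact: h.
Qed.

Lemma rescaled_pathE v w : 0 <= v -> rescaled_path e s q v w = q (Num.sqrt e * v) w / Num.sqrt e.
Proof.
move=> v0; rewrite /rescaled_path /rescaled_time (max_idPl _)//.
by rewrite (le_trans (ltW s0))// mulr_ge0// sqrtr_ge0.
Qed.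

End solution.

Lemma fast_probability (zeta : R) : 0 < zeta ->
  exists2 a, 0 < a <= 1 &
  forall (d : measure_display) (T : measurableType d) (P : probability T R)
    (sigma e s : R) (W q : R -> {RV P >-> R}),
  0 < sigma -> 0 < e -> s < 0 -> solves_sde P sigma e s W q ->
  sigma <= a -> a^-1 <= - ln sigma ->
  Num.sqrt e <= a -> noise_ratio sigma e <= a -> sigma <= Num.sqrt (Num.sqrt e) ->
  ((1 - zeta)%:E <= P (follows_upper (fun t w => q t w) (pull_time sigma e) (1 / 10)))%E.
Proof.
move=> z0; have [n0 [L [n02 L0 launch]]] := fast_launch z0.
pose k : R := Num.sqrt n0%:R.
have B0 := wbd_ge0 R.
have C0 : 0 <= cubic_cst k L by apply: cubic_cst_ge0; exact: ltW.
have N0 : 0 < (9 / 8 : R) ^+ n0 by rewrite exprn_gt0// divr_gt0.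
have n00 : 0 <= n0.+1%:R :> R by exact: ler0n.
have BL0 : 0 <= wbd R * L by rewrite mulr_ge0// ltW.
(* Each summand is the factor by which one of the requirements below multiplies a small parameter,
   so the single threshold [D^-1] serves them all. *)
pose D : R := 80 ^+ 2 + 4 * (12 * (wbd R * L) + 4 * cubic_cst k L) + 5 * (9 / 8) ^+ n0 + n0.+1%:R + 1.
have E0 : 0 <= 80 ^+ 2 :> R by exact: exprn_ge0.
have [D1 DE DC DN Dn] : [/\ 1 <= D, 80 ^+ 2 <= D,
    4 * (12 * (wbd R * L) + 4 * cubic_cst k L) <= D, 5 * (9 / 8) ^+ n0 <= D & n0.+1%:R <= D].
  rewrite /D; move: (80 ^+ 2) ((9 / 8) ^+ n0) (n0.+1%:R) (wbd R * L) (cubic_cst k L) E0 N0 n00 BL0 C0.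
  by move=> x1 x2 x3 x4 x5 *; split; lra.
have D0 : 0 < D by lra.
exists D^-1; first by rewrite invr_gt0 D0 invf_le1.
move=> d T P sigma e s W q sigma0 e0 s0 H sD lnD kD eD st.
rewrite invrK in lnD.
have kap0 : 0 < Num.sqrt e by rewrite sqrtr_gt0.
have tau0 : 0 < Num.sqrt (Num.sqrt e) by rewrite sqrtr_gt0.
have eta0 : 0 < noise_ratio sigma e by rewrite divr_gt0// exprn_gt0.
have eta1 : noise_ratio sigma e <= 1 by apply: (le_trans eD); rewrite invf_le1.
have sig1 : sigma < 1.
  rewrite ltNge; apply/negP => s1; have := ln_ge0 s1; lra.
have hk : 80 * Num.sqrt (Num.sqrt e) <= 1.
  by apply: sqrt_le_inv80; [exact: ltW|exact: (scaled_le1 D0 (ltW kap0) kD DE)].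
have hek : 80 * noise_ratio sigma e * Num.sqrt (Num.sqrt e) <= 1.
  rewrite mulrAC; apply: (@le_trans _ _ (1 * 1)); last by rewrite mulr1.
  by apply: ler_pM; [apply: mulr_ge0 => //; exact: ltW|exact: ltW|exact: hk|exact: eta1].
have Le0 : 0 <= L * noise_ratio sigma e by rewrite mulr_ge0// ltW.
have def : 4 * fast_defect (Num.sqrt e) k (L * noise_ratio sigma e) +
    4 * wbd R * (L * noise_ratio sigma e) <= 1 / 4.
  have hC : cubic_cst k (L * noise_ratio sigma e) <= cubic_cst k L.
    by apply: cubic_cst_le => //; rewrite ler_piMr// ltW.
  have h1 : Num.sqrt e * cubic_cst k (L * noise_ratio sigma e) <= D^-1 * cubic_cst k L.
    by apply: ler_pM => //; exact: cubic_cst_ge0.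
  have h2 : wbd R * L * noise_ratio sigma e <= wbd R * L * D^-1 by apply: ler_wpM2l.
  have h3 : 4 * (12 * (wbd R * L) + 4 * cubic_cst k L) * D^-1 <= 1.
    by apply: (scaled_le1 D0) => //; rewrite invr_ge0 ltW.
  rewrite /fast_defect; lra.
have sk0 : s / Num.sqrt e < 0 by rewrite pmulr_llt0// invr_gt0.
have [E [mE PE EP]] := launch _ _ P _ _ _ _ _ sk0 kap0 eta0 eta1 hk hek def
   (rescaled_solution e0 s0 H).
apply: (probability_compl_ge mE _ PE); first exact: (measurable_up sigma0 e0 s0 H).
move=> w Ew; apply: (@follows_from_rungs _ _ _ _ _ n0) => //.
- by apply: le_trans lnD.
- have := le_trans Dn lnD; lra.
- by rewrite mulrAC; apply: (scaled_le1 D0 (ltW sigma0) sD).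
- move=> n n0n v vP; have v0 : 0 <= v by case/andP: vP => h _; apply: le_trans h; exact: sqrtr_ge0.
  by have := EP w Ew n n0n v vP; rewrite rescaled_pathE.
Qed.

Lemma slow_probability (zeta : R) : 0 < zeta ->
  exists2 a, 0 < a <= 1 &
  forall (d : measure_display) (T : measurableType d) (P : probability T R)
    (sigma e s : R) (W q : R -> {RV P >-> R}),
  0 < sigma -> 0 < e -> s < 0 -> solves_sde P sigma e s W q ->
  sigma <= a -> a^-1 <= - ln sigma ->
  Num.sqrt e <= a -> 1 <= a * noise_ratio sigma e ->
  Num.sqrt e * noise_ratio sigma e ^+ 2 <= a -> sigma <= Num.sqrt (Num.sqrt e) ->
  ((1 / 2 - zeta)%:E <= P (follows_upper (fun t w => q t w) (pull_time sigma e) (1 / 10)))%E /\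
  ((1 / 2 - zeta)%:E <= P (follows_upper (fun t w => - q t w)%R (pull_time sigma e) (1 / 10)))%E.
Proof.
move=> z0; have [n0 [dl [L [n02 dl0 L0 launch]]]] := slow_launch z0.
pose k : R := Num.sqrt n0%:R.
have B0 := wbd_ge0 R.
have C0 : 0 <= cubic_cst k L by apply: cubic_cst_ge0; exact: ltW.
have N0 : 0 < (9 / 8 : R) ^+ n0 by rewrite exprn_gt0// divr_gt0.
have n00 : 0 <= n0.+1%:R :> R by exact: ler0n.
have X1 : 0 <= 20 / dl by rewrite divr_ge0// ltW.
have X2 : 0 <= 16 * wbd R / dl by apply: divr_ge0; [exact: mulr_ge0|exact: ltW].
have X3 : 0 <= 8 * cubic_cst k L / dl by apply: divr_ge0; [exact: mulr_ge0|exact: ltW].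
pose D : R := 80 ^+ 2 + 20 / dl + 16 * wbd R / dl + 8 * cubic_cst k L / dl
   + 5 * (9 / 8) ^+ n0 + n0.+1%:R + 1.
have E0 : 0 <= 80 ^+ 2 :> R by exact: exprn_ge0.
have [[D1 DE D20] [DB DC DN Dn]] : [/\ 1 <= D, 80 ^+ 2 <= D & 20 / dl <= D] /\
    [/\ 16 * wbd R / dl <= D, 8 * cubic_cst k L / dl <= D, 5 * (9 / 8) ^+ n0 <= D & n0.+1%:R <= D].
  rewrite /D; move: (80 ^+ 2) ((9 / 8) ^+ n0) (n0.+1%:R) (20 / dl) (16 * wbd R / dl) (8 * cubic_cst k L / dl)
    E0 N0 n00 X1 X2 X3.
  by move=> x1 x2 x3 x4 x5 x6 *; split; split; lra.
have D0 : 0 < D by lra.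
exists D^-1; first by rewrite invr_gt0 D0 invf_le1.
move=> d T P sigma e s W q sigma0 e0 s0 H sD lnD kD eD keD st.
rewrite invrK in lnD.
have kap0 : 0 < Num.sqrt e by rewrite sqrtr_gt0.
have tau0 : 0 < Num.sqrt (Num.sqrt e) by rewrite sqrtr_gt0.
have eta0 : 0 < noise_ratio sigma e by rewrite divr_gt0// exprn_gt0.
have etaD : D <= noise_ratio sigma e by move: eD; rewrite mulrC ler_pdivlMr// mul1r.
have eta1 : 1 <= noise_ratio sigma e by apply: le_trans etaD.
have sig1 : sigma < 1.
  rewrite ltNge; apply/negP => s1; have := ln_ge0 s1; lra.
have hk : 80 * Num.sqrt (Num.sqrt e) <= 1.
  by apply: sqrt_le_inv80; [exact: ltW|exact: (scaled_le1 D0 (ltW kap0) kD DE)].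
have ke0 : 0 <= Num.sqrt e * noise_ratio sigma e ^+ 2.
  by rewrite mulr_ge0 ?sqr_ge0// ltW.
have hek : 80 * noise_ratio sigma e * Num.sqrt (Num.sqrt e) <= 1.
  have -> : 80 * noise_ratio sigma e * Num.sqrt (Num.sqrt e) =
     80 * Num.sqrt (Num.sqrt e * noise_ratio sigma e ^+ 2).
    by rewrite sqrtrM ?(ltW kap0)// sqrtr_sqr gtr0_norm// mulrAC mulrA.
  by apply: sqrt_le_inv80 => //; exact: (scaled_le1 D0 ke0 keD DE).
have h20 : 20 <= dl * noise_ratio sigma e.
  by have := le_trans D20 etaD; rewrite ler_pdivrMr// [leRHS]mulrC.
have Le0 : 0 <= L * noise_ratio sigma e by rewrite mulr_ge0// ltW.
(* Each part of the defect takes half of [dl * eta]: the constant part because [eta] is large, the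
   cubic part because [kap * eta ^ 3] is [kap * eta ^ 2] times [eta]. *)
have def : 4 * defect_rate (Num.sqrt e) k (L * noise_ratio sigma e) 1 <= dl * noise_ratio sigma e.
  have h1 : 16 * wbd R <= dl * noise_ratio sigma e.
    by have := le_trans DB etaD; rewrite ler_pdivrMr// [leRHS]mulrC.
  have h2 := cubic_cst_scale k (ltW L0) eta1.
  have h3 : Num.sqrt e * cubic_cst k (L * noise_ratio sigma e) <=
     Num.sqrt e * (cubic_cst k L * noise_ratio sigma e ^+ 3) by rewrite ler_pM2l.
  have h4 : 8 * cubic_cst k L / dl * (Num.sqrt e * noise_ratio sigma e ^+ 2) <= 1.
    exact: (scaled_le1 D0 ke0 keD DC).
  rewrite mulrAC ler_pdivrMr// mul1r in h4.
  have h5 : 8 * cubic_cst k L * (Num.sqrt e * noise_ratio sigma e ^+ 2) * noise_ratio sigma e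
     <= dl * noise_ratio sigma e by rewrite ler_pM2r.
  have h6 : cubic_cst k L * noise_ratio sigma e ^+ 3 * Num.sqrt e * 8 =
     8 * cubic_cst k L * (Num.sqrt e * noise_ratio sigma e ^+ 2) * noise_ratio sigma e by ring.
  rewrite /defect_rate; lra.
have sk0 : s / Num.sqrt e < 0 by rewrite pmulr_llt0// invr_gt0.
have sol := rescaled_solution e0 s0 H.
have half : 1 / 2 - zeta = 1 - (1 / 2 + zeta) by lra.
have ln1 : 1 <= - ln sigma by apply: le_trans lnD.
have lnn : n0.+1%:R <= 100 * - ln sigma by have := le_trans Dn lnD; lra.
have sn : 5 * sigma * (9 / 8) ^+ n0 <= 1.
  by rewrite mulrAC; apply: (scaled_le1 D0 (ltW sigma0) sD).
have vge0 n (v : R) : Num.sqrt n%:R <= v <= Num.sqrt n.+1%:R -> 0 <= v.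
  by case/andP => h _; apply: le_trans h; exact: sqrtr_ge0.
have one1 : `|1 : R| <= 1 by rewrite normr1.
have oneN1 : `|- 1 : R| <= 1 by rewrite normrN normr1.
rewrite half; split.
  have [E [mE PE EP]] := launch _ _ P _ _ _ _ _ _ sk0 kap0 one1 eta0 hk hek h20 def sol.
  apply: (probability_compl_ge mE _ PE); first exact: (measurable_up sigma0 e0 s0 H).
  move=> w Ew; apply: (@follows_from_rungs _ _ _ _ _ n0) => // n n0n v vP.
  by have := EP w Ew n n0n v vP; rewrite rescaled_pathE// (vge0 _ _ vP).
have [E [mE PE EP]] := launch _ _ P _ _ _ _ _ _ sk0 kap0 oneN1 eta0 hk hek h20 def (scaled_solutionN sol).
apply: (probability_compl_ge mE _ PE); first exact: (measurable_down sigma0 e0 s0 H).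
move=> w Ew; apply: (@follows_from_rungs _ _ _ _ _ n0) => // n n0n v vP.
by have := EP w Ew n n0n v vP; rewrite rescaled_pathE ?mulNr// (vge0 _ _ vP).
Qed.

End probabilities.

(** Since the two probabilities add up to at most one, the lower bound on [y] is an upper bound on
    [x]. *)
Lemma near_half (R : realType) (z : R) (x y : \bar R) :
  ((1 / 2 - z)%:E <= x)%E -> ((1 / 2 - z)%:E <= y)%E -> (x + y <= 1)%E ->
  (`|x - (2^-1)%:E| <= z%:E)%E.
Proof.
case: x => [r||]//; case: y => [t||]//; rewrite -EFinD !lee_fin => h1 h2 h3.
change (`|r - 2^-1|%:E <= z%:E)%E; rewrite lee_fin.
by rewrite ler_norml; apply/andP; split; lra.
Qed.

Lemma ecvg0_squeeze (R : realType) (F : set_system R) (FF : ProperFilter F) (f : R -> \bar R) :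
  (forall x, 0 <= f x)%E ->
  (forall z : R, 0 < z -> \forall x \near F, (f x <= z%:E)%E) ->
  f x @[x --> F] --> 0%E.
Proof.
move=> f0 h; apply: ecvg_squeeze => z z0; apply: filterS (h z z0) => x fx.
rewrite !add0r fx andbT; apply: le_trans (f0 x).
by rewrite lee_fin oppr_le0 ltW.
Qed.

Lemma limf_esup_norm_ge0 (R : realType) (F : set_system R) (FF : ProperFilter F) (f : R -> \bar R) :
  (0 <= limf_esup (fun s => `|f s|) F)%E.
Proof.
rewrite limf_esupE; apply: le_ereal_inf_tmp => _ [V FV <-].
have [x Vx] := filter_ex FV.
by apply: (@le_trans _ _ `|f x|%E) => //; apply: ereal_sup_ubound; exists x.
Qed.

Theorem theorem2p2 (R : realType) :
  exists c1 gamma : R, [/\ 0 < c1, 0 < gamma &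
    forall (eps : R -> R)
      (d : R -> R -> measure_display)
      (Omega : forall sigma s : R, measurableType (d sigma s))
      (P : forall sigma s : R, probability (Omega sigma s) R)
      (W q : forall sigma s : R, R -> {RV (P sigma s) >-> R}),
    (forall sigma : R, 0 < sigma -> 0 < eps sigma) ->
    (forall sigma s : R, 0 < sigma -> s < 0 ->
       solves_sde (P sigma s) sigma (eps sigma) s (W sigma s) (q sigma s)) ->
    let t1 := fun sigma : R => c1 * Num.sqrt (eps sigma * `|ln sigma|) in
    let p_up := fun sigma s : R =>
      P sigma s (follows_upper (q sigma s) (t1 sigma) gamma) in
    let p_down := fun sigma s : R =>
      P sigma s (follows_lower (q sigma s) (t1 sigma) gamma) in
    ((fun sigma : R => sigma `^ (4 / 3) * `|ln sigma| `^ (2 / 3))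
         =o_ (0^'+) eps ->
     eps =o_ (0^'+) (fun _ : R => 1 : R) ->
     limf_einf (p_up sigma) (-oo)%R @[sigma --> 0^'+] --> 1%E)
    /\
    (asymp_lesssim (fun sigma : R => sigma ^+ 2 * `|ln sigma| ^+ 3) eps ->
     eps =o_ (0^'+)
       (fun sigma : R => sigma `^ (4 / 3) * `|ln sigma| `^ (- (13 / 6))) ->
     (limf_esup (fun s : R => `|p_up sigma s - (2^-1)%:E|%E) (-oo)%R
        @[sigma --> 0^'+] --> 0%E)
     /\
     (limf_esup (fun s : R => `|p_down sigma s - (2^-1)%:E|%E) (-oo)%R
        @[sigma --> 0^'+] --> 0%E))].
Proof.
exists 10, (1 / 10); split=> // eps d Omega P W q eps0 sol t1 p_up p_down.
(* All probability bounds hold for every [s < 0], so this one neighbourhood of minus infinity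
   settles the lower and upper limits in [s]. *)
have neg0 : (-oo)%R [set s : R | s < 0] by exact: nbhs_ninfty_lt.
split=> [fast1 fast2|slow1 slow2].
  apply: ecvg_squeeze => zeta zeta0.
  have [a /andP[a0 a1] fastP] := fast_probability zeta0.
  near=> sigma.
  have sigma0 : 0 < sigma by [].
  have sigmaa : sigma <= a by near: sigma; exact: nbhs_right_le.
  have lna : a^-1 <= - ln sigma by near: sigma; exact: near0_ln_ge.
  have [ka ra st] : [/\ Num.sqrt (eps sigma) <= a, noise_ratio sigma (eps sigma) <= a &
      sigma <= Num.sqrt (Num.sqrt (eps sigma))].
    by near: sigma; exact: fast_regime_near.
  have sigma1 : sigma < 1 by near: sigma; exact: nbhs_right_lt.
  apply/andP; split.
    apply: (@limf_einf_ge _ _ _ _ _ neg0) => s s0.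
    exact: (fastP _ _ _ _ _ _ _ _ sigma0 (eps0 _ sigma0) s0 (sol _ _ sigma0 s0)).
  apply: (@limf_einf_le _ _ _ _ _ _ neg0) => s s0; apply: (@le_trans _ _ 1%E).
    apply: probability_le1.
    exact: (measurable_up sigma0 (eps0 _ sigma0) s0 (sol _ _ sigma0 s0) _ sigma1).
  by rewrite lee_fin lerDl ltW.
have slowP (zeta : R) : 0 < zeta -> \forall sigma \near 0^'+, forall s : R, s < 0 ->
    (`|p_up sigma s - (2^-1)%:E| <= zeta%:E)%E /\ (`|p_down sigma s - (2^-1)%:E| <= zeta%:E)%E.
  move=> zeta0; have [a /andP[a0 a1] slowP] := slow_probability zeta0.
  near=> sigma => s s0.
  have sigma0 : 0 < sigma by [].
  have sigmaa : sigma <= a by near: sigma; exact: nbhs_right_le.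
  have lna : a^-1 <= - ln sigma by near: sigma; exact: near0_ln_ge.
  have [ka ra kra st] : [/\ Num.sqrt (eps sigma) <= a, 1 <= a * noise_ratio sigma (eps sigma),
      Num.sqrt (eps sigma) * noise_ratio sigma (eps sigma) ^+ 2 <= a &
      sigma <= Num.sqrt (Num.sqrt (eps sigma))].
    by near: sigma; exact: slow_regime_near.
  have e0 := eps0 _ sigma0; have S := sol _ _ sigma0 s0.
  have sigma1 : sigma < 1 by near: sigma; exact: nbhs_right_lt.
  have [up down] := slowP _ _ _ _ _ _ _ _ sigma0 e0 s0 S sigmaa lna ka ra kra st.
  have mU := measurable_up sigma0 e0 s0 S (1 / 10) sigma1.
  have mD := measurable_down sigma0 e0 s0 S (1 / 10) sigma1.
  have -> : p_down sigma s = P sigma s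
      (follows_upper (fun t w => - q sigma s t w) (pull_time sigma (eps sigma)) (1 / 10)).
    by rewrite /p_down follows_lowerE.
  have := measureU (P sigma s) mU mD.
  rewrite follows_disjoint ?divr_gt0// => /(_ erefl) UD.
  have := probability_le1 (P sigma s) (measurableU _ _ mU mD); rewrite UD => le1.
  by split; [exact: near_half up down le1|rewrite addeC in le1; exact: near_half down up le1].
split; apply: ecvg0_squeeze => [sigma|zeta zeta0]; try exact: limf_esup_norm_ge0;
  apply: filterS (slowP _ zeta0) => sigma h;
  by apply: (@limf_esup_le _ _ _ _ _ neg0) => s s0; have [] := h _ s0.
Unshelve. all: by end_near.
Qed.
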